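(* In the ridge regression setting described in the context, suppose that $\|\Sigma\|_{op}\le C$ and $\mathbb{E}[Z_{ij}^{12}]<C$ for all $p$, for some fixed constant $C$. Then: 1. Writing $\gamma_p=p/n$ and $\lambda_p^*=\gamma_p\alpha^{-2}$, the finite-sample predictive risk satisfies $$r_{\lambda_p^*}(X)=1+\frac{\gamma_p}{p}\operatorname{tr}\left(\Sigma\left(\widehat\Sigma+\frac{\gamma_p}{\alpha^2}I_{p\times p}\right)^{-1}\right),$$ and it converges almost surely: $r_{\lambda_p^*}(X)\to R^*(H,\alpha^2,\gamma):=\dfrac{1}{\lambda^*v(-\lambda^* )}$, where $\lambda^*=\gamma\alpha^{-2}$. 2. Moreover, for any fixed $\lambda>0$, the predictive risk $r_\lambda(X)$ converges almost surely to $$R_\lambda(H,\alpha^2,\gamma)=\frac{1}{\lambda v(-\lambda)}\left\{1+\left(\frac{\lambda\alpha^2}{\gamma}-1\right)\left(1-\frac{\lambda v'(-\lambda)}{v(-\lambda)}\right)\right\}.$$ The choice $\lambda=\lambda^*$ minimizes $R_\lambda(H,\alpha^2,\gamma)$ over $\lambda>0$.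
   Context: Ridge regression setting. Consider a sequence of problems with $n\to\infty$, $p=p(n)\to\infty$ and $p/n\to\gamma\in(0,\infty)$. For each problem, $X=Z\Sigma^{1/2}\in\mathbb{R}^{n\times p}$, where $Z$ is $n\times p$ with i.i.d. entries satisfying $\mathbb{E}[Z_{ij}]=0$, $\operatorname{Var}(Z_{ij})=1$, and $\Sigma$ is a deterministic $p\times p$ positive semidefinite matrix. The spectral distribution of $\Sigma$ (the c.d.f. $F_\Sigma(x)=p^{-1}\sum_{i}\mathbf 1\{\lambda_i(\Sigma)\le x\}$) converges weakly to a probability distribution $H$ supported on $[0,\infty)$. The responses are $Y=Xw+\varepsilon\in\mathbb{R}^n$, where the entries of $\varepsilon$ are independent, centered, with variance $1$, and independent of all other random quantities. The weight vector $w\in\mathbb{R}^p$ is random, independent of the features, with $\mathbb{E}[w]=0$ and $\operatorname{Var}(w)=p^{-1}\alpha^2I_{p\times p}$, where $\alpha^2>0$ is fixed. For $\lambda>0$, $\hat w_\lambda=(X^\top X+\lambda nI_{p\times p})^{-1}X^\top Y$. The predictive risk is $r_\lambda(X)=\mathbb{E}[(y-\hat w_\lambda\cdot x)^2\mid X]$, where $(x,y)$ is an independent test example from the same distribution as the training data (i.e. $y=x\cdot w+\varepsilon_0$ with the same $w$, $x$ an independent copy of a row of $X$, $\varepsilon_0$ independent noise with mean $0$ and variance $1$). Write $\widehat\Sigma=n^{-1}X^\top X$. Stieltjes transforms. The spectral distribution of $\widehat\Sigma$ converges weakly almost surely to a deterministic distribution $F$ determined by $H$ and $\gamma$ (Marchenko–Pastur).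 Let $m(z)=\int\frac{dF(l)}{l-z}$ for $z\in\mathbb{C}\setminus[0,\infty)$. The companion Stieltjes transform $v(z)$ is the Stieltjes transform of the limiting spectral distribution of $n^{-1}XX^\top$; it satisfies $\gamma(m(z)+1/z)=v(z)+1/z$ and the Silverstein equation $-\frac1{v(z)}=z-\gamma\int\frac{t\,dH(t)}{1+tv(z)}$. For $\lambda>0$, $v'(-\lambda)$ denotes the derivative $v'(z)$ evaluated at $z=-\lambda$. *)

(* Defs.v *)
From HB Require Import structures.
From mathcomp Require Import all_boot all_order all_algebra.
From mathcomp Require Import complex.
From mathcomp Require Import all_classical all_reals all_analysis.

Set Implicit Arguments.
Unset Strict Implicit.
Unset Printing Implicit Defensive.

Import Order.TTheory GRing.Theory Num.Theory.
Import numFieldNormedType.Exports.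

Local Open Scope classical_set_scope.
Local Open Scope ring_scope.

Section LinearAlgebra.
Context {R : realType}.

Definition psd p (A : 'M[R]_p) : Prop :=
  A^T = A /\ forall u : 'cV[R]_p, 0 <= (u^T *m A *m u) 0 0.

Definition is_psd_sqrt p (S A : 'M[R]_p) : Prop := psd S /\ S *m S = A.

Definition norm2 p (u : 'cV[R]_p) : R := Num.sqrt (\sum_i u i 0 ^+ 2).

Definition opnorm p (A : 'M[R]_p) : R :=
  sup [set norm2 (A *m u) | u in [set u : 'cV[R]_p | norm2 u <= 1]].

(* Eigenvalues with multiplicity, in some order; the value is meaningful when
   the characteristic polynomial splits over R, e.g. for symmetric A. *)
Definition spectrum p (A : 'M[R]_p) : seq R :=
  xget [::] [set s | char_poly A = \prod_(a <- s) ('X - a%:P)].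

Definition spectral_cdf p (A : 'M[R]_p) (x : R) : R :=
  (count (fun a => a <= x) (spectrum A))%:R / p%:R.

Definition ridge n p (X : 'M[R]_(n, p)) (Y : 'cV[R]_n) (lambda : R) : 'cV[R]_p :=
  invmx (X^T *m X + (lambda * n%:R)%:M) *m X^T *m Y.

Definition sample_cov n p (X : 'M[R]_(n, p)) : 'M[R]_p := n%:R^-1 *: (X^T *m X).

End LinearAlgebra.

Section Probability.
Context {R : realType}.

Definition sigma_rv {T : Type} (X : T -> R) : set (set T) :=
  preimage_set_system setT X measurable.

Definition sigma_gen {I T : Type} (X : I -> T -> R) : set (set T) :=
  <<s \bigcup_i sigma_rv (X i) >>.

(* The generators in the hypothesis on B are the coordinate maps, so B ranges
   over the product sigma-algebra of R^I. *)
Definition same_law {d} {T : measurableType d} (P : probability T R) {I : Type}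
    (X Y : I -> T -> R) : Prop :=
  forall B : set (I -> R), sigma_gen (fun i (f : I -> R) => f i) B ->
    P ((fun t i => X i t) @^-1` B) = P ((fun t i => Y i t) @^-1` B).

Definition mutually_independent {d} {T : measurableType d}
    (P : probability T R) {I : finType} (G : I -> set (set T)) : Prop :=
  forall (J : {set I}) (A : I -> set T), (forall i, i \in J -> G i (A i)) ->
    P (\bigcap_(i in [set` J]) A i) = (\prod_(i in J) P (A i))%E.

(* g is a version of E[f | G]. *)
Definition is_cond_expectation {d} {T : measurableType d}
    (P : probability T R) (G : set (set T)) (f g : T -> R) : Prop :=
  [/\ forall B : set R, measurable B -> G (g @^-1` B),
      P.-integrable setT (EFin \o g) &
      forall A, G A ->
        (\int[P]_(t in A) (g t)%:E = \int[P]_(t in A) (f t)%:E)%E].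

Definition cdf_of (H : probability (measurableTypeR R) R) (x : R) : R :=
  fine (H [set t | t <= x]).

Definition weakly_converges (G : nat -> R -> R)
    (H : probability (measurableTypeR R) R) : Prop :=
  forall x, {for x, continuous (cdf_of H)} ->
    G n x @[n --> \oo] --> cdf_of H x.

End Probability.

Section StieltjesTransforms.
Context {R : realType}.
Local Open Scope complex_scope.
Implicit Types H F : probability (measurableTypeR R) R.

Definition cintegral (mu : probability (measurableTypeR R) R) (f : R -> R[i]) :
    R[i] :=
  (\int[mu]_t complex.Re (f t)) +i* (\int[mu]_t complex.Im (f t)).

Definition stieltjes F (z : R[i]) : R[i] := cintegral F (fun l => (l%:C - z)^-1).

(* The companion transform v, from gamma (m(z) + 1/z) = v(z) + 1/z. *)
Definition companion (gamma : R) F (z : R[i]) : R[i] :=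
  gamma%:C * (stieltjes F z + z^-1) - z^-1.

(* F is the Marchenko-Pastur law with population spectral distribution H and
   aspect ratio gamma: the law on [0, +oo[ whose companion transform solves the
   Silverstein equation off [0, +oo[. *)
Definition marchenko_pastur (gamma : R) H F : Prop :=
  F [set t | 0 <= t] = 1%E /\
  forall z : R[i], ~ (complex.Im z = 0 /\ 0 <= complex.Re z) ->
    - (companion gamma F z)^-1
    = z - gamma%:C * cintegral H (fun t => t%:C / (1 + t%:C * companion gamma F z)).

(* v(-lambda) and v'(-lambda); both are real, v' is the complex derivative. *)
Definition v_at (gamma : R) F (lambda : R) : R :=
  complex.Re (companion gamma F (- lambda)%:C).

Definition dv_at (gamma : R) F (lambda : R) : R :=
  complex.Re (derive1 (companion gamma F : R[i]^o -> R[i]^o) (- lambda)%:C).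

Definition limit_risk (gamma alpha : R) F (lambda : R) : R :=
  let v := v_at gamma F lambda in
  let v' := dv_at gamma F lambda in
  (lambda * v)^-1
  * (1 + (lambda * alpha ^+ 2 / gamma - 1) * (1 - lambda * v' / v)).

Definition optimal_limit_risk (gamma alpha : R) F : R :=
  let lambda := gamma / alpha ^+ 2 in (lambda * v_at gamma F lambda)^-1.

End StieltjesTransforms.

Section RidgeModel.
Context {R : realType} {d : measure_display} {T : measurableType d}
  (P : probability T R).

Record ridge_problem (n p : nat) := RidgeProblem {
  Sigma : 'M[R]_p ;
  sqrtSigma : 'M[R]_p ;
  Z : 'I_n -> 'I_p -> {RV P >-> R} ;
  weight : 'I_p -> {RV P >-> R} ;
  noise : 'I_n -> {RV P >-> R} ;
  test_x : 'I_p -> {RV P >-> R} ;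
  test_noise : {RV P >-> R}
}.

Section OneProblem.
Context {n p : nat} (M : ridge_problem n p).

Definition Xmx (t : T) : 'M[R]_(n, p) := (\matrix_(i, j) Z M i j t) *m sqrtSigma M.

Definition wvec (t : T) : 'cV[R]_p := \col_j weight M j t.

Definition Yvec (t : T) : 'cV[R]_n := Xmx t *m wvec t + \col_i noise M i t.

Definition x0 (t : T) : 'rV[R]_p := \row_j test_x M j t.

Definition y0 (t : T) : R := (x0 t *m wvec t) 0 0 + test_noise M t.

Definition sq_error (lambda : R) (t : T) : R :=
  (y0 t - (x0 t *m ridge (Xmx t) (Yvec t) lambda) 0 0) ^+ 2.

Definition sigma_X : set (set T) :=
  sigma_gen (fun (ij : 'I_n * 'I_p) t => Xmx t ij.1 ij.2).

Record ridge_setting (alpha : R) : Prop := RidgeSetting {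
  Sigma_psd : psd (Sigma M) ;
  sqrtSigmaP : is_psd_sqrt (sqrtSigma M) (Sigma M) ;
  Z_independent : mutually_independent P (fun ij : 'I_n * 'I_p =>
    sigma_rv (Z M ij.1 ij.2)) ;
  Z_same_law : forall i j i' j' (B : set R), measurable B ->
    P (Z M i j @^-1` B) = P (Z M i' j' @^-1` B) ;
  Z_mean : forall i j, 'E_P[Z M i j]%E = 0%E ;
  Z_variance : forall i j, 'V_P[Z M i j]%E = 1%E ;
  weight_mean : forall j, 'E_P[weight M j]%E = 0%E ;
  weight_covariance : forall j k,
    covariance P (weight M j) (weight M k)
    = (alpha ^+ 2 / p%:R *+ (j == k))%:E ;
  noise_independent : mutually_independent P (fun i : 'I_n =>
    sigma_rv (noise M i)) ;
  noise_mean : forall i, 'E_P[noise M i]%E = 0%E ;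
  noise_variance : forall i, 'V_P[noise M i]%E = 1%E ;
  test_x_law : forall i : 'I_n,
    same_law P (fun j => test_x M j : T -> R) (fun j t => Xmx t i j) ;
  test_noise_mean : 'E_P[test_noise M]%E = 0%E ;
  test_noise_variance : 'V_P[test_noise M]%E = 1%E ;
  blocks_independent : mutually_independent P (tnth [tuple
    sigma_X ;
    sigma_gen (fun j => weight M j : T -> R) ;
    sigma_gen (fun i => noise M i : T -> R) ;
    sigma_gen (fun j => test_x M j : T -> R) ;
    sigma_rv (test_noise M)])
}.

(* r is a version of the predictive risk E[(y - w_lambda . x)^2 | X]. *)
Definition is_predictive_risk (lambda : R) (r : T -> R) : Prop :=
  is_cond_expectation P sigma_X (sq_error lambda) r.

End OneProblem.
End RidgeModel.

(* Main.v *)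
Require Import Defs.
From HB Require Import structures.
From mathcomp Require Import all_boot all_order all_algebra.
From mathcomp Require Import complex spectral.
From mathcomp Require Import all_classical all_reals all_analysis.
From mathcomp Require Import measurable_realfun.
From mathcomp Require Import ring lra.

Set Implicit Arguments.
Unset Strict Implicit.
Unset Printing Implicit Defensive.

Import Order.TTheory GRing.Theory Num.Theory.
Import numFieldNormedType.Exports.

Local Open Scope classical_set_scope.
Local Open Scope ring_scope.

(** Write X for the data matrix, hS = X^T X / n for the sample covariance and
    Q = (hS + l)^-1 for its resolvent.

    The ridge estimator errs by l Q w - n^-1 Q X^T eps, a shrinkage bias plus
    noise [ridge_error].  Given X, the prediction error is therefore a sum of
    coefficients that depend on X, times products of independent centred
    variables whose covariances are known; squaring and conditioning keeps the
    diagonal terms only, and Q hS = 1 - l Q collects them into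
      r = 1 + tau + l (l alpha^2 / gamma_n - 1) tau',
    where tau = n^-1 tr (Sigma Q) and tau' = n^-1 tr (Sigma Q^2)
    [predictive_risk_formula, risk_decomposition].  At l = gamma_n / alpha^2 the
    second trace drops out, which is the finite-sample formula.

    It remains to find the almost sure limits of the two traces.
    - Changing one row of X changes hS by rank-one terms, hence tau by O(1/n);
      a martingale argument over the rows bounds the fourth central moment of
      tau by O(n^-2) [concentration], which is summable, so tau minus its mean
      tends to zero almost surely.
    - The mean m of tau nearly satisfies m = n^-1 tr (Sigma B), where B is the
      resolvent of Sigma / (1 + m) at l [taubar_fixed_point].  Indeed, by the
      Sherman-Morrison formula row i enters through the resolvent without that
      row, of which it is independent, and the corresponding quadratic form
      concentrates around its trace because the entries have bounded fourth
      moments [quadratic_form].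
    - With s = 1 / (l (1 + m)) this equation says that s is an approximate root
      of a function with slope at least l whose limit, by weak convergence of the
      spectra of Sigma, is the Silverstein equation at -l.  Its root is v(-l),
      so 1 + m tends to 1 / (l v(-l)) [fixed_point_limit].
    - Finally tau' is minus the derivative of tau in l, with second-order errors
      uniform in n; comparing difference quotients of tau and of its limit shows
      that tau' tends to minus the derivative of 1 / (l v(-l)), which is where
      v'(-l) comes from [ridge_trace2_limit].

    The traces are Lipschitz in l, so l may follow gamma_n / alpha^2.  Optimality
    of the limit is inherited from a deterministic inequality between the risks of
    each sample [resolvent_optimality]: the Bayes-optimal regularization beats all
    others before any limit is taken. *)

(** * Independence of blocks of events *)

Section Independence.
Context {R : realType} {d} {T : measurableType d} (P : probability T R).
Implicit Types (G : set (set T)).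

(** Phrased with generators because the blocks used below are unions of
    sigma-algebras, hence not sigma-algebras themselves. *)
Definition independent2 G1 G2 := forall A B, <<s G1 >> A -> <<s G2 >> B ->
  P (A `&` B) = (P A * P B)%E.

(** Dynkin's argument: for fixed [B], the events [A] that satisfy the product rule
    form a lambda-system, which contains the sigma-algebra of any pi-system it
    contains. *)
Lemma independent2_pi_left G1 (B : set T) :
  setI_closed G1 -> G1 `<=` measurable -> measurable B ->
  (forall A, G1 A -> P (A `&` B) = (P A * P B)%E) ->
  forall A, <<s G1 >> A -> P (A `&` B) = (P A * P B)%E.
Proof.
move=> GI Gm mB h.
have sGm : <<s G1 >> `<=` measurable.
  by apply: smallest_sub => //; exact: sigma_algebra_measurable.
pose D := [set A | measurable A /\ P (A `&` B) = (P A * P B)%E].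
suff : <<s G1 >> `<=` D by move=> sub A /sub [].
apply: lambda_system_subset => //; last first.
- by move=> A GA; split; [exact: Gm|exact: h].
split => //=.
- by split => //; rewrite setTI probability_setT mul1e.
- move=> X Y YX [mX HX] [mY HY]; split; first exact: measurableD.
  rewrite (_ : (X `\` Y) `&` B = (X `&` B) `\` (Y `&` B)); last first.
    by apply/seteqP; split=> x /=; tauto.
  rewrite !measureD//; try exact: measurableI; try by rewrite ltey_eq fin_num_measure//; exact: measurableI.
  rewrite (_ : (X `&` B) `&` (Y `&` B) = Y `&` B); last first.
    by apply/seteqP; split=> x /=; [tauto|move=> [Yx Bx]; have := YX _ Yx; tauto].
  rewrite (_ : X `&` Y = Y); last by apply/setIidPr.
  transitivity (P X * P B - P Y * P B)%E; first by congr (_ - _)%E; [exact: HX|exact: HY].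
  rewrite muleBl ?fin_num_measure//.
  by rewrite fin_num_adde_defl// fin_numN fin_num_measure.
- move=> F ndF FD; split; first by apply: bigcup_measurable => i _; case: (FD i).
  have mF i : measurable (F i) by case: (FD i).
  have ndFB : nondecreasing_seq (fun i => F i `&` B).
    by move=> i j ij; apply/subsetPset; apply: setSI; apply/subsetPset; exact: ndF.
  rewrite setI_bigcupl.
  have c1 : P (F i `&` B) @[i --> \oo] --> P (\bigcup_i (F i `&` B)).
    apply: nondecreasing_cvg_mu => //; first by move=> i; exact: measurableI.
    by apply: bigcup_measurable => i _; exact: measurableI.
  have c2 : P (F i) @[i --> \oo] --> P (\bigcup_i F i).
    by apply: nondecreasing_cvg_mu => //; exact: bigcup_measurable.
  have c3 : (P (F i) * P B)%E @[i --> \oo] --> (P (\bigcup_i F i) * P B)%E.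
    by apply: cvgeZr => //; rewrite fin_num_measure.
  have e : (fun i => P (F i `&` B)) = (fun i => (P (F i) * P B)%E).
    by apply/funext => i; case: (FD i).
  by rewrite e in c1; exact: cvg_unique c1 c3.
Qed.

Lemma independent2_pi G1 G2 : setI_closed G1 -> setI_closed G2 ->
  G1 `<=` measurable -> G2 `<=` measurable ->
  (forall A B, G1 A -> G2 B -> P (A `&` B) = (P A * P B)%E) ->
  independent2 G1 G2.
Proof.
move=> I1 I2 m1 m2 h A B sA sB.
have s1 : <<s G1 >> `<=` measurable.
  by apply: smallest_sub => //; exact: sigma_algebra_measurable.
rewrite setIC muleC; apply: (independent2_pi_left I2 m2 _ _ sB); first exact: s1.
move=> C GC; rewrite setIC muleC; apply: (independent2_pi_left I1 m1 _ _ sA); first exact: m2.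
by move=> D GD; exact: h.
Qed.

Section Grouping.
Context {I : finType} (G : I -> set (set T)).
Hypothesis G_setI : forall i, setI_closed (G i).
Hypothesis G_setT : forall i, G i setT.
Hypothesis G_measurable : forall i, G i `<=` measurable.
Hypothesis G_independent : mutually_independent P G.

Definition gen_over (J : {set I}) : set (set T) := \bigcup_(i in [set` J]) G i.

(** The pi-system that generates the same sigma-algebra as [gen_over J]: the union
    itself is not closed under intersection. *)
Definition cylinders (J : {set I}) : set (set T) :=
  [set A | exists2 F : I -> set T, (forall i, G i (F i)) &
     A = \bigcap_(i in [set` J]) F i].

Lemma cylinders_setI J : setI_closed (cylinders J).
Proof.
move=> _ _ [F GF ->] [F' GF' ->]; exists (fun i => F i `&` F' i).
  by move=> i; exact: G_setI.
by rewrite bigcapI.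
Qed.

Lemma cylinders_measurable J : cylinders J `<=` measurable.
Proof.
move=> _ [F GF ->]; apply: fin_bigcap_measurable => // i _; exact: G_measurable.
Qed.

Lemma gen_over_cylinders J : gen_over J `<=` cylinders J.
Proof.
move=> A [i /= iJ GA]; exists (fun k => if k == i then A else setT).
  by move=> k; case: eqP => [->|].
apply/seteqP; split=> [x Ax k _ /=|x /(_ i iJ)]; last by rewrite eqxx.
by case: eqP.
Qed.

(** On cylinders over disjoint index sets the product rule is the hypothesis of
    mutual independence for [J :|: K], the product over which splits. *)
Lemma independent2_gen_over (J K : {set I}) : {in J, forall i, i \notin K} ->
  independent2 (gen_over J) (gen_over K).
Proof.
move=> JK A B sA sB.
have mono L : <<s gen_over L >> `<=` <<s cylinders L >>.
  exact: sub_sigma_algebra2 (gen_over_cylinders (J := L)).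
apply: (@independent2_pi (cylinders J) (cylinders K)); last 2 first.
- exact: mono.
- exact: mono.
- exact: cylinders_setI.
- exact: cylinders_setI.
- exact: cylinders_measurable.
- exact: cylinders_measurable.
move=> _ _ [F GF ->] [F' GF' ->].
pose H i := if i \in J then F i else F' i.
have GH i : G i (H i) by rewrite /H; case: ifP.
have HJ : \bigcap_(i in [set` J]) F i = \bigcap_(i in [set` J]) H i.
  by apply: eq_bigcapr => i /= iJ; rewrite /H iJ.
have HK : \bigcap_(i in [set` K]) F' i = \bigcap_(i in [set` K]) H i.
  apply: eq_bigcapr => i /= iK; rewrite /H; case: ifPn => // /JK.
  by rewrite iK.
rewrite HJ HK -bigcap_setU.
rewrite (_ : [set` J] `|` [set` K] = [set` (J :|: K)%SET]); last first.
  by apply/seteqP; split=> x /=; rewrite inE => /orP.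
rewrite !G_independent// (big_setID J)/=; congr (_ * _)%E.
  by apply: eq_bigl => i; rewrite !inE; case: (i \in J); rewrite ?andbF.
apply: eq_bigl => i; rewrite !inE; case: (boolP (i \in J)) => //= iJ.
by rewrite (negbTE (JK _ iJ)).
Qed.

End Grouping.

End Independence.

(** * Decoupling two independent blocks *)

Section Decoupling.
Context {R : realType} {d} {T : measurableType d} (P : probability T R).
Implicit Types (G : set (set T)).

Definition measurable_wrt G (f : T -> R) :=
  @measurable_fun _ _ (g_sigma_algebraType G) _ setT f.

Definition Rintegrable (f : T -> R) := P.-integrable setT (EFin \o f).

Definition Ex (f : T -> R) : R := \int[P]_t f t.

Section Coarsening.
Context G (Gm : G `<=` measurable).

(** The identity, seen as a map onto the measurable space that carries only the
    sigma-algebra of [G]: product measures can then treat [G] as the measurable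
    structure of a factor. *)
Definition coarsen : T -> g_sigma_algebraType G := id.

Lemma measurable_coarsen : measurable_fun setT coarsen.
Proof.
move=> _ A mA; rewrite setTI; move: A mA.
by apply: smallest_sub => //; exact: sigma_algebra_measurable.
Qed.

HB.instance Definition _ := isMeasurableFun.Build _ _ _ _ coarsen measurable_coarsen.

Lemma measurable_wrt_measurable f : measurable_wrt G f -> measurable_fun setT f.
Proof. by move=> mf; exact: (measurableT_comp mf measurable_coarsen). Qed.

Definition coarse_law : probability (g_sigma_algebraType G) R :=
  distribution P coarsen.

Lemma coarse_law_integral (f : T -> \bar R) :
  @measurable_fun _ _ (g_sigma_algebraType G) _ setT f -> P.-integrable setT f ->
  (\int[coarse_law]_(x in setT) f x = \int[P]_x f x)%E.
Proof. by move=> mf fi; rewrite integral_distribution. Qed.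

Lemma coarse_law_integrable (f : T -> \bar R) :
  @measurable_fun _ _ (g_sigma_algebraType G) _ setT f -> P.-integrable setT f ->
  coarse_law.-integrable setT f.
Proof. by move=> mf fi; apply: integrable_pushforward => //; exact: measurable_coarsen. Qed.

End Coarsening.

Section TwoBlocks.
Context G1 G2 (Gm1 : G1 `<=` measurable) (Gm2 : G2 `<=` measurable).
Hypothesis G12 : independent2 P G1 G2.

Let T1 := g_sigma_algebraType G1.
Let T2 := g_sigma_algebraType G2.

Definition diagonal (t : T) : T1 * T2 := (coarsen G1 t, coarsen G2 t).

Lemma measurable_diagonal : measurable_fun setT diagonal.
Proof. by apply: measurable_fun_pair; exact: measurable_coarsen. Qed.

HB.instance Definition _ := isMeasurableFun.Build _ _ _ _ diagonal measurable_diagonal.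

(** Independence of [G1] and [G2] is exactly the statement that the diagonal map
    has the product law, so that integrals on [T] become iterated integrals. *)
Lemma diagonal_law (X : set (T1 * T2)) : measurable X ->
  (coarse_law Gm1 \x coarse_law Gm2)%E X = distribution P diagonal X.
Proof.
apply: product_measure_unique => A B mA mB.
rewrite /distribution /pushforward /= /pushforward.
by rewrite -[RHS]G12.
Qed.

Lemma integral_diagonal (f : T1 * T2 -> \bar R) : measurable_fun setT f ->
  P.-integrable setT (f \o diagonal) ->
  (\int[coarse_law Gm1 \x coarse_law Gm2]_z f z = \int[P]_t f (diagonal t))%E.
Proof.
move=> mf fi; rewrite -(integral_distribution mf fi).
by apply: eq_measure_integral => X mX _; exact: diagonal_law.
Qed.

Lemma ge0_integral_diagonal (f : T1 * T2 -> \bar R) : measurable_fun setT f ->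
  (forall z, 0 <= f z)%E ->
  (\int[coarse_law Gm1 \x coarse_law Gm2]_z f z = \int[P]_t f (diagonal t))%E.
Proof.
move=> mf f0; rewrite -(ge0_integral_distribution diagonal mf f0).
by apply: eq_measure_integral => X mX _; exact: diagonal_law.
Qed.

Lemma Rintegrable_bounded (f : T -> R) K :
  measurable_fun setT f -> (forall t, `|f t| <= K) -> Rintegrable f.
Proof.
move=> mf fK; apply: measurable_bounded_integrable => //.
  exact: le_lt_trans (probability_le1 P measurableT) (ltry _).
exists K; split; first by rewrite num_real.
by move=> M KM t _; apply: le_trans (fK t) (ltW KM).
Qed.

Lemma Ex_fin f : Rintegrable f -> (\int[P]_t (f t)%:E)%E = (Ex f)%:E.
Proof. by move=> fi; rewrite /Ex /Rintegral fineK//; exact: integrable_fin_num. Qed.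

Lemma prod_law_finite :
  ((coarse_law Gm1 \x coarse_law Gm2) [set: T1 * T2] < +oo)%E.
Proof.
rewrite -setXTT product_measure1E//.
apply: (@le_lt_trans _ _ (1 * 1)%E); last by rewrite mule1 ltry.
by apply: lee_pmul => //; exact: (probability_le1 (coarse_law _)).
Qed.

Lemma decouple_measurable (h : T -> T -> R) K :
  measurable_fun setT (fun z : T1 * T2 => h z.1 z.2) ->
  (forall x y, `|h x y| <= K) ->
  measurable_wrt G2 (fun y => Ex (fun x => h x y)).
Proof.
move=> mh hK.
pose f (z : T1 * T2) := (h z.1 z.2)%:E.
have mf : measurable_fun setT f by exact/measurable_EFinP.
have fint : (coarse_law Gm1 \x coarse_law Gm2)%E.-integrable setT f.
  apply: measurable_bounded_integrable => //.
    exact: prod_law_finite.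
  exists K; split; first by rewrite num_real.
  by move=> M KM t _; apply: le_trans (hK _ _) (ltW KM).
have := measurable_fubini_G fint => mG.
have mg : measurable_wrt G2 (fine \o fubini_G (coarse_law Gm1) f).
  exact: (measurableT_comp (@fine_measurable _ setT measurableT) mG).
move: mg; rewrite /measurable_wrt; apply: eq_measurable_fun => y _ /=.
rewrite /Ex /Rintegral /fubini_G coarse_law_integral//.
  exact: (measurable_fun_pair1 y mf).
apply: (@Rintegrable_bounded (fun x => h x y) K) => //.
apply: (@measurable_wrt_measurable G1) => //.
exact: (measurable_fun_pair1 y mh).
Qed.

(** When [h x y] depends on [x] through [G1] and on [y] through [G2], the two
    arguments may be averaged one after the other, over independent copies.  The
    inner mean is thus a conditional expectation given [G2]. *)
Lemma decouple (h : T -> T -> R) K :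
  measurable_fun setT (fun z : T1 * T2 => h z.1 z.2) ->
  (forall x y, `|h x y| <= K) ->
  Ex (fun t => h t t) = Ex (fun y => Ex (fun x => h x y)).
Proof.
move=> mh hK.
pose f (z : T1 * T2) := (h z.1 z.2)%:E.
have mf : measurable_fun setT f by exact/measurable_EFinP.
have fint : (coarse_law Gm1 \x coarse_law Gm2)%E.-integrable setT f.
  apply: measurable_bounded_integrable => //.
    exact: prod_law_finite.
  exists K; split; first by rewrite num_real.
  by move=> M KM t _; apply: le_trans (hK _ _) (ltW KM).
have hd : Rintegrable (fun t => h t t).
  apply: (@Rintegrable_bounded _ K) => //.
  exact: (measurableT_comp mh measurable_diagonal).
have hx (y : T2) : Rintegrable (fun x => h x y).
  apply: (@Rintegrable_bounded _ K) => //.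
  apply: (@measurable_wrt_measurable G1) => //.
  exact: (measurable_fun_pair1 y mh).
apply/EFin_inj; rewrite -Ex_fin//.
rewrite -(integral_diagonal (f := f))// -integral21_prod_meas1//.
rewrite /fubini_G.
transitivity (\int[coarse_law Gm2]_y (Ex (fun x => h x y))%:E)%E.
  apply: eq_integral => y _; rewrite -Ex_fin//; apply: coarse_law_integral; last exact: hx.
  exact: (measurable_fun_pair1 y mf).
have mE := decouple_measurable mh hK.
have iE : Rintegrable (fun y => Ex (fun x => h x y)).
  apply: (@Rintegrable_bounded _ K); first exact: measurable_wrt_measurable mE.
  move=> y; apply: le_trans (le_normr_Rintegral _ (hx y)) _ => //.
  apply: (@le_trans _ _ (\int[P]_t K)); last first.
    rewrite Rintegral_cst//= probability_setT/= mulr1//.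
  apply: le_Rintegral => //.
    exact: integrable_norm (hx y).
  apply: (@Rintegrable_bounded (cst K) `|K|) => //.
rewrite -Ex_fin//; apply: coarse_law_integral; last exact: iE.
exact/measurable_EFinP.
Qed.

Lemma independent2_integrable_mul (f g : T -> R) :
  measurable_wrt G1 f -> measurable_wrt G2 g ->
  Rintegrable f -> Rintegrable g ->
  Rintegrable (fun t => f t * g t) /\
  Ex (fun t => f t * g t) = Ex f * Ex g.
Proof.
move=> mf mg fi gi.
pose F (z : T1 * T2) := (f z.1 * g z.2)%:E.
have mF : measurable_fun setT F.
  apply/measurable_EFinP; apply: measurable_funM.
    exact: (measurableT_comp mf measurable_fst).
  exact: (measurableT_comp mg measurable_snd).
have cf : (coarse_law Gm1).-integrable setT (EFin \o f).
  by apply: coarse_law_integrable => //; exact/measurable_EFinP.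
have cg : (coarse_law Gm2).-integrable setT (EFin \o g).
  by apply: coarse_law_integrable => //; exact/measurable_EFinP.
have Fi : (coarse_law Gm1 \x coarse_law Gm2)%E.-integrable setT F.
  apply/integrable21ltyP => //.
  rewrite (_ : (fun y => _) = (fun y => `|(g y)%:E| *
      \int[coarse_law Gm1]_x `|(f x)%:E|)%E); last first.
    apply/funext => y; rewrite -ge0_integralZl//.
    - by apply: eq_integral => x _; rewrite /F /= normrM mulrC.
    - by apply: measurableT_comp => //; exact/measurable_EFinP.
  rewrite ge0_integralZr//; last 2 first.
  - by apply: measurableT_comp => //; exact/measurable_EFinP.
  - by apply: integral_ge0.
  have [_ ?] := integrableP _ _ _ cf; have [_ ?] := integrableP _ _ _ cg.
  by rewrite lte_mul_pinfty// ?integral_ge0// ge0_fin_numE// integral_ge0.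
have fgi : Rintegrable (fun t => f t * g t).
  apply/integrableP; split.
    exact: (measurableT_comp mF measurable_diagonal).
  have [_] := integrableP _ _ _ Fi.
  rewrite (ge0_integral_diagonal (f := fun z => `|F z|%E))//.
  exact: measurableT_comp.
split=> //; apply/EFin_inj; rewrite -Ex_fin//.
rewrite -(integral_diagonal (f := F))// -integral21_prod_meas1//.
have FG y : (fubini_G (coarse_law Gm1) F y = (Ex f)%:E * (g y)%:E)%E.
  rewrite -Ex_fin// -(coarse_law_integral Gm1 (f := EFin \o f)) //; last first.
    exact/measurable_EFinP.
  rewrite muleC -integralZl//; apply: eq_integral => x _.
  by rewrite /F /= EFinM muleC.
rewrite (eq_integral _ _ (fun y _ => FG y)).
rewrite integralZl// EFinM; congr (_ * _)%E.
rewrite -Ex_fin//; apply: coarse_law_integral => //.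
exact/measurable_EFinP.
Qed.

End TwoBlocks.
End Decoupling.

(** * Expectations and products over independent families *)

Section ExpectationRules.
Context {R : realType} {d} {T : measurableType d} (P : probability T R).
Implicit Types (f g : T -> R).
Local Notation Rintegrable := (Rintegrable P).
Local Notation Ex := (Ex P).

Lemma Rintegrable_measurable f : Rintegrable f -> measurable_fun setT f.
Proof. by move/integrableP => [/measurable_EFinP]. Qed.

Lemma Rintegrable_cst c : Rintegrable (fun=> c).
Proof. by apply: (@Rintegrable_bounded _ _ _ _ _ `|c|). Qed.

Lemma RintegrableD f g : Rintegrable f -> Rintegrable g ->
  Rintegrable (fun t => f t + g t).
Proof. by move=> fi gi; exact: (integrableD measurableT fi gi). Qed.

Lemma RintegrableB f g : Rintegrable f -> Rintegrable g ->
  Rintegrable (fun t => f t - g t).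
Proof. by move=> fi gi; exact: (integrableB measurableT fi gi). Qed.

Lemma RintegrableZl c f : Rintegrable f -> Rintegrable (fun t => c * f t).
Proof. by move=> fi; exact: (integrableZl measurableT c fi). Qed.

Lemma Rintegrable_abs f : Rintegrable f -> Rintegrable (fun t => `|f t|).
Proof. exact: integrable_norm. Qed.

Lemma Rintegrable_le f g : measurable_fun setT f -> (forall t, `|f t| <= g t) ->
  Rintegrable g -> Rintegrable f.
Proof.
move=> mf fg gi; apply: (le_integrable _ _ _ gi) => //.
  exact/measurable_EFinP.
by move=> t _ /=; rewrite lee_fin (le_trans (fg t))// ler_norm.
Qed.

Lemma eq_Rintegrable f g : f =1 g -> Rintegrable f -> Rintegrable g.
Proof. by move=> /funext ->. Qed.

Lemma Rintegrable_sum (I : Type) (s : seq I) (A : pred I) (F : I -> T -> R) :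
  (forall i, Rintegrable (F i)) -> Rintegrable (fun t => \sum_(i <- s | A i) F i t).
Proof.
move=> Fi; elim: s => [|i s IH].
  by apply: (@eq_Rintegrable (fun=> 0)) => [t|]; [rewrite big_nil|exact: Rintegrable_cst].
pose h t := \sum_(j <- s | A j) F j t.
apply: (@eq_Rintegrable (fun t => if A i then F i t + h t else h t)) => [t|].
  by rewrite big_cons.
by case: (A i) => //; exact: RintegrableD.
Qed.

Lemma Ex_cst c : Ex (fun=> c) = c.
Proof. by rewrite /Ex Rintegral_cst//= probability_setT mulr1. Qed.

Lemma eq_Ex f g : f =1 g -> Ex f = Ex g.
Proof. by move=> /funext ->. Qed.

Lemma ExD f g : Rintegrable f -> Rintegrable g ->
  Ex (fun t => f t + g t) = Ex f + Ex g.
Proof. by move=> fi gi; apply: RintegralD. Qed.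

Lemma ExB f g : Rintegrable f -> Rintegrable g ->
  Ex (fun t => f t - g t) = Ex f - Ex g.
Proof. by move=> fi gi; apply: RintegralB. Qed.

Lemma ExZl c f : Rintegrable f -> Ex (fun t => c * f t) = c * Ex f.
Proof. by move=> fi; apply: RintegralZl. Qed.

Lemma Ex_sum (I : Type) (s : seq I) (A : pred I) (F : I -> T -> R) :
  (forall i, Rintegrable (F i)) ->
  Ex (fun t => \sum_(i <- s | A i) F i t) = \sum_(i <- s | A i) Ex (F i).
Proof.
move=> Fi; elim: s => [|i s IH].
  by under eq_Ex do rewrite big_nil; rewrite Ex_cst big_nil.
under eq_Ex do rewrite big_cons; rewrite big_cons.
by case: ifP => // _; rewrite ExD ?IH//; exact: Rintegrable_sum.
Qed.

Lemma Ex_le f g : Rintegrable f -> Rintegrable g -> (forall t, f t <= g t) ->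
  Ex f <= Ex g.
Proof. by move=> fi gi fg; apply: le_Rintegral. Qed.

Lemma Ex_ge0 f : (forall t, 0 <= f t) -> 0 <= Ex f.
Proof. by move=> f0; apply: Rintegral_ge0. Qed.

Lemma Ex_abs f : Rintegrable f -> `|Ex f| <= Ex (fun t => `|f t|).
Proof. by move=> fi; apply: le_normr_Rintegral. Qed.

Lemma Ex_bounded f K : Rintegrable f -> (forall t, `|f t| <= K) -> `|Ex f| <= K.
Proof.
move=> fi fK; apply: le_trans (Ex_abs fi) _; rewrite -[leRHS](Ex_cst K).
by apply: Ex_le fK; [exact: Rintegrable_abs|exact: Rintegrable_cst].
Qed.

Lemma Rintegrable_mul f g : measurable_fun setT f -> measurable_fun setT g ->
  Rintegrable (fun t => f t ^+ 2) -> Rintegrable (fun t => g t ^+ 2) ->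
  Rintegrable (fun t => f t * g t).
Proof.
move=> mf mg fi gi; apply: (Rintegrable_le _ _ (RintegrableD fi gi)).
  exact: measurable_funM.
move=> t; rewrite normrM -[f t ^+ 2]real_normK ?num_real//.
rewrite -[g t ^+ 2]real_normK ?num_real//.
have := sqr_ge0 (`|f t| - `|g t|); have := normr_ge0 (f t).
by have := normr_ge0 (g t); nra.
Qed.

Lemma measurable_wrt_sub (G G' : set (set T)) f : G `<=` <<s G' >> ->
  measurable_wrt G f -> measurable_wrt G' f.
Proof.
move=> GG' mf _ A mA; rewrite setTI.
have : <<s G >> `<=` <<s G' >>.
  by apply: smallest_sub => //; exact: smallest_sigma_algebra.
by apply; rewrite -[X in <<s G >> X]setTI; exact: mf.
Qed.

Lemma sigma_rv_measurable_wrt (G : set (set T)) f : sigma_rv f `<=` G ->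
  measurable_wrt G f.
Proof.
move=> fG _ A mA; apply: sub_sigma_algebra; apply: fG.
by exists A.
Qed.

End ExpectationRules.

Section FamilyProducts.
Context {R : realType} {d} {T : measurableType d} (P : probability T R).
Context {I : finType} (G : I -> set (set T)).
Hypothesis G_sigma : forall i, sigma_algebra setT (G i).
Hypothesis G_measurable : forall i, G i `<=` measurable.
Hypothesis G_independent : mutually_independent P G.
Local Notation Rintegrable := (Rintegrable P).
Local Notation Ex := (Ex P).

Lemma family_setT i : G i setT.
Proof.
have [G0 GC _] := G_sigma i.
by rewrite -(setD0 setT); exact: GC.
Qed.

Lemma family_setI i : setI_closed (G i).
Proof.
move=> A B GA GB.
rewrite -(sigma_algebra_id (G_sigma i)) in GA GB *.
exact: (@measurableI _ (g_sigma_algebraType (G i))).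
Qed.

Lemma gen_over_measurable J : gen_over G J `<=` measurable.
Proof. by move=> A [i _ GA]; exact: G_measurable GA. Qed.

Lemma gen_over_sub (J K : {set I}) : J \subset K -> gen_over G J `<=` gen_over G K.
Proof. by move=> /fintype.subsetP JK A [i /= iJ GA]; exists i => //=; exact: JK. Qed.

Lemma gen_over_independent2 (J K : {set I}) : {in J, forall i, i \notin K} ->
  independent2 P (gen_over G J) (gen_over G K).
Proof.
by move=> JK; apply: independent2_gen_over => //; [exact: family_setI|exact: family_setT].
Qed.

Lemma gen_over_measurable_wrt (J : {set I}) i (f : T -> R) : i \in J ->
  measurable_wrt (G i) f -> measurable_wrt (gen_over G J) f.
Proof.
move=> iJ; apply: measurable_wrt_sub => A GA; apply: sub_sigma_algebra.
by exists i.
Qed.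

(** One factor is independent of the product of the others, which is measurable
    with respect to the remaining members of the family; peel them off one by
    one. *)
Lemma independent_prod (f : I -> T -> R) (s : seq I) :
  (forall i, measurable_wrt (G i) (f i)) -> (forall i, Rintegrable (f i)) -> uniq s ->
  Rintegrable (fun t => \prod_(i <- s) f i t) /\
  Ex (fun t => \prod_(i <- s) f i t) = \prod_(i <- s) Ex (f i).
Proof.
move=> mf fi; elim: s => [_|i s IH /= /andP[nis us]].
  split; last by under eq_Ex do rewrite big_nil; rewrite big_nil Ex_cst.
  apply: (@eq_Rintegrable _ _ _ _ (fun=> 1)) => [t|]; [by rewrite big_nil|].
  exact: Rintegrable_cst.
have [si sE] := IH us.
pose J := [set i]%SET; pose K := [set j in s]%SET.
have JK : {in J, forall j, j \notin K} by move=> j; rewrite !inE => /eqP ->.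
have m1 : measurable_wrt (gen_over G J) (f i).
  by apply: gen_over_measurable_wrt (mf i); rewrite inE.
have m2 : measurable_wrt (gen_over G K) (fun t => \prod_(j <- s) f j t).
  apply: measurable_prod => j js; apply: gen_over_measurable_wrt (mf j).
  by rewrite inE.
have [] := independent2_integrable_mul (@gen_over_measurable J)
  (@gen_over_measurable K) (gen_over_independent2 JK) m1 m2 (fi i) si.
move=> h1 h2; split.
  by apply: (eq_Rintegrable _ h1) => t; rewrite big_cons.
by under eq_Ex do rewrite big_cons; rewrite h2 big_cons sE.
Qed.

End FamilyProducts.

(** * Concentration under bounded differences *)

Lemma sigma_rv_sigma_algebra {R : realType} {T : Type} (f : T -> R) :
  sigma_algebra setT (sigma_rv f).
Proof. by apply: sigma_algebra_preimage; exact: sigma_algebra_measurable. Qed.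

Lemma sigma_rv_measurable {R : realType} {d} {T : measurableType d} (f : T -> R) :
  measurable_fun setT f -> sigma_rv f `<=` measurable.
Proof. by move=> mf _ [A mA <-]; exact: mf. Qed.

Lemma measurable_ext {d d'} {T : measurableType d} {T' : measurableType d'}
  (f g : T -> T') : f =1 g -> measurable_fun setT f -> measurable_fun setT g.
Proof. by move=> /funext ->. Qed.

Definition measurable_mx {R : realType} {d} {T : measurableType d} {n p}
  (W : T -> 'M[R]_(n, p)) := forall i j, measurable_fun setT (fun t => W t i j).

Section BoundedDifferences.
Context {R : realType} {d} {T : measurableType d} (P : probability T R).
Context {n p : nat} (Z : 'I_n -> 'I_p -> T -> R).
Hypothesis mZ : forall i j, measurable_fun setT (Z i j).
Let G (ij : 'I_n * 'I_p) := sigma_rv (Z ij.1 ij.2).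
Hypothesis Z_indep : mutually_independent P G.
Local Notation Rintegrable := (Rintegrable P).
Local Notation Ex := (Ex P).

Context (Phi : 'M[R]_(n, p) -> R) (K c : R).
(** Asked for every measurable type because [Phi] is also evaluated on matrices whose
    rows come from two copies of [T], each with a coarser sigma-algebra. *)
Hypothesis Phi_measurable : forall d' (T' : measurableType d') (W : T' -> 'M[R]_(n, p)),
  measurable_mx W -> measurable_fun setT (fun t => Phi (W t)).
Hypothesis Phi_bounded : forall W, `|Phi W| <= K.
Hypothesis Phi_diff : forall (i : 'I_n) (U V : 'M[R]_(n, p)),
  (forall i' j, i' != i -> U i' j = V i' j) -> `|Phi U - Phi V| <= c.

Definition Zmx (t : T) : 'M[R]_(n, p) := \matrix_(i, j) Z i j t.

Definition mix_rows (k : nat) (U V : 'M[R]_(n, p)) : 'M[R]_(n, p) :=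
  \matrix_(i, j) if (i < k)%N then U i j else V i j.

Definition rows_below (k : nat) : {set 'I_n * 'I_p} := [set ij : 'I_n * 'I_p | (ij.1 < k)%N]%SET.
Definition rows_from (k : nat) : {set 'I_n * 'I_p} := [set ij : 'I_n * 'I_p | (k <= ij.1)%N]%SET.

(** A version of the conditional expectation of [Phi] given the rows from [k] on: the
    rows below [k] are averaged over an independent copy.  It interpolates between
    [Phi] at [k = 0] and its mean at [k = n]. *)
Definition partial_mean (k : nat) (t : T) : R :=
  Ex (fun s => Phi (mix_rows k (Zmx s) (Zmx t))).

Let Gs ij : sigma_algebra setT (G ij).
Proof. exact: sigma_rv_sigma_algebra. Qed.
Let Gm ij : G ij `<=` measurable.
Proof. exact: sigma_rv_measurable. Qed.

Let blocks_indep k : independent2 P (gen_over G (rows_below k)) (gen_over G (rows_from k)).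
Proof.
apply: gen_over_independent2 => // ij; rewrite !inE => h.
by rewrite -ltnNge.
Qed.

Let Gbm k := gen_over_measurable Gm (J := rows_below k).
Let Gfm k := gen_over_measurable Gm (J := rows_from k).

Lemma entry_measurable_wrt (J : {set 'I_n * 'I_p}) i j : (i, j) \in J ->
  measurable_wrt (gen_over G J) (Z i j).
Proof.
move=> ijJ; apply: (gen_over_measurable_wrt (i := (i, j))) => //.
exact: sigma_rv_measurable_wrt.
Qed.

Lemma mix_measurable k :
  measurable_mx (fun z : g_sigma_algebraType (gen_over G (rows_below k)) *
                         g_sigma_algebraType (gen_over G (rows_from k)) =>
    mix_rows k (Zmx z.1) (Zmx z.2)).
Proof.
move=> i j.
have [ik|ki] := boolP (i < k)%N.
  rewrite (_ : (fun z => _) = (fun z => Z i j z.1)); last first.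
    by apply/funext => z; rewrite !mxE ik.
  have mij : measurable_wrt (gen_over G (rows_below k)) (Z i j).
    by apply: entry_measurable_wrt; rewrite inE.
  exact: (measurableT_comp mij measurable_fst).
rewrite (_ : (fun z => _) = (fun z => Z i j z.2)); last first.
  by apply/funext => z; rewrite !mxE (negbTE ki).
have mij : measurable_wrt (gen_over G (rows_from k)) (Z i j).
  by apply: entry_measurable_wrt; rewrite inE leqNgt.
exact: (measurableT_comp mij measurable_snd).
Qed.

Lemma Zmx_measurable : measurable_mx Zmx.
Proof.
by move=> i j; apply: (measurable_ext (f := Z i j)) => [t|]; rewrite ?mxE//; exact: mZ.
Qed.

Lemma mix_section_measurable k t : measurable_fun setT (fun s => Phi (mix_rows k (Zmx s) (Zmx t))).
Proof.
apply: Phi_measurable => i j.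
apply: (measurable_ext (f := fun s => if (i < k)%N then Z i j s else Z i j t)) => [s /=|].
  by rewrite /mix_rows /Zmx !mxE.
by case: (i < k)%N; [exact: mZ|exact: measurable_cst].
Qed.

Lemma mix_section_integrable k t : Rintegrable (fun s => Phi (mix_rows k (Zmx s) (Zmx t))).
Proof. by apply: (@Rintegrable_bounded _ _ _ _ _ K) => //; exact: mix_section_measurable. Qed.

Lemma partial_mean_measurable k : measurable_wrt (gen_over G (rows_from k)) (partial_mean k).
Proof.
apply: (decouple_measurable P (@Gbm k) (@Gfm k) (K := K)) => //.
exact: Phi_measurable (@mix_measurable k).
Qed.

Lemma partial_mean_bounded k t : `|partial_mean k t| <= K.
Proof. by apply: Ex_bounded => //; exact: mix_section_integrable. Qed.

Lemma partial_mean0 t : partial_mean 0 t = Phi (Zmx t).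
Proof.
rewrite -[RHS](Ex_cst P); apply: eq_Ex => s; congr (Phi _).
by apply/matrixP => i j; rewrite !mxE.
Qed.

Lemma partial_meann t : partial_mean n t = Ex (fun s => Phi (Zmx s)).
Proof.
apply: eq_Ex => s; congr (Phi _).
by apply/matrixP => i j; rewrite !mxE ltn_ord.
Qed.

Lemma partial_mean_step k t : (k < n)%N ->
  `|partial_mean k t - partial_mean k.+1 t| <= c.
Proof.
move=> kn; rewrite /partial_mean -ExB; try exact: mix_section_integrable.
apply: Ex_bounded; first by apply: RintegrableB; exact: mix_section_integrable.
move=> s; apply: (Phi_diff (i := Ordinal kn)) => i j; rewrite -val_eqE /= => ik.
by rewrite !mxE ltnS (leq_eqVlt i) (negbTE ik).
Qed.

Lemma bounded_wrt_integrable (J : {set 'I_n * 'I_p}) f L :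
  measurable_wrt (gen_over G J) f -> (forall t, `|f t| <= L) -> Rintegrable f.
Proof.
move=> mf fL; apply: (@Rintegrable_bounded _ _ _ _ _ L) => //.
by apply: measurable_wrt_measurable mf; exact: gen_over_measurable.
Qed.

(** Both sides are the mean of [Phi] on rows mixed from two independent copies, by
    [decouple]; this is the defining property of the conditional expectation. *)
Lemma partial_mean_test k f L : measurable_wrt (gen_over G (rows_from k)) f ->
  (forall t, `|f t| <= L) ->
  Ex (fun t => partial_mean k t * f t) = Ex (fun t => Phi (Zmx t) * f t).
Proof.
move=> mf fL.
pose h s t := Phi (mix_rows k (Zmx s) (Zmx t)) * f t.
have hE := decouple (@Gbm k) (@Gfm k) (@blocks_indep k) (h := h) (K := K * L).
transitivity (Ex (fun t => Ex (fun s => h s t))).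
  apply: eq_Ex => t; rewrite /h; under eq_Ex do rewrite mulrC.
  by rewrite ExZl 1?mulrC//; exact: mix_section_integrable.
rewrite -hE.
- apply: eq_Ex => t; rewrite /h; congr (Phi _ * _).
  by apply/matrixP => i j; rewrite !mxE if_same.
- apply: measurable_funM; first exact: Phi_measurable (@mix_measurable k).
  exact: (measurableT_comp mf measurable_snd).
- by move=> s t; rewrite normrM ler_pM.
Qed.

Lemma rows_fromS k : gen_over G (rows_from k.+1) `<=` <<s gen_over G (rows_from k) >>.
Proof.
apply: subset_trans (@sub_sigma_algebra _ _ _); apply: gen_over_sub.
by apply/fintype.subsetP => ij; rewrite !inE => /ltnW.
Qed.

(** The increments are martingale differences along the decreasing blocks of
    rows. *)
Lemma partial_mean_orthogonal k f L : measurable_wrt (gen_over G (rows_from k.+1)) f ->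
  (forall t, `|f t| <= L) ->
  Ex (fun t => (partial_mean k t - partial_mean k.+1 t) * f t) = 0.
Proof.
move=> mf fL.
have mf' : measurable_wrt (gen_over G (rows_from k)) f.
  exact: measurable_wrt_sub (@rows_fromS k) mf.
under eq_Ex do rewrite mulrBl.
have ii k' : measurable_wrt (gen_over G (rows_from k')) f ->
    Rintegrable (fun t => partial_mean k' t * f t).
  move=> mfk; apply: (@bounded_wrt_integrable (rows_from k') _ (K * L)).
    by apply: measurable_funM => //; exact: partial_mean_measurable.
  by move=> t; rewrite normrM ler_pM// partial_mean_bounded.
rewrite ExB ?ii// (partial_mean_test mf' fL) (partial_mean_test mf fL).
by rewrite subrr.
Qed.

Let m := Ex (fun s => Phi (Zmx s)).

(** One row contributes an increment [D], bounded by [c] and orthogonal to every power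
    of the remaining deviation [g].  Hence the terms of [(D + g) ^+ 2] and
    [(D + g) ^+ 4] that are linear in [D] have mean zero, and the cubic one is
    absorbed by its neighbours. *)
Lemma concentration_step k : (k < n)%N ->
  Ex (fun t => (partial_mean k t - m) ^+ 2) <=
    c ^+ 2 + Ex (fun t => (partial_mean k.+1 t - m) ^+ 2) /\
  Ex (fun t => (partial_mean k t - m) ^+ 4) <=
    3 * c ^+ 4 + 8 * c ^+ 2 * Ex (fun t => (partial_mean k.+1 t - m) ^+ 2) +
    Ex (fun t => (partial_mean k.+1 t - m) ^+ 4).
Proof.
move=> kn.
pose D t := partial_mean k t - partial_mean k.+1 t.
pose g t := partial_mean k.+1 t - m.
have DgE t : partial_mean k t - m = D t + g t by rewrite /D /g; ring.
have mK : `|m| <= K.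
  apply: Ex_bounded; last by [].
  by apply: (@Rintegrable_bounded _ _ _ _ _ K) => //; exact: Phi_measurable Zmx_measurable.
have K0 : 0 <= K by exact: le_trans mK.
have gb t : `|g t| <= 2 * K.
  rewrite (le_trans (ler_normB _ _))//.
  by have := partial_mean_bounded k.+1 t; move: mK; lra.
have Dc t : `|D t| <= c by exact: partial_mean_step.
have mg : measurable_wrt (gen_over G (rows_from k.+1)) g.
  by apply: measurable_funB => //; exact: partial_mean_measurable.
have mg' : measurable_wrt (gen_over G (rows_from k)) g.
  exact: measurable_wrt_sub (@rows_fromS k) mg.
have mD : measurable_wrt (gen_over G (rows_from k)) D.
  apply: measurable_funB; first exact: partial_mean_measurable.
  by apply: measurable_wrt_sub (@rows_fromS k) _; exact: partial_mean_measurable.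
have int_mono a b : Rintegrable (fun t => D t ^+ a * g t ^+ b).
  apply: (@bounded_wrt_integrable (rows_from k) _ (c ^+ a * (2 * K) ^+ b)).
    by apply: measurable_funM; exact: measurable_funX.
  move=> t; rewrite normrM !normrX ler_pM ?exprn_ge0//.
    by rewrite lerXn2r ?nnegrE// (le_trans _ (Dc t)).
  by rewrite lerXn2r ?nnegrE// mulr_ge0.
have int_g b : Rintegrable (fun t => g t ^+ b).
  by apply: (eq_Rintegrable _ (int_mono 0 b)) => t; rewrite mul1r.
have orth b : Ex (fun t => D t * g t ^+ b) = 0.
  apply: (@partial_mean_orthogonal k _ ((2 * K) ^+ b)).
    exact: measurable_funX.
  by move=> t; rewrite normrX lerXn2r ?nnegrE// mulr_ge0.
have D2 t : D t ^+ 2 <= c ^+ 2.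
  rewrite -[D t ^+ 2]real_normK ?num_real//.
  by rewrite lerXn2r ?nnegrE// (le_trans _ (Dc t)).
split.
  apply: (@le_trans _ _ (Ex (fun t => c ^+ 2 + (2 * (D t ^+ 1 * g t ^+ 1) + g t ^+ 2)))).
    apply: Ex_le.
    - apply: (@eq_Rintegrable _ _ _ _ (fun t => D t ^+ 2 * g t ^+ 0 +
          (2 * (D t ^+ 1 * g t ^+ 1) + g t ^+ 2))) => [t|].
        by rewrite DgE; ring.
      apply: RintegrableD => //; apply: RintegrableD => //.
      exact: RintegrableZl.
    - apply: RintegrableD; first exact: Rintegrable_cst.
      by apply: RintegrableD => //; exact: RintegrableZl.
    - by move=> t; rewrite DgE; have := D2 t; rewrite !expr1; nra.
  rewrite ExD; [|exact: Rintegrable_cst|]; last first.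
    by apply: RintegrableD => //; exact: RintegrableZl.
  rewrite Ex_cst ExD//; last exact: RintegrableZl.
  rewrite ExZl//; under [X in 2 * X]eq_Ex do rewrite expr1.
  by rewrite orth mulr0 add0r.
apply: (@le_trans _ _ (Ex (fun t => 3 * c ^+ 4 + (8 * c ^+ 2 * g t ^+ 2 +
    (4 * (D t ^+ 1 * g t ^+ 3) + g t ^+ 4))))).
  apply: Ex_le.
  - apply: (@eq_Rintegrable _ _ _ _ (fun t => D t ^+ 4 * g t ^+ 0 +
        (4 * (D t ^+ 3 * g t ^+ 1) + (6 * (D t ^+ 2 * g t ^+ 2) +
        (4 * (D t ^+ 1 * g t ^+ 3) + g t ^+ 4))))) => [t|].
      by rewrite DgE; ring.
    do 4 (apply: RintegrableD; first by [|exact: RintegrableZl]).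
    by [].
  - apply: RintegrableD; first exact: Rintegrable_cst.
    do 2 (apply: RintegrableD; first exact: RintegrableZl).
    by [].
  - move=> t; rewrite DgE.
    have := D2 t; have := sqr_ge0 (D t); have := sqr_ge0 (g t).
    have : D t ^+ 3 * g t <= (D t ^+ 2 * (D t ^+ 2 + g t ^+ 2)) / 2.
      have : 0 <= D t ^+ 2 * (D t - g t) ^+ 2 by rewrite mulr_ge0// sqr_ge0.
      by nra.
    have -> : (D t + g t) ^+ 4 = (D t ^+ 2) ^+ 2 + 4 * (D t ^+ 3 * g t) +
      6 * (D t ^+ 2 * g t ^+ 2) + 4 * (D t ^+ 1 * g t ^+ 3) + g t ^+ 4 by ring.
    rewrite (_ : c ^+ 4 = (c ^+ 2) ^+ 2); last by ring.
    set a := D t ^+ 2; set b := g t ^+ 2; set e := c ^+ 2; set u := D t ^+ 3 * g t.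
    set v := D t ^+ 1 * g t ^+ 3; set w := g t ^+ 4 => hu b0 a0 ae.
    have : a ^+ 2 <= e ^+ 2 by rewrite lerXn2r ?nnegrE// (le_trans a0).
    have : a * b <= e * b by rewrite ler_wpM2r.
    by nra.
rewrite ExD; [|exact: Rintegrable_cst|]; last first.
  apply: RintegrableD; first exact: RintegrableZl.
  by apply: RintegrableD => //; exact: RintegrableZl.
rewrite Ex_cst ExD; [|exact: RintegrableZl|]; last first.
  by apply: RintegrableD => //; exact: RintegrableZl.
rewrite ExZl// ExD//; last exact: RintegrableZl.
rewrite ExZl//; under [X in 4 * X]eq_Ex do rewrite expr1.
by rewrite orth mulr0 add0r addrA.
Qed.

(** Sum of the increments over the rows.  For a statistic with [c] of order [n^-1] the
    fourth moment is of order [n ^- 2], which is summable in [n], while the second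
    moment, of order [n^-1], is not. *)
Lemma concentration :
  Ex (fun t => (Phi (Zmx t) - m) ^+ 2) <= n%:R * c ^+ 2 /\
  Ex (fun t => (Phi (Zmx t) - m) ^+ 4) <= 11 * n%:R ^+ 2 * c ^+ 4.
Proof.
have S0 a : Ex (fun t => (partial_mean n t - m) ^+ a.+1) = 0.
  rewrite -[RHS](Ex_cst P); apply: eq_Ex => t.
  by rewrite partial_meann subrr expr0n.
have S2 k : (k <= n)%N -> Ex (fun t => (partial_mean (n - k) t - m) ^+ 2) <= k%:R * c ^+ 2.
  elim: k => [_|k IH kn]; first by rewrite subn0 S0 mul0r.
  have lt : (n - k.+1 < n)%N by rewrite ltn_subrL (leq_trans _ kn).
  have [h _] := concentration_step lt; move: h; rewrite -subSn// subSS.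
  move=> /le_trans; apply.
  by have := IH (ltnW kn); rewrite -natr1 mulrDl mul1r; lra.
have c4 : 0 <= c ^+ 4 by rewrite exprn_even_ge0.
have S4 k : (k <= n)%N -> Ex (fun t => (partial_mean (n - k) t - m) ^+ 4) <=
    k%:R * (3 * c ^+ 4 + 8 * n%:R * c ^+ 4).
  elim: k => [_|k IH kn]; first by rewrite subn0 S0 mul0r.
  have lt : (n - k.+1 < n)%N by rewrite ltn_subrL (leq_trans _ kn).
  have [_ h] := concentration_step lt; move: h; rewrite -subSn// subSS.
  move=> /le_trans; apply.
  have := IH (ltnW kn); rewrite -natr1 mulrDl mul1r.
  have : c ^+ 2 * Ex (fun t => (partial_mean (n - k) t - m) ^+ 2) <= n%:R * c ^+ 4.
    apply: (@le_trans _ _ (c ^+ 2 * (n%:R * c ^+ 2))).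
      rewrite ler_wpM2l ?sqr_ge0// (le_trans (S2 _ (ltnW kn)))//.
      by rewrite ler_wpM2r ?sqr_ge0// ler_nat ltnW.
    by rewrite le_eqVlt; apply/orP; left; apply/eqP; ring.
  by lra.
have e0 t : partial_mean (n - n) t = Phi (Zmx t) by rewrite subnn partial_mean0.
split.
  by have := S2 n (leqnn n); under [X in X <= _ -> _]eq_Ex do rewrite e0.
have := S4 n (leqnn n); under [X in X <= _ -> _]eq_Ex do rewrite e0.
move=> /le_trans; apply; case: (posnP n) => [->|n0]; first by rewrite !mul0r expr0n/= mulr0 mul0r.
have : 1 <= n%:R :> R by rewrite ler1n.
have : 0 <= n%:R :> R by rewrite ler0n.
move: c4; set a := c ^+ 4; set N := n%:R => a0 N0 N1.
have : 0 <= a * (N - 1) * N.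
  by apply: mulr_ge0 => //; apply: mulr_ge0 => //; rewrite subr_ge0.
by nra.
Qed.

End BoundedDifferences.

(** * Quadratic forms and operator bounds *)

Section OperatorBounds.
Context {R : realType}.

Definition dot {p} (u v : 'cV[R]_p) : R := (u^T *m v) 0 0.
Local Notation sqn u := (dot u u).

Lemma dotE p (u v : 'cV[R]_p) : dot u v = \sum_i u i 0 * v i 0.
Proof. by rewrite /dot mxE; apply: eq_bigr => i _; rewrite mxE. Qed.

Lemma dotC p (u v : 'cV[R]_p) : dot u v = dot v u.
Proof. by rewrite !dotE; apply: eq_bigr => i _; rewrite mulrC. Qed.

Lemma sqn_ge0 p (u : 'cV[R]_p) : 0 <= sqn u.
Proof. by rewrite dotE sumr_ge0// => i _; rewrite -expr2 sqr_ge0. Qed.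

Lemma sqn_eq0 p (u : 'cV[R]_p) : sqn u <= 0 -> u = 0.
Proof.
move=> u0; have : sqn u == 0 by rewrite eq_le u0 sqn_ge0.
rewrite dotE psumr_eq0 => [/allP h|i _]; last by rewrite -expr2 sqr_ge0.
apply/matrixP => i j; rewrite ord1 mxE; apply/eqP.
by have := h i (mem_index_enum _); rewrite /= mulf_eq0 orbb.
Qed.

Lemma dotDl p (u v w : 'cV[R]_p) : dot (u + v) w = dot u w + dot v w.
Proof. by rewrite /dot linearD /= mulmxDl mxE. Qed.

Lemma dotDr p (u v w : 'cV[R]_p) : dot w (u + v) = dot w u + dot w v.
Proof. by rewrite /dot mulmxDr mxE. Qed.

Lemma dotZl p a (u v : 'cV[R]_p) : dot (a *: u) v = a * dot u v.
Proof. by rewrite /dot linearZ /= -scalemxAl mxE. Qed.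

Lemma dotZr p a (u v : 'cV[R]_p) : dot u (a *: v) = a * dot u v.
Proof. by rewrite /dot -scalemxAr mxE. Qed.

Lemma dot_mull n p (A : 'M[R]_(n, p)) u v : dot (A *m u) v = dot u (A^T *m v).
Proof. by rewrite /dot trmx_mul mulmxA. Qed.

Lemma dot_young p (u v : 'cV[R]_p) (a : R) : 0 < a ->
  2 * `|dot u v| <= a * sqn u + a^-1 * sqn v.
Proof.
move=> a0.
have h s : s = 1 \/ s = -1 -> 2 * (s * dot u v) <= a * sqn u + a^-1 * sqn v.
  move=> s1; have ss : s * s = 1 by case: s1 => ->; rewrite ?mulrNN mul1r.
  have := sqn_ge0 (a *: u - s *: v).
  rewrite -scaleNr dotDl !dotDr !dotZl !dotZr (dotC v u) => h0.
  have : 0 <= a^-1 * (a * (a * dot u u) + a * (- s * dot u v) +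
      (- s * (a * dot u v) + - s * (- s * dot v v))).
    by apply: mulr_ge0 => //; rewrite invr_ge0 ltW.
  have -> : a^-1 * (a * (a * dot u u) + a * (- s * dot u v) +
      (- s * (a * dot u v) + - s * (- s * dot v v))) =
      a * dot u u - 2 * (s * dot u v) + a^-1 * ((s * s) * dot v v).
    by field; rewrite gt_eqF.
  by rewrite ss mul1r; lra.
have [d0|d0] := lerP 0 (dot u v).
  by rewrite ger0_norm//; have := h 1 (or_introl erefl); rewrite mul1r.
by rewrite ltr0_norm//; have := h (-1) (or_intror erefl); rewrite mulN1r.
Qed.

(** An operator-norm bound, in terms of squared norms so that no square root
    appears. *)
Definition opbound {n p} (K : R) (A : 'M[R]_(n, p)) :=
  0 <= K /\ forall u, sqn (A *m u) <= K ^+ 2 * sqn u.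

Lemma opbound_mul n p q (A : 'M[R]_(n, p)) (B : 'M[R]_(p, q)) K L :
  opbound K A -> opbound L B -> opbound (K * L) (A *m B).
Proof.
move=> [K0 hA] [L0 hB]; split=> [|u]; first exact: mulr_ge0.
rewrite -mulmxA (le_trans (hA _))// (_ : (K * L) ^+ 2 * _ = K ^+ 2 * (L ^+ 2 * sqn u)).
  apply: ler_wpM2l; [exact: sqr_ge0|exact: hB].
by ring.
Qed.

Lemma opboundZ n p (A : 'M[R]_(n, p)) K a : opbound K A -> opbound (`|a| * K) (a *: A).
Proof.
move=> [K0 hA]; split=> [|u]; first exact: mulr_ge0.
rewrite -scalemxAl dotZl dotZr (_ : (`|a| * K) ^+ 2 * _ = `|a| ^+ 2 * (K ^+ 2 * sqn u)); last by ring.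
rewrite mulrA -expr2 real_normK ?num_real//.
by apply: ler_wpM2l; [exact: sqr_ge0|exact: hA].
Qed.

(** Young's inequality with weight [K] in place of Cauchy-Schwarz, which would need a
    square root; the weight must be positive, whence the separate case [K = 0]. *)
Lemma opbound_quad p (A : 'M[R]_p) K u : opbound K A -> `|dot u (A *m u)| <= K * sqn u.
Proof.
move=> [K0 hA]; have := hA u; rewrite le_eqVlt in K0.
case/predU1P: K0 => [<-|K0] h.
  rewrite mul0r (_ : A *m u = 0); first by rewrite /dot mulmx0 mxE normr0.
  by apply: sqn_eq0; rewrite (le_trans h)// expr0n mul0r.
have := dot_young u (A *m u) K0.
have : K^-1 * sqn (A *m u) <= K * sqn u.
  apply: le_trans (_ : K^-1 * (K ^+ 2 * sqn u) <= _).
    by rewrite ler_wpM2l// invr_ge0 ltW.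
  by rewrite le_eqVlt; apply/orP; left; apply/eqP; field; rewrite gt_eqF.
by lra.
Qed.

Lemma sqn_delta p (j : 'I_p) : sqn (delta_mx j 0 : 'cV[R]_p) = 1.
Proof.
rewrite dotE (bigD1 j)//= !mxE !eqxx mulr1 big1 ?addr0// => i ij.
by rewrite !mxE (negbTE ij) mul0r.
Qed.

Lemma mul_delta n p (A : 'M[R]_(n, p)) j i : (A *m delta_mx j 0 : 'cV[R]_n) i 0 = A i j.
Proof. by rewrite -colE mxE. Qed.

Lemma dot_delta p (v : 'cV[R]_p) j : dot (delta_mx j 0) v = v j 0.
Proof.
rewrite dotE (bigD1 j)//= !mxE !eqxx mul1r big1 ?addr0// => i ij.
by rewrite !mxE (negbTE ij) mul0r.
Qed.

Lemma opbound_col n p (A : 'M[R]_(n, p)) K j : opbound K A ->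
  \sum_i A i j ^+ 2 <= K ^+ 2.
Proof.
move=> [K0 hA]; have := hA (delta_mx j 0); rewrite sqn_delta mulr1; apply: le_trans.
by rewrite dotE le_eqVlt; apply/orP; left; apply/eqP/eq_bigr => i _; rewrite mul_delta.
Qed.

Lemma opbound_entry n p (A : 'M[R]_(n, p)) K i j : opbound K A -> `|A i j| <= K.
Proof.
move=> hA; have K0 := hA.1; rewrite -(@ler_pXn2r _ 2)// ?nnegrE//.
rewrite real_normK ?num_real//.
apply: le_trans (opbound_col j hA); rewrite (bigD1 i)//= lerDl sumr_ge0// => k _.
exact: sqr_ge0.
Qed.

Lemma opbound_frobenius n p (A : 'M[R]_(n, p)) K : opbound K A ->
  \sum_i \sum_j A i j ^+ 2 <= p%:R * K ^+ 2.
Proof.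
move=> hA; rewrite exchange_big /=.
apply: (@le_trans _ _ (\sum_(j < p) K ^+ 2)).
  by apply: ler_sum => j _; exact: opbound_col.
by rewrite sumr_const card_ord mulr_natl.
Qed.

Lemma opbound_trace p (A : 'M[R]_p) K : opbound K A -> `|\tr A| <= p%:R * K.
Proof.
move=> hA; apply: le_trans (ler_norm_sum _ _ _) _.
apply: (@le_trans _ _ (\sum_(j < p) K)).
  by apply: ler_sum => j _; exact: opbound_entry.
by rewrite sumr_const card_ord mulr_natl.
Qed.

Lemma psd_dot p (A : 'M[R]_p) : psd A -> forall u, 0 <= dot u (A *m u).
Proof. by move=> [_ h] u; have := h u; rewrite /dot mulmxA. Qed.

(** By cyclicity the trace is that of [S *m A *m S], a sum of values of the quadratic
    form of [A] at the columns of [S]. *)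
Lemma psd_trace_mul p (S A : 'M[R]_p) : S^T = S -> psd A -> 0 <= \tr (S *m S *m A).
Proof.
move=> ST hA; rewrite -mulmxA mxtrace_mulC -mulmxA; apply: sumr_ge0 => j _.
have := psd_dot hA (S *m delta_mx j 0); rewrite dot_mull ST dot_delta.
by rewrite !mulmxA mul_delta -!mulmxA.
Qed.

End OperatorBounds.
Notation sqn u := (dot u u).

(** * Resolvents of positive semidefinite matrices *)

Section Resolvent.
Context {R : realType} {p : nat}.
Implicit Types (A N : 'M[R]_p) (u v x : 'cV[R]_p) (l : R).

Definition resolvent A l : 'M[R]_p := invmx (A + l%:M).

Lemma shift_coercive A l u : psd A -> l * sqn u <= dot u ((A + l%:M) *m u).
Proof.
move=> hA; rewrite mulmxDl dotDr mul_scalar_mx dotZr lerDr.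
exact: psd_dot.
Qed.

(** Coercivity: a vector in the kernel has norm zero. *)
Lemma shift_unit A l : psd A -> 0 < l -> A + l%:M \in unitmx.
Proof.
move=> hA l0; rewrite -unitmx_tr -row_free_unit -kermx_eq0; apply/eqP/row_matrixP => i.
rewrite row0; set w := row i _.
have : w *m (A + l%:M)^T = 0.
  by apply/eqP; have /sub_kermxP -> := row_sub i (kermx (A + l%:M)^T).
move=> /(congr1 trmx); rewrite trmx_mul trmxK trmx0 => e.
apply: trmx_inj; rewrite trmx0; apply: sqn_eq0.
have := shift_coercive l w^T hA; rewrite e {2}/dot mulmx0 mxE => h.
by rewrite -(pmulr_rle0 _ l0).
Qed.

Lemma mul_resolvent A l : psd A -> 0 < l -> (A + l%:M) *m resolvent A l = 1%:M.
Proof. by move=> hA l0; rewrite mulmxV// shift_unit. Qed.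

Lemma resolvent_mul A l : psd A -> 0 < l -> resolvent A l *m (A + l%:M) = 1%:M.
Proof. by move=> hA l0; rewrite mulVmx// shift_unit. Qed.

Lemma resolvent_sym A l : psd A -> (resolvent A l)^T = resolvent A l.
Proof. by move=> [AT _]; rewrite /resolvent trmx_inv linearD /= AT tr_scalar_mx. Qed.

(** Coercivity at the vector [resolvent A l *m u].  Boundedness and positivity of the
    resolvent both follow from this inequality. *)
Lemma resolvent_dot A l u : psd A -> 0 < l ->
  l * sqn (resolvent A l *m u) <= dot u (resolvent A l *m u).
Proof.
move=> hA l0; apply: le_trans (shift_coercive _ _ hA) _.
by rewrite mulmxA mul_resolvent// mul1mx dotC.
Qed.

Lemma resolvent_bound A l : psd A -> 0 < l -> opbound l^-1 (resolvent A l).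
Proof.
move=> hA l0; split=> [|u]; first by rewrite invr_ge0 ltW.
have h := resolvent_dot u hA l0.
have /(dot_young u (resolvent A l *m u)) : 0 < l^-1 by rewrite invr_gt0.
rewrite invrK; set y := sqn (_ *m _) in h *; set s := sqn u; set b := dot _ _ in h *.
have := ler_norm b => hb hy.
have : l * y <= l^-1 * s by lra.
have li : 0 < l^-1 by rewrite invr_gt0.
rewrite -(ler_pM2l li) mulrA mulVf ?gt_eqF// mul1r => /le_trans; apply.
by rewrite expr2 mulrA.
Qed.

Lemma resolvent_psd A l : psd A -> 0 < l -> psd (resolvent A l).
Proof.
move=> hA l0; split; first exact: resolvent_sym.
move=> u; rewrite -mulmxA -/(dot _ _); apply: le_trans (resolvent_dot u hA l0).
by rewrite mulr_ge0 ?sqn_ge0 ?ltW.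
Qed.

Lemma resolvent_quad A l u : psd A -> 0 < l ->
  dot u (resolvent A l *m u) <= l^-1 * sqn u.
Proof.
move=> hA l0; apply: le_trans (ler_norm _) _.
exact: opbound_quad (resolvent_bound hA l0).
Qed.

Lemma resolvent_diff A A' l l' : psd A -> psd A' -> 0 < l -> 0 < l' ->
  resolvent A l - resolvent A' l' =
  resolvent A l *m ((A' + l'%:M) - (A + l%:M)) *m resolvent A' l'.
Proof.
move=> hA hA' l0 l0'; rewrite mulmxBr mulmxBl resolvent_mul// mul1mx -mulmxA.
by rewrite mul_resolvent// mulmx1.
Qed.

Section RankOne.
Variables (A : 'M[R]_p) (l s : R) (x : 'cV[R]_p).
Hypotheses (hA : psd A) (l0 : 0 < l) (s0 : 0 <= s).
Let A1 := A + s *: (x *m x^T).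
Let Q0 := resolvent A l.
Let Q1 := resolvent A1 l.
(** The denominator of the Sherman-Morrison formula, minus one. *)
Definition leverage := s * dot x (Q0 *m x).

Lemma outer_mul (u : 'cV[R]_p) : x *m x^T *m u = dot x u *: x.
Proof. by rewrite -mulmxA [x^T *m u]mx11_scalar mul_mx_scalar. Qed.

Lemma psd_rank_one : psd A1.
Proof.
case: hA => AT h; split.
  by rewrite /A1 linearD /= linearZ /= trmx_mul trmxK AT.
move=> u; rewrite -mulmxA -/(dot _ _) mulmxDl dotDr addr_ge0//; first by rewrite /dot mulmxA.
by rewrite -scalemxAl outer_mul !dotZr (dotC u) -expr2 mulr_ge0// sqr_ge0.
Qed.

Lemma leverage_ge0 : 0 <= leverage.
Proof.
by rewrite mulr_ge0// psd_dot//; exact: resolvent_psd.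
Qed.

(** The Sherman-Morrison formula, evaluated at the updating vector. *)
Lemma resolvent_rank_one : Q1 *m x = (1 + leverage)^-1 *: (Q0 *m x).
Proof.
have q0 := leverage_ge0.
have e : (A1 + l%:M) *m (Q0 *m x) = (1 + leverage) *: x.
  rewrite /A1 addrAC mulmxDl mulmxA mul_resolvent// mul1mx -scalemxAl outer_mul.
  by rewrite scalerDl scale1r scalerA.
have : Q1 *m ((A1 + l%:M) *m (Q0 *m x)) = (1 + leverage) *: (Q1 *m x).
  by rewrite e -scalemxAr.
rewrite mulmxA resolvent_mul//; last exact: psd_rank_one.
rewrite mul1mx => ->; rewrite scalerA mulVf ?scale1r// gt_eqF//.
by rewrite ltr_pwDl.
Qed.

(** The two resolvents differ by a matrix of rank one, whose trace against [N] is
    [s / (1 + leverage)] times the form of [N] at [Q0 *m x].  Coercivity bounds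
    [l * s] times the squared norm of that vector by the leverage, so the estimate
    involves neither [x] nor [s] nor the dimension. *)
Lemma trace_rank_one N K : opbound K N ->
  `|\tr (N *m Q0) - \tr (N *m Q1)| <= K / l.
Proof.
move=> hN; have q0 := leverage_ge0.
rewrite -linearB /= -mulmxBr resolvent_diff//; last exact: psd_rank_one.
rewrite /A1 (_ : _ - _ = s *: (x *m x^T)); last first.
  by rewrite [A + _ + _]addrAC [A + l%:M + _]addrC addrK.
rewrite -!scalemxAr -scalemxAl -scalemxAr linearZ /= !mulmxA.
rewrite -[_ *m x^T *m _]mulmxA mxtrace_mulC.
have -> : x^T *m resolvent (A + s *: (x *m x^T)) l = (Q1 *m x)^T.
  by rewrite trmx_mul resolvent_sym//; exact: psd_rank_one.
rewrite resolvent_rank_one linearZ /= -!scalemxAl linearZ /=.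
set y := Q0 *m x.
rewrite -mulmxA -/Q0 -/y trace_mx11 -/(dot _ _).
have hq := opbound_quad y hN.
have hy := resolvent_dot x hA l0.
have q1 : 0 < 1 + leverage by rewrite ltr_pwDl.
rewrite mulrA normrM ger0_norm; last by rewrite mulr_ge0// invr_ge0 ltW.
have K0 := hN.1.
have sy : l * (s * sqn y) <= leverage.
  by rewrite mulrCA ler_wpM2l.
apply: (@le_trans _ _ (s / (1 + leverage) * (K * sqn y))).
  by rewrite ler_wpM2l// mulr_ge0// invr_ge0 ltW.
rewrite ler_pdivlMr// (_ : _ * l = (K * (l * (s * sqn y))) / (1 + leverage)); last by ring.
rewrite ler_pdivrMr//; apply: ler_wpM2l => //.
by apply: le_trans sy _; rewrite lerDr.
Qed.

End RankOne.

Section Perturbation.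
Variables (A N : 'M[R]_p) (K l m : R).
Hypotheses (hA : psd A) (hN : opbound K N) (l0 : 0 < l) (m0 : 0 < m).
Let Q := resolvent A l.
Let Q' := resolvent A m.

Lemma resolvent_identity : Q' = Q + (l - m) *: (Q *m Q').
Proof.
have := resolvent_diff hA hA l0 m0; rewrite -/Q -/Q' => e.
have -> : (l - m) *: (Q *m Q') = - (Q - Q').
  rewrite e opprD addrACA subrr add0r -[X in _ = - (Q *m X *m _)](raddfB scalar_mx) /=.
  by rewrite -mulmxA mul_scalar_mx -scalemxAr -scaleNr opprB.
by rewrite opprB addrCA subrr addr0.
Qed.

Lemma trace_resolvent_lipschitz :
  `|\tr (N *m Q') - \tr (N *m Q)| <= p%:R * (K * (l^-1 * m^-1)) * `|l - m|.
Proof.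
rewrite {1}resolvent_identity mulmxDr linearD /= addrAC subrr add0r.
rewrite -scalemxAr linearZ /= normrM mulrC ler_wpM2r//; apply: opbound_trace.
by apply: opbound_mul => //; apply: opbound_mul; exact: resolvent_bound.
Qed.

Lemma resolvent_second_order :
  Q' = Q + (l - m) *: (Q *m Q) + (l - m) ^+ 2 *: (Q *m Q *m Q').
Proof.
rewrite {1}resolvent_identity {1}resolvent_identity mulmxDr scalerDr addrA.
by rewrite -scalemxAr scalerA -expr2 mulmxA.
Qed.

(** Identifies [- \tr (N *m (Q *m Q))] as the derivative in [l] of [\tr (N *m Q)], with
    an error uniform in [A]: limits of the former will follow from limits of the
    latter. *)
Lemma trace_resolvent_second_order :
  `|\tr (N *m Q') - \tr (N *m Q) - (l - m) * \tr (N *m (Q *m Q))| <=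
  p%:R * (K * (l^-1 * l^-1 * m^-1)) * (l - m) ^+ 2.
Proof.
have e := congr1 (fun M => \tr (N *m M)) resolvent_second_order.
rewrite /= !mulmxDr !linearD /= -!scalemxAr !linearZ /= in e; rewrite e.
rewrite (_ : _ - _ - _ = (l - m) ^+ 2 * \tr (N *m (Q *m Q *m Q'))); last by ring.
rewrite normrM ger0_norm ?sqr_ge0// mulrC ler_wpM2r ?sqr_ge0//.
apply: opbound_trace; apply: opbound_mul => //.
by do 2?apply: opbound_mul; exact: resolvent_bound.
Qed.

(** The two sides differ by [(l - m) ^+ 2 / m] times the trace of [S *m S] against
    [Q *m (1 - m Q') *m Q], which is positive semidefinite because [m Q'] is at most
    one.  Read for ridge regression, the regularization [m] of least Bayes risk beats
    [l] on every sample. *)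
Lemma resolvent_optimality (S : 'M[R]_p) : S^T = S ->
  \tr (S *m S *m Q') <=
  \tr (S *m S *m Q) + l * (l / m - 1) * \tr (S *m S *m (Q *m Q)).
Proof.
move=> ST; set G := S *m S.
have hP : psd (Q *m (1%:M - m *: Q') *m Q).
  split.
    rewrite !trmx_mul !resolvent_sym// linearB /= trmx1 linearZ /= resolvent_sym//.
    by rewrite mulmxA.
  move=> u; rewrite -!mulmxA -/(dot _ _).
  have -> : dot u (Q *m ((1%:M - m *: Q') *m (Q *m u))) =
      dot (Q *m u) ((1%:M - m *: Q') *m (Q *m u)).
    by rewrite [RHS]dot_mull resolvent_sym.
  set v := Q *m u; rewrite mulmxBl mul1mx -scalemxAl -scaleNr dotDr.
  have := resolvent_quad v hA m0; rewrite -/Q' -(ler_pM2l m0) mulrA mulfV ?gt_eqF//.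
  by rewrite mul1r dotZr; lra.
have := psd_trace_mul ST hP; rewrite -/G.
have -> : Q *m (1%:M - m *: Q') *m Q = Q *m Q - m *: (Q *m Q' *m Q).
  by rewrite mulmxBr mulmx1 mulmxBl -scalemxAr -scalemxAl.
have comm : Q *m Q' *m Q = Q *m Q *m Q'.
  rewrite -!mulmxA; congr (_ *m _).
  have e1 : (A + m%:M) *m Q = Q *m (A + m%:M).
    have -> : A + m%:M = (A + l%:M) + (m - l)%:M.
      by rewrite raddfB /= -addrA [l%:M + _]addrC subrK.
    by rewrite mulmxDl mulmxDr mul_resolvent// resolvent_mul// mul_scalar_mx mul_mx_scalar.
  have := congr1 (fun M => Q' *m M *m Q') e1.
  rewrite /= !mulmxA resolvent_mul// mul1mx -!mulmxA mul_resolvent// mulmx1.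
  by move->.
rewrite comm mulmxBr linearB /= -scalemxAr linearZ /= => h.
have e := congr1 (fun M => \tr (G *m M)) resolvent_second_order.
rewrite /= !mulmxDr !linearD /= -!scalemxAr !linearZ /= in e; rewrite e.
set a := \tr (G *m (Q *m Q)) in h *; set b := \tr (G *m (Q *m Q *m Q')) in h *.
have : 0 <= (l - m) ^+ 2 / m * (a - m * b).
  apply: mulr_ge0 => //; apply: mulr_ge0; first exact: sqr_ge0.
  by rewrite invr_ge0 ltW.
have -> : (l - m) ^+ 2 / m * (a - m * b) =
  (l * (l / m - 1) * a) - (l - m) * a - (l - m) ^+ 2 * b.
  by field; rewrite gt_eqF.
by lra.
Qed.

End Perturbation.
End Resolvent.

(** * Measurability of random resolvents *)

Section MatrixMeasurability.
Context {R : realType} {d} {T : measurableType d}.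

Lemma measurable_inv : measurable_fun [set: R] (@GRing.inv R).
Proof.
have mC : measurable (~` [set (0 : R)]) by exact: measurableC.
rewrite (_ : setT = [set (0 : R)] `|` ~` [set (0 : R)]); last by rewrite setUv.
apply/measurable_funU => //; split; first exact: measurable_fun_set1.
apply: subspace_continuous_measurable_fun => //.
apply: continuous_in_subspaceT => x; rewrite inE => /eqP x0.
exact: inv_continuous.
Qed.

Lemma measurable_mx_cst n p (A : 'M[R]_(n, p)) : measurable_mx (fun _ : T => A).
Proof. by move=> i j; exact: measurable_cst. Qed.

Lemma measurable_mxD n p (A B : T -> 'M[R]_(n, p)) : measurable_mx A -> measurable_mx B ->
  measurable_mx (fun t => A t + B t).
Proof.
move=> mA mB i j; apply: (measurable_ext (f := fun t => A t i j + B t i j)).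
  by move=> t; rewrite mxE.
exact: measurable_funD.
Qed.

Lemma measurable_mxM n p q (A : T -> 'M[R]_(n, p)) (B : T -> 'M[R]_(p, q)) :
  measurable_mx A -> measurable_mx B -> measurable_mx (fun t => A t *m B t).
Proof.
move=> mA mB i j; apply: (measurable_ext (f := fun t => \sum_k A t i k * B t k j)).
  by move=> t; rewrite mxE.
by apply: measurable_sum => k; exact: measurable_funM.
Qed.

Lemma measurable_mxZ n p (f : T -> R) (A : T -> 'M[R]_(n, p)) :
  measurable_fun setT f -> measurable_mx A -> measurable_mx (fun t => f t *: A t).
Proof.
move=> mf mA i j; apply: (measurable_ext (f := fun t => f t * A t i j)).
  by move=> t; rewrite mxE.
exact: measurable_funM.
Qed.

Lemma measurable_mx_tr n p (A : T -> 'M[R]_(n, p)) :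
  measurable_mx A -> measurable_mx (fun t => (A t)^T).
Proof. by move=> mA i j; apply: (measurable_ext _ (mA j i)) => t; rewrite mxE. Qed.

Lemma measurable_det p (A : T -> 'M[R]_p) :
  measurable_mx A -> measurable_fun setT (fun t => \det (A t)).
Proof.
move=> mA; apply: measurable_sum => s; apply: measurable_funM; first exact: measurable_cst.
by apply: measurable_prod => i _; exact: mA.
Qed.

Lemma measurable_trace p (A : T -> 'M[R]_p) :
  measurable_mx A -> measurable_fun setT (fun t => \tr (A t)).
Proof. by move=> mA; apply: measurable_sum => i; exact: mA. Qed.

(** Cramer's formula writes the entries as rational functions of those of [A t], with
    a denominator that does not vanish. *)
Lemma measurable_invmx p (A : T -> 'M[R]_p) : (forall t, A t \in unitmx) ->
  measurable_mx A -> measurable_mx (fun t => invmx (A t)).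
Proof.
move=> uA mA i j.
apply: (measurable_ext (f := fun t => (\det (A t))^-1 *
    ((-1) ^+ (j + i) * \det (row' j (col' i (A t)))))).
  by move=> t; rewrite /invmx uA !mxE.
apply: measurable_funM; first exact: measurableT_comp measurable_inv (measurable_det mA).
apply: measurable_funM; first exact: measurable_cst.
apply: measurable_det => a b.
by apply: (measurable_ext _ (mA (lift j a) (lift i b))) => t; rewrite !mxE.
Qed.

Lemma measurable_resolvent p (A : T -> 'M[R]_p) l : (forall t, psd (A t)) -> 0 < l ->
  measurable_mx A -> measurable_mx (fun t => resolvent (A t) l).
Proof.
move=> hA l0 mA; apply: measurable_invmx => [t|]; first exact: shift_unit.
by apply: measurable_mxD => //; exact: measurable_mx_cst.
Qed.

End MatrixMeasurability.

(** * Sample covariance matrices and deleted rows *)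

Section SampleResolvent.
Context {R : realType} {n p : nat} (S : 'M[R]_p).
Hypothesis ST : S^T = S.
Implicit Types W : 'M[R]_(n, p).

Lemma sample_cov_psd q (X : 'M[R]_(n, q)) : psd (sample_cov X).
Proof.
split; first by rewrite /sample_cov linearZ /= trmx_mul trmxK.
move=> u; rewrite -mulmxA -/(dot _ _) /sample_cov -scalemxAl dotZr.
rewrite mulr_ge0 ?invr_ge0 ?ler0n// -mulmxA -[X in _ *m X]/(X *m u).
by rewrite -[X in dot u (X *m _)]/(X^T) -dot_mull sqn_ge0.
Qed.

(** Deleting row [i], encoded as zeroing it so that the dimensions do not change. *)
Definition zero_row (i : 'I_n) W : 'M[R]_(n, p) :=
  \matrix_(k, j) if k == i then 0 else W k j.

Definition feature (i : 'I_n) W : 'cV[R]_p := S *m (row i W)^T.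

Lemma zero_row_mul i W k a : (zero_row i W *m S) k a = if k == i then 0 else (W *m S) k a.
Proof.
rewrite !mxE; case: ifPn => ki.
  by rewrite big1// => j _; rewrite mxE ki mul0r.
by apply: eq_bigr => j _; rewrite mxE (negbTE ki).
Qed.

Lemma featureE i W a : feature i W a 0 = (W *m S) i a.
Proof.
rewrite !mxE; apply: eq_bigr => j _; rewrite !mxE mulrC; congr (_ * _).
by rewrite -[in LHS]ST mxE.
Qed.

Lemma sample_cov_features W :
  sample_cov (W *m S) = n%:R^-1 *: \sum_i feature i W *m (feature i W)^T.
Proof.
congr (_ *: _); apply/matrixP => a b; rewrite summxE mxE; apply: eq_bigr => k _.
rewrite [RHS]mxE big_ord1 [(feature k W)^T _ _]mxE !featureE; congr (_ * _).
by rewrite mxE.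
Qed.

Lemma sample_cov_zero_row i W : sample_cov (W *m S) =
  sample_cov (zero_row i W *m S) + n%:R^-1 *: (feature i W *m (feature i W)^T).
Proof.
rewrite !sample_cov_features -scalerDr; congr (_ *: _).
rewrite (bigD1 i)//= addrC; congr (_ + _).
rewrite [RHS](bigD1 i)//= (_ : feature i (zero_row i W) = 0) ?mul0mx ?add0r; last first.
  by apply/matrixP => a b; rewrite ord1 featureE zero_row_mul eqxx mxE.
apply: eq_bigr => k ki; suff -> : feature k (zero_row i W) = feature k W by [].
by apply/matrixP => a b; rewrite ord1 !featureE zero_row_mul (negbTE ki).
Qed.

Definition sample_resolvent (l : R) W := resolvent (sample_cov (W *m S)) l.

Variables (l : R) (l0 : 0 < l).

Lemma sample_resolvent_bound W : opbound l^-1 (sample_resolvent l W).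
Proof. by apply: resolvent_bound => //; exact: sample_cov_psd. Qed.

Lemma trace_zero_row N K i W : opbound K N ->
  `|\tr (N *m sample_resolvent l (zero_row i W)) - \tr (N *m sample_resolvent l W)| <= K / l.
Proof.
move=> hN; rewrite /sample_resolvent (sample_cov_zero_row i W).
by apply: trace_rank_one => //; exact: sample_cov_psd.
Qed.

(** Pass through the matrix with row [i] deleted: each half is a rank-one update. *)
Lemma trace_row_change N K i (U V : 'M[R]_(n, p)) : opbound K N ->
  (forall i' j, i' != i -> U i' j = V i' j) ->
  `|\tr (N *m sample_resolvent l U) - \tr (N *m sample_resolvent l V)| <= 2 * (K / l).
Proof.
move=> hN UV; have e : zero_row i U = zero_row i V.
  by apply/matrixP => k j; rewrite !mxE; case: ifPn => // ki; exact: UV.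
have hU := trace_zero_row i U hN; have hV := trace_zero_row i V hN.
rewrite e in hU; move: hU hV; rewrite !ler_norml => /andP[? ?] /andP[? ?].
by apply/andP; split; lra.
Qed.

Lemma trace_sample_resolvent_bound N K W : opbound K N ->
  `|\tr (N *m sample_resolvent l W)| <= p%:R * (K / l).
Proof. by move=> hN; apply/opbound_trace/opbound_mul => //; exact: sample_resolvent_bound. Qed.

Lemma measurable_sample_resolvent d (T : measurableType d) (W : T -> 'M[R]_(n, p)) :
  measurable_mx W -> measurable_mx (fun t => sample_resolvent l (W t)).
Proof.
move=> mW; apply: measurable_resolvent => // [t|]; [exact: sample_cov_psd|].
apply: measurable_mxZ; first exact: measurable_cst.
have mWS : measurable_mx (fun t => W t *m S) by apply: measurable_mxM => //; exact: measurable_mx_cst.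
by apply: measurable_mxM => //; exact: measurable_mx_tr.
Qed.

End SampleResolvent.

(** * Random quadratic forms in a row with independent entries *)

Section QuadraticForms.
Context {R : realType} {d} {T : measurableType d} (P : probability T R).
Context {n p : nat} (Z : 'I_n -> 'I_p -> T -> R).
Hypothesis mZ : forall i j, measurable_fun setT (Z i j).
Let G (ij : 'I_n * 'I_p) := sigma_rv (Z ij.1 ij.2).
Hypothesis Z_indep : mutually_independent P G.
Local Notation Rintegrable := (Rintegrable P).
Local Notation Ex := (Ex P).
Context (kappa : R).
Hypothesis kappa1 : 1 <= kappa.
Hypothesis Z_mean : forall i j, Ex (Z i j) = 0.
Hypothesis Z_sq : forall i j, Ex (fun t => Z i j t ^+ 2) = 1.
Hypothesis Z_fourth_int : forall i j, Rintegrable (fun t => Z i j t ^+ 4).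
Hypothesis Z_fourth : forall i j, Ex (fun t => Z i j t ^+ 4) <= kappa.

Let Gs ij : sigma_algebra setT (G ij).
Proof. exact: sigma_rv_sigma_algebra. Qed.
Let Gm ij : G ij `<=` measurable.
Proof. exact: sigma_rv_measurable. Qed.

Lemma Z_power_int i j k : (k <= 4)%N -> Rintegrable (fun t => Z i j t ^+ k).
Proof.
move=> k4; apply: (Rintegrable_le _ _ (RintegrableD (Rintegrable_cst P 1) (Z_fourth_int i j))).
  exact: measurable_funX.
move=> t; rewrite normrX -[Z i j t ^+ 4]ger0_norm ?exprn_even_ge0// normrX.
set x := `|_|; have x0 : 0 <= x by exact: normr_ge0.
have [x1|x1] := lerP x 1.
  apply: (@le_trans _ _ 1); first by rewrite exprn_ile1.
  by rewrite lerDl exprn_ge0.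
apply: (@le_trans _ _ (x ^+ 4)); first by rewrite ler_eXn2l.
by rewrite lerDr.
Qed.

Lemma row_monomial i (k : 'I_p -> nat) : (forall m, (k m <= 4)%N) ->
  Rintegrable (fun t => \prod_m Z i m t ^+ k m) /\
  Ex (fun t => \prod_m Z i m t ^+ k m) = \prod_m Ex (fun t => Z i m t ^+ k m).
Proof.
move=> k4; pose s := [seq (i, m) | m <- index_enum 'I_p].
have us : uniq s by rewrite map_inj_uniq ?index_enum_uniq// => a b [].
pose f (ij : 'I_n * 'I_p) t := Z ij.1 ij.2 t ^+ k ij.2.
have [] := independent_prod Gs Gm Z_indep (f := f) _ _ us.
- move=> ij; apply: measurable_funX; exact: sigma_rv_measurable_wrt.
- by move=> ij; exact: Z_power_int.
rewrite big_map => h1 h2; split.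
  by apply: (eq_Rintegrable _ h1) => t; rewrite big_map.
by rewrite -h2; apply: eq_Ex => t; rewrite big_map.
Qed.

Lemma prod_count (x : 'I_p -> R) s : \prod_m x m ^+ count_mem m s = \prod_(j <- s) x j.
Proof.
elim: s => [|a s IH]; first by rewrite big_nil big1// => m _; rewrite expr0.
rewrite big_cons -IH /=; under eq_bigr do rewrite exprD.
rewrite big_split /=; congr (_ * _).
rewrite (bigD1 a)//= eqxx expr1 big1 ?mulr1// => m ma.
by rewrite eq_sym (negbTE ma) expr0.
Qed.

(** Independence factors a product of entries of one row, repetitions allowed,
    according to the multiplicity of each column. *)
Lemma row_word i (s : seq 'I_p) : (size s <= 4)%N ->
  Rintegrable (fun t => \prod_(j <- s) Z i j t) /\
  Ex (fun t => \prod_(j <- s) Z i j t) = \prod_m Ex (fun t => Z i m t ^+ count_mem m s).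
Proof.
move=> s4; have [h1 h2] := @row_monomial i (fun m => count_mem m s)
  (fun m => leq_trans (count_size _ _) s4).
split; last by rewrite -h2; apply: eq_Ex => t; rewrite prod_count.
by apply: (eq_Rintegrable _ h1) => t; rewrite prod_count.
Qed.

Lemma row_word0 i s m : (size s <= 4)%N -> count_mem m s = 1 ->
  Ex (fun t => \prod_(j <- s) Z i j t) = 0.
Proof.
move=> s4 m1; rewrite (row_word i s4).2 (bigD1 m)//= m1.
by under eq_Ex do rewrite expr1; rewrite Z_mean mul0r.
Qed.

Lemma row_word1 i s : (size s <= 4)%N ->
  (forall m, count_mem m s = 0 \/ count_mem m s = 2) ->
  Ex (fun t => \prod_(j <- s) Z i j t) = 1.
Proof.
move=> s4 h; rewrite (row_word i s4).2 big1// => m _.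
case: (h m) => ->; last exact: Z_sq.
by under eq_Ex do rewrite expr0; rewrite Ex_cst.
Qed.

Lemma row_covariance i a b : Ex (fun t => Z i a t * Z i b t) = (a == b)%:R.
Proof.
have e : (fun t => Z i a t * Z i b t) =1 (fun t => \prod_(j <- [:: a; b]) Z i j t).
  by move=> t; rewrite big_cons big_seq1.
rewrite (eq_Ex P e); have [->|ab] := eqVneq a b.
  apply: row_word1 => // m /=; case: (b == m); [by right|by left].
by apply: (@row_word0 _ _ a) => //=; rewrite eqxx (eq_sym b) (negbTE ab).
Qed.

Lemma row_covariance_int i a b : Rintegrable (fun t => Z i a t * Z i b t).
Proof.
have [h _] := @row_word i [:: a; b] erefl.
by apply: (eq_Rintegrable _ h) => t; rewrite big_cons big_seq1.
Qed.

(** The moment vanishes as soon as some column occurs exactly once, so only the three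
    pairings of the four columns contribute.  The constant [kappa] bounds the moment
    when the four columns coincide and, being at least one, also when they only
    agree in pairs. *)
Lemma row_fourth i a b c e :
  `|Ex (fun t => \prod_(j <- [:: a; b; c; e]) Z i j t) - ((a == b) && (c == e))%:R| <=
  kappa * (((a == c) && (b == e))%:R + ((a == e) && (b == c))%:R).
Proof.
have dec (x y : 'I_p) : x = y \/ x != y by case: eqVneq; [left|right].
have k0 : 0 <= kappa by rewrite (le_trans _ kappa1).
have zero m : count_mem m [:: a; b; c; e] = 1 -> ~~ ((a == b) && (c == e)) ->
    `|Ex (fun t => \prod_(j <- [:: a; b; c; e]) Z i j t) - ((a == b) && (c == e))%:R| <=
    kappa * (((a == c) && (b == e))%:R + ((a == e) && (b == c))%:R).
  move=> m1 /negbTE ->; rewrite (row_word0 i _ m1)// subr0 normr0.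
  by rewrite mulr_ge0// addr_ge0// ler0n.
have one : (forall m, count_mem m [:: a; b; c; e] = 0 \/ count_mem m [:: a; b; c; e] = 2) ->
    Ex (fun t => \prod_(j <- [:: a; b; c; e]) Z i j t) = 1 by exact: row_word1.
have [ab|ab] := dec a b.
  subst b; have [ce|ce] := dec c e.
    subst e; have [ac|ac] := dec a c.
      subst c => /=; have e4 : (fun t => \prod_(j <- [:: a; a; a; a]) Z i j t) =1
          (fun t => Z i a t ^+ 4).
        by move=> t; rewrite !big_cons big_nil; ring.
      rewrite (eq_Ex P e4); have := Z_fourth i a.
      have : 0 <= Ex (fun t => Z i a t ^+ 4).
        by apply: Ex_ge0 => t; rewrite exprn_even_ge0.
      rewrite ?eqxx /=; move: kappa1; set E4 := Ex _ => k1 h1 h2.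
      by rewrite ler_norml; apply/andP; split; lra.
    rewrite one; first by rewrite !eqxx /= subrr normr0 mulr_ge0// addr_ge0// ler0n.
    move=> m /=; have [am|am] := dec a m.
      by subst m; rewrite eqxx (eq_sym c) (negbTE ac); right.
    by rewrite (negbTE am); case: (c == m); [right|left].
  have [ac|ac] := dec c a.
    subst c; apply: (zero e); last by rewrite (negbTE ce) andbF.
    by rewrite /= (negbTE ce) eqxx.
  apply: (zero c); last by rewrite (negbTE ce) andbF.
  by rewrite /= (eq_sym a) (negbTE ac) eqxx (eq_sym e) (negbTE ce).
have nab : ~~ ((a == b) && (c == e)) by rewrite (negbTE ab).
have [ac|ac] := dec a c.
  subst c; have [be|be] := dec b e.
    subst e; rewrite one ?(negbTE ab)/=; last first.
      move=> m /=; have [am|am] := dec a m.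
        by subst m; rewrite eqxx (eq_sym b) (negbTE ab); right.
      by rewrite (negbTE am); case: (b == m); [right|left].
    rewrite subr0 normr1 !eqxx /= -[leLHS]mulr1 ler_pM//.
    by rewrite lerDl ler0n.
  apply: (zero b) => //.
  by rewrite /= eqxx (negbTE ab) (eq_sym e) (negbTE be).
have [ae|ae] := dec a e.
  subst e; have [bc|bc] := dec b c.
    subst c; rewrite one ?(negbTE ab)/=; last first.
      move=> m /=; have [am|am] := dec a m.
        by subst m; rewrite eqxx (eq_sym b) (negbTE ab); right.
      by rewrite (negbTE am); case: (b == m); [right|left].
    rewrite subr0 normr1 !eqxx /= -[leLHS]mulr1 ler_pM//.
    by rewrite lerDr ler0n.
  apply: (zero b) => //.
  by rewrite /= eqxx (negbTE ab) (eq_sym c) (negbTE bc).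
apply: (zero a) => //.
by rewrite /= eqxx !(eq_sym _ a) (negbTE ab) (negbTE ac) (negbTE ae).
Qed.

Definition other_rows (i : 'I_n) : {set 'I_n * 'I_p} := [set ij : 'I_n * 'I_p | ij.1 != i]%SET.
Definition this_row (i : 'I_n) : {set 'I_n * 'I_p} := [set ij : 'I_n * 'I_p | ij.1 == i]%SET.

(** The covariance of [Z_u1 * Z_u2] and [Z_v1 * Z_v2] is nonzero only if [v] is [u] or [u]
    swapped. *)
Let centred i (u : 'I_p * 'I_p) t := Z i u.1 t * Z i u.2 t - (u.1 == u.2)%:R.

Let centred_wrt i u : measurable_wrt (gen_over G (this_row i)) (centred i u).
Proof.
have mij j : measurable_wrt (gen_over G (this_row i)) (Z i j).
  apply: (gen_over_measurable_wrt (i := (i, j))); first by rewrite inE.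
  exact: sigma_rv_measurable_wrt.
by apply: measurable_funB; [exact: (measurable_funM (mij _) (mij _))|exact: measurable_cst].
Qed.

Let centred_int i u : Rintegrable (centred i u).
Proof. by apply: RintegrableB; [exact: row_covariance_int|exact: Rintegrable_cst]. Qed.

Let centred_mean i u : Ex (centred i u) = 0.
Proof.
rewrite ExB ?row_covariance ?Ex_cst ?subrr//; first exact: row_covariance_int.
exact: Rintegrable_cst.
Qed.

Let centred2 i u v : Rintegrable (fun t => centred i u t * centred i v t) /\
  `|Ex (fun t => centred i u t * centred i v t)| <=
    kappa * ((v == u)%:R + (v == (u.2, u.1))%:R).
Proof.
case: u v => [a b] [c e].
have [h4 _] := @row_word i [:: a; b; c; e] erefl.
pose r t := (a == b)%:R * (Z i c t * Z i e t) + (c == e)%:R * (Z i a t * Z i b t).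
have ri : Rintegrable r by apply: RintegrableD; apply: RintegrableZl; exact: row_covariance_int.
pose k : R := (a == b)%:R * (c == e)%:R.
have E : (fun t => centred i (a, b) t * centred i (c, e) t) =1
    (fun t => (\prod_(j <- [:: a; b; c; e]) Z i j t - r t) + k).
  by move=> t; rewrite /centred /r /k !big_cons big_nil /=; ring.
have hi : Rintegrable (fun t => \prod_(j <- [:: a; b; c; e]) Z i j t - r t) by exact: RintegrableB.
split.
  by apply: (eq_Rintegrable (fun t => esym (E t))); apply: RintegrableD => //; exact: Rintegrable_cst.
rewrite (eq_Ex P E) ExD//; last exact: Rintegrable_cst.
rewrite ExB// Ex_cst ExD; try by apply: RintegrableZl; exact: row_covariance_int.
rewrite !ExZl; try exact: row_covariance_int.
rewrite !row_covariance (_ : _ - _ + _ = Ex (fun t => \prod_(j <- [:: a; b; c; e]) Z i j t) - k).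
  apply: (@le_trans _ _ (kappa * (((a == c) && (b == e))%:R + ((a == e) && (b == c))%:R))).
    by rewrite /k -natrM mulnb; exact: row_fourth.
  rewrite !xpair_eqE (eq_sym a c) (eq_sym b e) (eq_sym a e) (eq_sym b c).
  by rewrite [(e == a) && _]andbC.
by rewrite /k; ring.
Qed.

Let sum_delta (c : 'I_p * 'I_p -> R) w : \sum_v c v * (v == w)%:R = c w.
Proof.
rewrite (bigD1 w)//= eqxx mulr1 big1 ?addr0// => v vw.
by rewrite (negbTE vw) mulr0.
Qed.

(** After expansion of the square, the centred products of entries are orthogonal except
    for a pair and its swap, so the second moment costs the sum of the squared
    coefficients.  The coefficients may be random provided that they depend on the
    other rows only. *)
Lemma quadratic_form i (B : 'I_p * 'I_p -> T -> R) (L F : R) :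
  (forall u, measurable_wrt (gen_over G (other_rows i)) (B u)) ->
  (forall u t, `|B u t| <= L) -> (forall t, \sum_u B u t ^+ 2 <= F) ->
  let q t := \sum_u B u t * (Z i u.1 t * Z i u.2 t - (u.1 == u.2)%:R) in
  [/\ Rintegrable q, Ex q = 0, Rintegrable (fun t => q t ^+ 2) &
      Ex (fun t => q t ^+ 2) <= 2 * kappa * F].
Proof.
move=> mB BL BF q.
have k0 : 0 <= kappa by rewrite (le_trans _ kappa1).
have indep : independent2 P (gen_over G (other_rows i)) (gen_over G (this_row i)).
  by apply: gen_over_independent2 => // ij; rewrite !inE.
have Gmo := gen_over_measurable Gm (J := other_rows i).
have Gmt := gen_over_measurable Gm (J := this_row i).
have Bi u : Rintegrable (B u).
  apply: (@Rintegrable_bounded _ _ _ _ _ L) => //.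
  exact: measurable_wrt_measurable (mB u).
have BBm u v : measurable_wrt (gen_over G (other_rows i)) (fun t => B u t * B v t).
  exact: (measurable_funM (mB u) (mB v)).
have BBi u v : Rintegrable (fun t => B u t * B v t).
  apply: (@Rintegrable_bounded _ _ _ _ _ (L * L)).
    exact: measurable_wrt_measurable (BBm u v).
  by move=> t; rewrite normrM ler_pM.
have h1 u := independent2_integrable_mul (@Gmo) (@Gmt) indep (mB u) (@centred_wrt i u)
  (Bi u) (@centred_int i u).
have CCm u v : measurable_wrt (gen_over G (this_row i))
    (fun t => centred i u t * centred i v t).
  exact: (measurable_funM (@centred_wrt i u) (@centred_wrt i v)).
have h2 u v := independent2_integrable_mul (@Gmo) (@Gmt) indep (BBm u v)
  (CCm u v) (BBi u v) (@centred2 i u v).1.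
have q2 t : q t ^+ 2 = \sum_u \sum_v (B u t * B v t) * (centred i u t * centred i v t).
  rewrite expr2 mulr_suml; apply: eq_bigr => u _; rewrite mulr_sumr.
  by apply: eq_bigr => v _; rewrite /centred; ring.
have q2i : Rintegrable (fun t => q t ^+ 2).
  apply: (eq_Rintegrable (fun t => esym (q2 t))).
  by apply: Rintegrable_sum => u; apply: Rintegrable_sum => v; exact: (h2 u v).1.
split=> //.
- by apply: Rintegrable_sum => u; exact: (h1 u).1.
- rewrite Ex_sum; last by move=> u; exact: (h1 u).1.
  by rewrite big1// => u _; rewrite (h1 u).2 centred_mean mulr0.
rewrite (eq_Ex P q2) Ex_sum; last first.
  by move=> u; apply: Rintegrable_sum => v; exact: (h2 u v).1.
pose m u := Ex (fun t => B u t ^+ 2).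
have B2i u : Rintegrable (fun t => B u t ^+ 2).
  by apply: (eq_Rintegrable _ (BBi u u)) => t; rewrite expr2.
have cs u v : `|Ex (fun t => B u t * B v t)| <= (m u + m v) / 2.
  apply: le_trans (Ex_abs (BBi u v)) _.
  (* Cauchy-Schwarz in its arithmetic-mean form. *)
  have -> : (m u + m v) / 2 = Ex (fun t => 2^-1 * (B u t ^+ 2 + B v t ^+ 2)).
    by rewrite ExZl ?ExD// 1?mulrC//; exact: RintegrableD.
  apply: Ex_le; [exact: Rintegrable_abs|by apply: RintegrableZl; exact: RintegrableD|].
  move=> t; have := sqr_ge0 (B u t - B v t); have := sqr_ge0 (B u t + B v t).
  by rewrite ler_norml => ? ?; apply/andP; split; nra.
apply: (@le_trans _ _ (\sum_u kappa * (m u + (m u + m (u.2, u.1)) / 2))).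
  apply: ler_sum => u _; rewrite Ex_sum; last by move=> v; exact: (h2 u v).1.
  apply: (@le_trans _ _ (\sum_v (kappa * ((m u + m v) / 2) * (v == u)%:R +
      kappa * ((m u + m v) / 2) * (v == (u.2, u.1))%:R))).
    apply: ler_sum => v _; rewrite (h2 u v).2.
    apply: le_trans (ler_norm _) _; rewrite normrM -mulrDr mulrAC mulrC [leRHS]mulrC.
    rewrite [leLHS]mulrC ler_pM//.
    exact: (@centred2 i u v).2.
  rewrite big_split /= !sum_delta -mulrDr ler_wpM2l//.
  by have : (m u + m u) / 2 = m u; [field|move=> ->].
rewrite -mulr_sumr big_split /= -mulr_suml big_split /=.
have -> : \sum_(u : 'I_p * 'I_p) m (u.2, u.1) = \sum_u m u.
  rewrite (reindex (fun u : 'I_p * 'I_p => (u.2, u.1)))/=; last first.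
    by exists (fun u => (u.2, u.1)) => -[].
  by apply: eq_bigr => -[].
have : \sum_u m u <= F.
  rewrite -Ex_sum// -[leRHS](Ex_cst P); apply: Ex_le => //.
    exact: Rintegrable_sum.
  exact: Rintegrable_cst.
set s := \sum_u m u => sF; rewrite (_ : kappa * _ = 2 * kappa * s); last by field.
by rewrite ler_wpM2l// mulr_ge0.
Qed.

End QuadraticForms.

(** * The approximate fixed-point equation for the mean trace *)

Section Expansions.
Context {R : realType} {p : nat} (M : 'M[R]_p).

Lemma quad_expand (z : 'cV[R]_p) :
  dot z (M *m z) = \sum_(u : 'I_p * 'I_p) M u.1 u.2 * (z u.1 0 * z u.2 0).
Proof.
rewrite dotE -(pair_big xpredT xpredT (fun a c => M a c * (z a 0 * z c 0)))/=.
apply: eq_bigr => a _; rewrite mxE mulr_sumr; apply: eq_bigr => c _.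
by rewrite mulrCA mulrA.
Qed.

Lemma trace_expand : \tr M = \sum_(u : 'I_p * 'I_p) M u.1 u.2 * (u.1 == u.2)%:R.
Proof.
rewrite -(pair_big xpredT xpredT (fun a c => M a c * (a == c)%:R))/=.
apply: eq_bigr => a _; rewrite (bigD1 a)//= eqxx mulr1 big1 ?addr0// => c ca.
by rewrite eq_sym (negbTE ca) mulr0.
Qed.

Lemma trace_rotate (A B D E : 'M[R]_p) :
  \tr (A *m (D *m E *m B)) = \tr ((B *m A) *m D *m E).
Proof. by rewrite mulmxA mxtrace_mulC !mulmxA. Qed.

Lemma trace_rotate3 (A B D : 'M[R]_p) : \tr (A *m B *m D) = \tr (D *m A *m B).
Proof. by rewrite mxtrace_mulC mulmxA. Qed.

End Expansions.

Section FixedPoint.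
Context {R : realType} {d} {T : measurableType d} (P : probability T R).
Context {n p : nat} (Z : 'I_n -> 'I_p -> T -> R).
Hypothesis n0 : (0 < n)%N.
Hypothesis mZ : forall i j, measurable_fun setT (Z i j).
Let G (ij : 'I_n * 'I_p) := sigma_rv (Z ij.1 ij.2).
Hypothesis Z_indep : mutually_independent P G.
Local Notation Rintegrable := (Rintegrable P).
Local Notation Ex := (Ex P).
Context (kappa : R).
Hypothesis kappa1 : 1 <= kappa.
Hypothesis Z_mean : forall i j, Ex (Z i j) = 0.
Hypothesis Z_sq : forall i j, Ex (fun t => Z i j t ^+ 2) = 1.
Hypothesis Z_fourth_int : forall i j, Rintegrable (fun t => Z i j t ^+ 4).
Hypothesis Z_fourth : forall i j, Ex (fun t => Z i j t ^+ 4) <= kappa.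
Context (S : 'M[R]_p) (c0 l rho : R).
Hypothesis ST : S^T = S.
Hypothesis S_bound : opbound c0 S.
Hypothesis l0 : 0 < l.
Hypothesis p_rho : p%:R <= rho * n%:R.

Context (Sig : 'M[R]_p).
Hypothesis SigE : S *m S = Sig.
Let C := c0 * c0.
Let W (t : T) := Zmx Z t.
Let Q (t : T) := sample_resolvent S l (W t).
Let Qi i (t : T) := sample_resolvent S l (zero_row i (W t)).
Let x i (t : T) := feature S i (W t).

Let C0 : 0 <= C. Proof. by rewrite mulr_ge0 ?S_bound.1. Qed.
Let kappa0 : 0 <= kappa. Proof. by rewrite (le_trans _ kappa1). Qed.
Let nR : 0 < n%:R :> R. Proof. by rewrite ltr0n. Qed.
Let Sig_bound : opbound C Sig. Proof. by rewrite -SigE; exact: opbound_mul. Qed.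

Lemma gram_psd : psd Sig.
Proof.
rewrite -SigE; split; first by rewrite trmx_mul ST.
by move=> u; rewrite -!mulmxA -/(dot _ _) -{1}ST -dot_mull sqn_ge0.
Qed.

(** One plus this trace is the conditional risk at the optimal regularization. *)
Definition tau_of (V : 'M[R]_(n, p)) : R := n%:R^-1 * \tr (Sig *m sample_resolvent S l V).
Definition tau (t : T) : R := tau_of (W t).
Definition taubar : R := Ex tau.

Lemma tau_of_ge0 V : 0 <= tau_of V.
Proof.
apply: mulr_ge0; first by rewrite invr_ge0 ltW.
rewrite -SigE; apply: psd_trace_mul => //.
by apply: resolvent_psd => //; exact: sample_cov_psd.
Qed.

Lemma tau_of_bounded V : `|tau_of V| <= n%:R^-1 * (p%:R * (C / l)).
Proof.
rewrite normrM ger0_norm ?invr_ge0 ?(ltW nR)//; apply: ler_wpM2l; rewrite ?invr_ge0 ?(ltW nR)//.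
exact: trace_sample_resolvent_bound.
Qed.

Lemma tau_of_diff i (U V : 'M[R]_(n, p)) : (forall i' j, i' != i -> U i' j = V i' j) ->
  `|tau_of U - tau_of V| <= n%:R^-1 * (2 * (C / l)).
Proof.
move=> UV; rewrite -mulrBr normrM ger0_norm ?invr_ge0 ?(ltW nR)//.
apply: ler_wpM2l; rewrite ?invr_ge0 ?(ltW nR)//.
exact: trace_row_change UV.
Qed.

Lemma measurable_trace_resolvent d' (T' : measurableType d') (V : T' -> 'M[R]_(n, p)) N :
  measurable_mx V -> measurable_fun setT (fun t => \tr (N *m sample_resolvent S l (V t))).
Proof.
move=> mV; apply: measurable_trace; apply: measurable_mxM; first exact: measurable_mx_cst.
exact: measurable_sample_resolvent.
Qed.

Lemma measurable_tau_of d' (T' : measurableType d') (V : T' -> 'M[R]_(n, p)) :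
  measurable_mx V -> measurable_fun setT (fun t => tau_of (V t)).
Proof.
move=> mV; apply: measurable_funM; first exact: measurable_cst.
exact: measurable_trace_resolvent.
Qed.

Let mW : measurable_mx W. Proof. exact: Zmx_measurable. Qed.

Lemma tau_int : Rintegrable tau.
Proof.
apply: (@Rintegrable_bounded _ _ _ _ _ (n%:R^-1 * (p%:R * (C / l)))).
  exact: measurable_tau_of.
by move=> t; exact: tau_of_bounded.
Qed.

Lemma taubar_ge0 : 0 <= taubar.
Proof. by apply: Ex_ge0 => t; exact: tau_of_ge0. Qed.

Lemma tau_concentration :
  Ex (fun t => (tau t - taubar) ^+ 2) <= n%:R * (n%:R^-1 * (2 * (C / l))) ^+ 2 /\
  Ex (fun t => (tau t - taubar) ^+ 4) <= 11 * n%:R ^+ 2 * (n%:R^-1 * (2 * (C / l))) ^+ 4.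
Proof.
exact: (concentration mZ Z_indep measurable_tau_of tau_of_bounded tau_of_diff).
Qed.

Section Feature.
Variables (i : 'I_n) (D : 'M[R]_p) (k : R).
Hypothesis hD : opbound k D.
Let b t := dot (x i t) (D *m (Qi i t *m x i t)).
Let m t := \tr (Sig *m D *m Qi i t).
Let K := C * k / l.

Let K0 : 0 <= K.
Proof. by apply: divr_ge0; [apply: mulr_ge0 => //; exact: hD.1|exact: ltW]. Qed.

Let Mx t := S *m (D *m Qi i t) *m S.

Let Mx_bound t : opbound K (Mx t).
Proof.
rewrite (_ : K = c0 * (k * l^-1) * c0); last by rewrite /K /C; ring.
apply: opbound_mul => //; apply: opbound_mul => //; apply: opbound_mul => //.
exact: sample_resolvent_bound.
Qed.

Let bE t : b t - m t =
  \sum_u Mx t u.1 u.2 * (Z i u.1 t * Z i u.2 t - (u.1 == u.2)%:R).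
Proof.
under eq_bigr do rewrite mulrBr; rewrite sumrB; congr (_ - _).
  rewrite /b /x /feature dot_mull ST.
  have -> : S *m (D *m (Qi i t *m (S *m (row i (W t))^T))) = Mx t *m (row i (W t))^T.
    by rewrite /Mx !mulmxA.
  rewrite quad_expand; apply: eq_bigr => u _.
  by rewrite !mxE.
rewrite /m -SigE -mulmxA -[S *m S *m _]mulmxA mxtrace_mulC -/(Mx t) trace_expand.
by [].
Qed.

Let centred_quadratic : [/\ Rintegrable (fun t => b t - m t), Ex (fun t => b t - m t) = 0,
  Rintegrable (fun t => (b t - m t) ^+ 2) &
  Ex (fun t => (b t - m t) ^+ 2) <= 2 * kappa * (p%:R * K ^+ 2)].
Proof.
pose B u t := Mx t u.1 u.2.
have mB u : measurable_wrt (gen_over G (other_rows i)) (B u).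
  pose T' := g_sigma_algebraType (gen_over G (other_rows i)).
  have mz : measurable_mx (fun t : T' => zero_row i (W t)).
    move=> a c; apply: (measurable_ext (f := fun t : T' => if a == i then 0 else Z a c t)).
      by move=> t; rewrite !mxE.
    case: (eqVneq a i) => [_|ai]; first exact: measurable_cst.
    apply: (gen_over_measurable_wrt (i := (a, c))); first by rewrite inE.
    exact: sigma_rv_measurable_wrt.
  have mQ : measurable_mx (fun t : T' => Qi i t) by exact: measurable_sample_resolvent.
  have : measurable_mx (fun t : T' => S *m (D *m Qi i t) *m S).
    apply: measurable_mxM; last exact: measurable_mx_cst.
    apply: measurable_mxM; first exact: measurable_mx_cst.
    by apply: measurable_mxM => //; exact: measurable_mx_cst.
  by move/(_ u.1 u.2).
have BK u t : `|B u t| <= K by apply: opbound_entry.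
have BF t : \sum_u B u t ^+ 2 <= p%:R * K ^+ 2.
  rewrite -(pair_big xpredT xpredT (fun a c => Mx t a c ^+ 2))/=.
  exact: opbound_frobenius.
have [h1 h2 h3 h4] := quadratic_form mZ Z_indep kappa1 Z_mean Z_sq Z_fourth_int Z_fourth mB BK BF.
split.
- by apply: (eq_Rintegrable _ h1) => t; rewrite bE.
- by rewrite -[RHS]h2; apply: eq_Ex => t; rewrite bE.
- by apply: (eq_Rintegrable _ h3) => t; rewrite bE.
- by apply: le_trans h4; rewrite le_eqVlt; apply/orP; left; apply/eqP/eq_Ex => t; rewrite bE.
Qed.

(** A row is independent of the resolvent in which it has been deleted, so its
    quadratic form concentrates around the trace against [Sig]. *)
Lemma feature_quad : [/\ Rintegrable (fun t => b t - m t), Ex (fun t => b t - m t) = 0,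
  Rintegrable (fun t => (b t - m t) ^+ 2),
  Ex (fun t => (b t - m t) ^+ 2) <= 2 * kappa * (p%:R * K ^+ 2) &
  forall t, `|m t| <= p%:R * K].
Proof.
have [h1 h2 h3 h4] := centred_quadratic; split=> // t.
rewrite /K -mulrA (mulrA C); apply: trace_sample_resolvent_bound => //.
exact: opbound_mul.
Qed.

End Feature.

(** The deterministic equivalent of [Q]: each row is discounted by the mean leverage
    [1 + taubar]. *)
Let Qb := resolvent ((1 + taubar)^-1 *: Sig) l.
Let N := Qb *m Sig.
Let lev i t := n%:R^-1 * dot (x i t) (Qi i t *m x i t).

Let tb1 : 0 < 1 + taubar. Proof. by rewrite ltr_pwDl// taubar_ge0. Qed.

Let Sigb_psd : psd ((1 + taubar)^-1 *: Sig).
Proof.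
have [h1 h2] := gram_psd; split; first by rewrite linearZ /= h1.
move=> u; rewrite -scalemxAr -scalemxAl mxE mulr_ge0//.
by rewrite invr_ge0 ltW.
Qed.

Let lev_ge0 i t : 0 <= lev i t.
Proof.
apply: mulr_ge0; first by rewrite invr_ge0 ltW.
by apply: psd_dot; apply: resolvent_psd => //; exact: sample_cov_psd.
Qed.

Let trace_feature i t (D : 'M[R]_p) : \tr (D *m Q t *m (x i t *m (x i t)^T)) =
  (1 + lev i t)^-1 * dot (x i t) (D *m (Qi i t *m x i t)).
Proof.
rewrite mulmxA mxtrace_mulC trace_mx11 -/(dot _ _) -mulmxA.
rewrite /Q /sample_resolvent (sample_cov_zero_row ST i (W t)).
have s0 : 0 <= n%:R^-1 :> R by rewrite invr_ge0 ltW.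
rewrite (resolvent_rank_one (x i t) (sample_cov_psd (zero_row i (W t) *m S)) l0 s0).
by rewrite -scalemxAr dotZr.
Qed.

(** The resolvent identity compares [Q] with its deterministic equivalent; the
    Sherman-Morrison formula then expresses the contribution of each row through the
    resolvent in which that row is deleted. *)
Lemma trace_decomposition t : \tr (Sig *m Q t) - \tr (Sig *m Qb) =
  (1 + taubar)^-1 * \tr (Sig *m N *m Q t) -
  n%:R^-1 * \sum_i (1 + lev i t)^-1 * dot (x i t) (N *m (Qi i t *m x i t)).
Proof.
rewrite -linearB /= -mulmxBr {1}/Q /sample_resolvent (resolvent_diff _ Sigb_psd)//; last first.
  exact: sample_cov_psd.
rewrite opprD addrACA subrr addr0 -/(sample_resolvent _ _ _) -/(Q t) -/Qb.
rewrite trace_rotate -/N mulmxBr linearB /=; congr (_ - _).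
  by rewrite -scalemxAr linearZ /=; congr (_ * _); exact: trace_rotate3.
rewrite sample_cov_features// -scalemxAr linearZ /=; congr (_ * _).
rewrite mulmx_sumr linear_sum; apply: eq_bigr => i _.
exact: trace_feature.
Qed.

Let k1 := l^-1 * C.
Let K1 := C * k1 / l.
Let KN : opbound k1 N.
Proof. by apply: opbound_mul => //; exact: resolvent_bound. Qed.

Let k1_ge0 : 0 <= k1. Proof. exact: KN.1. Qed.
Let K1_ge0 : 0 <= K1. Proof. by apply: divr_ge0; [exact: mulr_ge0|exact: ltW]. Qed.

Let b i t := dot (x i t) (N *m (Qi i t *m x i t)).
Let m i t := \tr (Sig *m N *m Qi i t).
Let m0 i t := \tr (Sig *m 1%:M *m Qi i t).

Let opbound1 : opbound (1 : R) (1%:M : 'M[R]_p).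
Proof. by split=> [|u] //; rewrite mul1mx expr1n mul1r. Qed.

(** The trace difference plus centred quadratic forms, which have mean zero: what is left
    in [YE] is small term by term, by a rank-one change of resolvent and by the
    concentration of the leverages. *)
Let Y t := \tr (Sig *m Q t) - \tr (Sig *m Qb) +
  n%:R^-1 * \sum_i (1 + taubar)^-1 * (b i t - m i t).

Let YE t : Y t = n%:R^-1 * \sum_i ((1 + taubar)^-1 * (\tr (Sig *m N *m Q t) - m i t) +
  b i t * (lev i t - taubar) / ((1 + taubar) * (1 + lev i t))).
Proof.
rewrite /Y trace_decomposition.
have -> : (1 + taubar)^-1 * \tr (Sig *m N *m Q t) =
    n%:R^-1 * \sum_(i < n) (1 + taubar)^-1 * \tr (Sig *m N *m Q t).
  rewrite sumr_const card_ord -[X in _ = _ * X]mulr_natl [RHS]mulrA mulVf ?mul1r// gt_eqF//.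
rewrite -mulrBr -mulrDr -sumrB -big_split /=; congr (_ * _); apply: eq_bigr => i _.
have := lev_ge0 i t; rewrite -/(b i t); move: tb1 => t1 l1.
have l1' : 0 < 1 + lev i t by rewrite ltr_pwDl.
by field; rewrite !gt_eqF.
Qed.

Let e2 i t := (lev i t - n%:R^-1 * m0 i t) ^+ 2.
Let bm2 i t := (b i t - m i t) ^+ 2.

(** [theta] balances, in Young's inequality, the size of the quadratic form [b] against the
    fluctuation of the leverage around its mean. *)
Let Y_bound (theta : R) t : 0 < theta -> `|Y t| <= n%:R^-1 * \sum_(i < n)
  (K1 + theta * (bm2 i t + (p%:R * K1) ^+ 2) +
   3 / (2 * theta) * (e2 i t + (n%:R^-1 * (C / l)) ^+ 2 + (tau t - taubar) ^+ 2)).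
Proof.
move=> th0; rewrite YE normrM ger0_norm ?invr_ge0 ?(ltW nR)//.
apply: ler_wpM2l; first by rewrite invr_ge0 ltW.
apply: le_trans (ler_norm_sum _ _ _) _; apply: ler_sum => i _.
apply: le_trans (ler_normD _ _) _; rewrite -addrA; apply: lerD.
  rewrite normrM gtr0_norm ?invr_gt0// distrC.
  rewrite -[leRHS]mul1r; apply: ler_pM => //; first by rewrite invr_ge0 ltW.
    by rewrite invf_le1// lerDl taubar_ge0.
  have := trace_zero_row ST l0 i (W t) (opbound_mul Sig_bound KN).
  by move/le_trans; apply; rewrite lexx.
have ab : `|b i t * (lev i t - taubar) / ((1 + taubar) * (1 + lev i t))| <=
    `|b i t| * `|lev i t - taubar|.
  rewrite !normrM -[leRHS]mulr1; apply: ler_pM => //.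
  rewrite ger0_norm ?invr_ge0 ?mulr_ge0 ?(ltW tb1)// ?addr_ge0//.
  rewrite invf_le1; first by rewrite mulr_ege1// lerDl ?taubar_ge0.
  by rewrite mulr_gt0// ltr_pwDl.
apply: le_trans ab _.
have mb : m i t ^+ 2 <= (p%:R * K1) ^+ 2.
  have [_ _ _ _ h] := feature_quad i KN.
  rewrite -[m i t ^+ 2]real_normK ?num_real// lerXn2r ?nnegrE//; last exact: h.
  by apply: mulr_ge0.
have d0 : (n%:R^-1 * m0 i t - tau t) ^+ 2 <= (n%:R^-1 * (C / l)) ^+ 2.
  have ni : 0 <= n%:R^-1 :> R by rewrite invr_ge0 ltW.
  rewrite -[leLHS]real_normK ?num_real// lerXn2r ?nnegrE//.
    by apply: mulr_ge0 => //; apply: divr_ge0 => //; exact: ltW.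
  rewrite /tau /tau_of -mulrBr normrM ger0_norm//; apply: ler_wpM2l => //.
  by rewrite /m0 mulmx1; exact: trace_zero_row.
have hb : b i t ^+ 2 <= 2 * (bm2 i t + (p%:R * K1) ^+ 2).
  have := sqr_ge0 (b i t - m i t - m i t); rewrite /bm2; move: mb.
  set q := (_ * _) ^+ 2; nra.
have he : (lev i t - taubar) ^+ 2 <=
    3 * (e2 i t + (n%:R^-1 * (C / l)) ^+ 2 + (tau t - taubar) ^+ 2).
  have -> : lev i t - taubar = (lev i t - n%:R^-1 * m0 i t) + (n%:R^-1 * m0 i t - tau t) +
    (tau t - taubar) by ring.
  rewrite /e2; move: d0; set u := lev i t - _; set v := n%:R^-1 * m0 i t - _.
  set w := tau t - _; set q := (_ * _) ^+ 2 => d0.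
  have := sqr_ge0 (u - v); have := sqr_ge0 (u - w); have := sqr_ge0 (v - w).
  nra.
have young : `|b i t| * `|lev i t - taubar| <=
    (theta * b i t ^+ 2 + theta^-1 * (lev i t - taubar) ^+ 2) / 2.
  rewrite -[b i t ^+ 2]real_normK ?num_real// -[(_ - _) ^+ 2]real_normK ?num_real//.
  set u := `|b i t|; set v := `|_|.
  have : 0 <= theta^-1 * (theta * u - v) ^+ 2.
    by apply: mulr_ge0; rewrite ?sqr_ge0// invr_ge0 ltW.
  have -> : theta^-1 * (theta * u - v) ^+ 2 = theta * u ^+ 2 - 2 * (u * v) + theta^-1 * v ^+ 2.
    by field; rewrite gt_eqF.
  lra.
apply: le_trans young _.
have th1 : 0 < theta^-1 by rewrite invr_gt0.
have h1 := ler_wpM2l (ltW th0) hb; have h2 := ler_wpM2l (ltW th1) he.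
have -> : 3 / (2 * theta) = theta^-1 * (3 / 2) by field; rewrite gt_eqF.
move: h1 h2; set u := theta * b i t ^+ 2; set v := theta^-1 * (lev i t - taubar) ^+ 2.
by lra.
Qed.

Let trace_int : Rintegrable (fun t => \tr (Sig *m Q t)).
Proof.
apply: (@Rintegrable_bounded _ _ _ _ _ (p%:R * (C / l))).
  exact: measurable_trace_resolvent.
by move=> t; exact: trace_sample_resolvent_bound.
Qed.

Let b_int i : Rintegrable (fun t => (1 + taubar)^-1 * (b i t - m i t)).
Proof. by have [h _ _ _ _] := feature_quad i KN; exact: RintegrableZl. Qed.

Let b_sum_int : Rintegrable (fun t => n%:R^-1 * \sum_i (1 + taubar)^-1 * (b i t - m i t)).
Proof. by apply: RintegrableZl; apply: Rintegrable_sum. Qed.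

Let traceB_int : Rintegrable (fun t => \tr (Sig *m Q t) - \tr (Sig *m Qb)).
Proof. by apply: RintegrableB => //; exact: Rintegrable_cst. Qed.

Let Y_int : Rintegrable Y.
Proof. exact: RintegrableD. Qed.

Let Y_mean : Ex Y = n%:R * taubar - \tr (Sig *m Qb).
Proof.
have z : Ex (fun t => \sum_i (1 + taubar)^-1 * (b i t - m i t)) = 0.
  rewrite Ex_sum// big1// => i _.
  by have [h1 h2 _ _ _] := feature_quad i KN; rewrite ExZl// h2 mulr0.
rewrite /Y ExD// ExB//; last exact: Rintegrable_cst.
rewrite Ex_cst ExZl; last by apply: Rintegrable_sum.
rewrite z mulr0 addr0 /taubar /tau /tau_of ExZl//.
by rewrite mulrA mulfV ?mul1r// gt_eqF.
Qed.

Let bm2_int i : Rintegrable (bm2 i).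
Proof. by have [_ _ h _ _] := feature_quad i KN. Qed.

Let bm2_mean i : Ex (bm2 i) <= 2 * kappa * (p%:R * K1 ^+ 2).
Proof. by have [_ _ _ h _] := feature_quad i KN. Qed.

Let e2E i t : e2 i t = n%:R^-1 ^+ 2 *
  (dot (x i t) (1%:M *m (Qi i t *m x i t)) - m0 i t) ^+ 2.
Proof. by rewrite /e2 /lev mul1mx -mulrBr exprMn. Qed.

Let e2_int i : Rintegrable (e2 i).
Proof.
have [_ _ h _ _] := feature_quad i opbound1.
apply: (eq_Rintegrable (fun t => esym (e2E i t))); exact: RintegrableZl.
Qed.

Let e2_mean i : Ex (e2 i) <= n%:R^-1 ^+ 2 * (2 * kappa * (p%:R * (C / l) ^+ 2)).
Proof.
have [_ _ h1 h2 _] := feature_quad i opbound1.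
rewrite (eq_Ex P (e2E i)) ExZl//; apply: ler_wpM2l; first exact: sqr_ge0.
by rewrite mulr1 in h2.
Qed.

Let tau2_int : Rintegrable (fun t => (tau t - taubar) ^+ 2).
Proof.
have mt : measurable_fun setT tau by exact: measurable_tau_of.
apply: (@Rintegrable_bounded _ _ _ _ _ ((n%:R^-1 * (p%:R * (C / l)) + taubar) ^+ 2)).
  by apply: measurable_funX; apply: measurable_funB.
move=> t; rewrite normrX; apply: lerXn2r; rewrite ?nnegrE//.
  by apply: addr_ge0 (taubar_ge0); apply: le_trans (tau_of_bounded (W t)).
apply: le_trans (ler_normB _ _) _; apply: lerD; first exact: tau_of_bounded.
by rewrite ger0_norm// taubar_ge0.
Qed.

Let fixed_point_raw (theta : R) : 0 < theta ->
  `|n%:R * taubar - \tr (Sig *m Qb)| <=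
  K1 + theta * (2 * kappa * (p%:R * K1 ^+ 2) + (p%:R * K1) ^+ 2) +
   3 / (2 * theta) * (n%:R^-1 ^+ 2 * (2 * kappa * (p%:R * (C / l) ^+ 2)) +
     (n%:R^-1 * (C / l)) ^+ 2 + n%:R * (n%:R^-1 * (2 * (C / l))) ^+ 2).
Proof.
move=> th0; rewrite -Y_mean; apply: le_trans (Ex_abs Y_int) _.
have ii (c : R) : Rintegrable (fun=> c) by exact: Rintegrable_cst.
have i1 i : Rintegrable (fun t => bm2 i t + (p%:R * K1) ^+ 2) by exact: RintegrableD.
have i2 i : Rintegrable (fun t => e2 i t + (n%:R^-1 * (C / l)) ^+ 2) by exact: RintegrableD.
have i3 i : Rintegrable (fun t => e2 i t + (n%:R^-1 * (C / l)) ^+ 2 + (tau t - taubar) ^+ 2).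
  exact: RintegrableD.
have i4 i : Rintegrable (fun t => K1 + theta * (bm2 i t + (p%:R * K1) ^+ 2)).
  by apply: RintegrableD => //; exact: RintegrableZl.
have i5 i : Rintegrable (fun t => 3 / (2 * theta) *
    (e2 i t + (n%:R^-1 * (C / l)) ^+ 2 + (tau t - taubar) ^+ 2)) by exact: RintegrableZl.
have i6 i : Rintegrable (fun t => K1 + theta * (bm2 i t + (p%:R * K1) ^+ 2) +
   3 / (2 * theta) * (e2 i t + (n%:R^-1 * (C / l)) ^+ 2 + (tau t - taubar) ^+ 2)).
  exact: RintegrableD.
apply: le_trans (Ex_le _ _ (fun t => Y_bound t th0)) _.
- exact: Rintegrable_abs.
- by apply: RintegrableZl; exact: Rintegrable_sum.
rewrite ExZl; last exact: Rintegrable_sum.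
rewrite Ex_sum//.
have [tc _] := tau_concentration.
set rhs := (leRHS); apply: (@le_trans _ _ (n%:R^-1 * \sum_(i < n) rhs)); last first.
  by rewrite sumr_const card_ord -[X in _ * X]mulr_natl mulKf// gt_eqF.
apply: ler_wpM2l; first by rewrite invr_ge0 ltW.
apply: ler_sum => i _; rewrite /rhs.
rewrite ExD// ExD//; last exact: RintegrableZl.
rewrite Ex_cst !ExZl// ExD// ExD// ExD// !Ex_cst.
apply: lerD.
  apply: lerD => //; apply: ler_wpM2l; first exact: ltW.
  by apply: lerD => //; exact: bm2_mean.
apply: ler_wpM2l.
  by apply: divr_ge0 => //; apply: mulr_ge0 => //; exact: ltW.
by apply: lerD => //; apply: lerD => //; exact: e2_mean.
Qed.

(** The leverages fluctuate with variance of order [n^-1] while the quadratic forms are of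
    order [n]; [delta] is the Young weight between the two after division by [n].  The
    error vanishes when first [n] tends to infinity and then [delta] to zero. *)
Lemma taubar_fixed_point (delta : R) : 0 < delta ->
  `|taubar - n%:R^-1 * \tr (Sig *m resolvent ((1 + taubar)^-1 *: Sig) l)| <=
  K1 / n%:R + delta * ((2 * kappa * rho + rho ^+ 2) * K1 ^+ 2) +
  3 / (2 * delta) * ((2 * kappa * rho + 5) * (C / l) ^+ 2) / n%:R.
Proof.
move=> d0; rewrite -/Qb.
have n1 : 1 <= n%:R :> R by rewrite ler1n.
have r0 : 0 <= rho.
  by rewrite -(pmulr_lge0 _ nR); apply: le_trans p_rho; rewrite ler0n.
have -> : taubar - n%:R^-1 * \tr (Sig *m Qb) =
    n%:R^-1 * (n%:R * taubar - \tr (Sig *m Qb)).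
  by rewrite mulrBr mulrA mulVf ?mul1r// gt_eqF.
rewrite normrM ger0_norm ?invr_ge0 ?(ltW nR)// mulrC ler_pdivrMr//.
have th0 : 0 < delta / n%:R by rewrite divr_gt0.
have := fixed_point_raw th0; have := K1_ge0; rewrite -!/K1; move: K1 (C / l) => k c k_ge0 raw.
apply: le_trans raw _.
have nR' := nR; have pr := p_rho; have q0 : 0 <= p%:R :> R by rewrite ler0n.
move: n1 nR' pr q0 th0; set N' : R := n%:R; set q : R := p%:R.
move=> n1 N0 pr q0 th0.
rewrite [leRHS]mulrDl [X in _ <= X + _]mulrDl; apply: lerD; first apply: lerD.
- by rewrite divfK// gt_eqF.
- rewrite -!mulrA; apply: ler_wpM2l; first exact: ltW.
  rewrite mulrC ler_pdivrMr//.
  have k2 : 0 <= k ^+ 2 by exact: sqr_ge0.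
  have : kappa * q * k ^+ 2 <= kappa * (rho * N') * (N' * k ^+ 2).
    apply: ler_pM => //; first exact: mulr_ge0.
      by apply: ler_wpM2l.
    by rewrite ler_peMl.
  have : q ^+ 2 * k ^+ 2 <= (rho * N') ^+ 2 * k ^+ 2.
    by apply: ler_wpM2r => //; apply: lerXn2r => //; rewrite nnegrE// mulr_ge0// ltW.
  rewrite exprMn => h1 h2.
  by lra.
- rewrite divfK ?gt_eqF//.
  have -> : 3 / (2 * (delta / N')) = 3 / (2 * delta) * N' by field; rewrite !gt_eqF.
  rewrite -mulrA; apply: ler_wpM2l; first by apply: divr_ge0 => //; apply: mulr_ge0 => //; exact: ltW.
  have c0' : 0 <= c ^+ 2 by exact: sqr_ge0.
  have -> : N' * (N'^-1 ^+ 2 * (2 * kappa * (q * c ^+ 2)) + (N'^-1 * c) ^+ 2 +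
      N' * (N'^-1 * (2 * c)) ^+ 2) = N'^-1 * (2 * kappa * (q * c ^+ 2)) + N'^-1 * c ^+ 2 + 4 * c ^+ 2.
    by field; rewrite !gt_eqF.
  have N1 : N'^-1 <= 1 by rewrite invf_le1.
  have : N'^-1 * (2 * kappa * (q * c ^+ 2)) <= 2 * kappa * rho * c ^+ 2.
    rewrite mulrC ler_pdivrMr//.
    have : kappa * q * c ^+ 2 <= kappa * (rho * N') * c ^+ 2.
      by apply: ler_wpM2r => //; exact: ler_wpM2l.
    lra.
  have : N'^-1 * c ^+ 2 <= c ^+ 2 by rewrite ler_piMl.
  lra.
Qed.

End FixedPoint.

(** * Spectra and operator norms *)

Section Spectrum.
Context {R : realType} {p : nat}.
Implicit Types A : 'M[R]_p.
Local Notation toC := (real_complex R).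

Lemma invmx_right (K : fieldType) (A B : 'M[K]_p) : A *m B = 1%:M -> invmx A = B.
Proof.
move=> AB; have uA : A \in unitmx by case/mulmx1_unit: AB.
by rewrite -[LHS]mulmx1 -AB mulKmx.
Qed.

Lemma char_poly_similar (K : fieldType) (U A : 'M[K]_p) : U \in unitmx ->
  char_poly (invmx U *m A *m U) = char_poly A.
Proof.
move=> uU; rewrite /char_poly.
have -> : char_poly_mx (invmx U *m A *m U) =
    map_mx polyC (invmx U) *m char_poly_mx A *m map_mx polyC U.
  rewrite /char_poly_mx mulmxBr mulmxBl !map_mxM; congr (_ - _).
  by rewrite mul_mx_scalar -scalemxAl -map_mxM mulVmx// map_mx1 scalemx1.
rewrite !det_mulmx mulrAC -det_mulmx -map_mxM mulVmx//.
by rewrite map_mx1 det1 mul1r.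
Qed.

(** A real symmetric matrix is Hermitian, hence unitarily diagonalizable over the complex
    numbers with real eigenvalues; the characteristic polynomial and the trace are then
    computed on the diagonal and brought back to [R]. *)
Lemma symmetric_diagonalization A : A^T = A ->
  exists2 a : 'I_p -> R, char_poly A = \prod_i ('X - (a i)%:P) &
  forall c l, 0 < l -> (forall i, 0 <= a i) -> 0 <= c -> (c *: A + l%:M) \in unitmx ->
    \tr (A *m invmx (c *: A + l%:M)) = \sum_i a i / (c * a i + l).
Proof.
move=> AT; pose B : 'M[R[i]]_p := map_mx toC A.
have Bh : B \is hermsymmx.
  apply: realsym_hermsym.
    by apply/is_hermitianmxP; rewrite expr0 scale1r map_mx_id// map_trmx AT.
  apply/mxOverP => i j; rewrite mxE; apply/complex_realP; by exists (A i j).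
have /hermitian_normalmx/orthomx_spectralP BE := Bh.
have /mxOverP dr := hermitian_spectral_diag_real Bh.
set U := spectralmx B in BE; set D := spectral_diag B in BE dr.
have uU : U \in unitmx by exact: spectral_unit.
pose a i := complex.Re (D 0 i).
have aE i : D 0 i = toC (a i) by rewrite /a RRe_real.
exists a.
  apply: (map_poly_inj (real_complex R)).
  rewrite map_char_poly -/B BE char_poly_similar// char_poly_trig ?diag_mx_is_trig//.
  rewrite rmorph_prod; apply: eq_bigr => i _.
  by rewrite rmorphB /= map_polyX map_polyC /= !mxE eqxx mulr1n aE.
move=> c l l0 a0 c0 uA; apply: (@complexI R).
rewrite -[toC (\tr _)]/(real_complex R _) -trace_map_mx map_mxM map_invmx map_mxD map_mxZ map_scalar_mx /= -/B.
pose E : 'rV[R[i]]_p := \row_i (toC c * D 0 i + toC l)^-1.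
have den i : toC c * D 0 i + toC l != 0.
  rewrite aE -rmorphM -rmorphD /= eq_complex /= eqxx andbT gt_eqF//.
  by rewrite ltr_wpDl// mulr_ge0.
have conjM (X Y : 'M[R[i]]_p) : (invmx U *m X *m U) *m (invmx U *m Y *m U) =
    invmx U *m (X *m Y) *m U by rewrite -!mulmxA mulKVmx.
have -> : invmx (toC c *: B + (toC l)%:M) = invmx U *m diag_mx E *m U.
  apply: invmx_right.
  have -> : toC c *: B + (toC l)%:M = invmx U *m (toC c *: diag_mx D + (toC l)%:M) *m U.
    rewrite mulmxDr mulmxDl mul_mx_scalar -scalemxAl mulVmx// scalemx1.
    by rewrite -scalemxAr -scalemxAl -BE.
  rewrite conjM (_ : (_ + _) *m diag_mx E = 1%:M) ?mulmx1 ?mulVmx//.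
  apply/matrixP => i j; rewrite mul_mx_diag !mxE.
  have [->|ij] := eqVneq i j; first by rewrite !mulr1n mulfV.
  by rewrite !mulr0n mulr0 addr0 mul0r.
rewrite {1}BE conjM mxtrace_mulC mulmxA mulmxV// mul1mx.
rewrite rmorph_sum; apply: eq_bigr => i _.
rewrite mul_mx_diag !mxE eqxx mulr1n aE.
by rewrite -rmorphM -rmorphD /= -fmorphV -rmorphM.
Qed.

Lemma eigenvalue_quad A (a : R) : root (char_poly A) a -> A^T = A ->
  exists2 v : 'cV[R]_p, 0 < dot v v & dot v (A *m v) = a * dot v v.
Proof.
rewrite -eigenvalue_root_char => /eigenvalueP[v va v0] AT; exists v^T.
  rewrite lt_neqAle sqn_ge0 andbT eq_sym; apply: contra v0 => /eqP h.
  by rewrite -(trmxK v) (sqn_eq0 (u := v^T)) ?h// trmx0.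
by rewrite -[A]AT -trmx_mul va linearZ /= dotZr.
Qed.

(** [spectrum A] is some list of roots that splits the characteristic polynomial, so it is
    a permutation of the eigenvalues found by diagonalization. *)
Lemma psd_spectrum A (C : R) : psd A -> (forall u, dot u (A *m u) <= C * dot u u) ->
  [/\ size (spectrum A) = p, forall a, a \in spectrum A -> 0 <= a <= C &
   forall c l, 0 < l -> 0 <= c ->
     \tr (A *m resolvent (c *: A) l) = \sum_(a <- spectrum A) a / (c * a + l)].
Proof.
move=> hA AC; have [AT _] := hA.
have [a chA trA] := symmetric_diagonalization AT.
pose s := [seq a i | i <- enum 'I_p].
have chs : char_poly A = \prod_(x <- s) ('X - x%:P).
  by rewrite big_map big_enum.
have sP : char_poly A = \prod_(x <- spectrum A) ('X - x%:P).
  by rewrite /spectrum; case: xgetP => [_ _ ->//|/(_ s)].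
have ps : perm_eq (spectrum A) s by apply: prod_XsubC_eq; rewrite -sP.
have rt x : x \in spectrum A -> 0 <= x <= C.
  move=> xs; have : root (char_poly A) x by rewrite sP root_prod_XsubC.
  move=> /eigenvalue_quad /(_ AT)[v v0 hv]; apply/andP; split.
    by rewrite -(pmulr_lge0 _ v0) -hv; exact: psd_dot.
  by rewrite -(ler_pM2r v0) -hv.
split=> //.
  by rewrite (perm_size ps) size_map size_enum_ord.
move=> c l l0 c0; rewrite (perm_big _ ps) /= big_map big_enum /= /resolvent.
apply: trA => // [i|].
  have /andP[] // : 0 <= a i <= C by apply: rt; rewrite (perm_mem ps) map_f// mem_enum.
apply: shift_unit => //; split; first by rewrite linearZ /= AT.
by move=> u; rewrite -scalemxAr -scalemxAl mxE mulr_ge0// -mulmxA; exact: psd_dot.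
Qed.

End Spectrum.

Section OperatorNorm.
Context {R : realType} {p : nat} (A : 'M[R]_p).

Lemma norm2E (u : 'cV[R]_p) : norm2 u = Num.sqrt (dot u u).
Proof. by rewrite /norm2 dotE; under eq_bigr do rewrite expr2. Qed.

Lemma norm2_sq (u : 'cV[R]_p) : norm2 u ^+ 2 = dot u u.
Proof. by rewrite norm2E sqr_sqrtr// sqn_ge0. Qed.

(** Ensures that the supremum defining [opnorm A] is that of a bounded set; the constant
    comes from the Frobenius norm. *)
Lemma exists_opbound : exists K, opbound K A.
Proof.
pose F := \sum_i \sum_j A i j ^+ 2.
have F0 : 0 <= F by apply: sumr_ge0 => i _; apply: sumr_ge0 => j _; exact: sqr_ge0.
exists (1 + F); split=> [|u]; first by rewrite addr_ge0.
apply: (@le_trans _ _ (F * dot u u)); last first.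
  apply: ler_wpM2r; first exact: sqn_ge0.
  by nra.
rewrite dotE /F mulr_suml; apply: ler_sum => i _; rewrite mxE -expr2.
have := dot_young (row i A)^T u.
pose r := (row i A)^T.
have ru : \sum_j A i j * u j 0 = dot r u.
  by rewrite dotE; apply: eq_bigr => j _; rewrite !mxE.
have rr : \sum_j A i j ^+ 2 = dot r r.
  by rewrite dotE; apply: eq_bigr => j _; rewrite !mxE expr2.
move=> _; rewrite ru rr.
have [u0|u0] := eqVneq (dot u u) 0.
  have -> : u = 0 by apply: sqn_eq0; rewrite u0.
  by rewrite /dot !mulmx0 mxE expr0n mulr0.
have up : 0 < dot u u by rewrite lt_neqAle eq_sym u0 sqn_ge0.
have := sqn_ge0 (dot u u *: r - dot r u *: u).
rewrite -scaleNr dotDl !dotDr !dotZl !dotZr (dotC u r).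
set x := dot r u; set y := dot u u in up *; set z := dot r r => h.
have : 0 <= y * (z * y - x ^+ 2) by apply: le_trans h _; rewrite le_eqVlt; apply/orP; left; apply/eqP; ring.
by rewrite pmulr_rge0// subr_ge0.
Qed.

Lemma opnorm_sq (u : 'cV[R]_p) (C : R) : opnorm A <= C -> dot (A *m u) (A *m u) <= C ^+ 2 * dot u u.
Proof.
move=> AC; have [K [K0 hK]] := exists_opbound.
have ubK : has_ubound [set norm2 (A *m v) | v in [set v : 'cV[R]_p | norm2 v <= 1]].
  exists K => _ [v /= v1 <-]; rewrite -(@ler_pXn2r _ 2)// ?nnegrE ?sqrtr_ge0//.
  rewrite norm2_sq; apply: le_trans (hK v) _; rewrite -norm2_sq -[leRHS]mulr1.
  apply: ler_wpM2l; first exact: sqr_ge0.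
  by rewrite exprn_ile1// sqrtr_ge0.
have op v : norm2 v <= 1 -> norm2 (A *m v) <= C.
  move=> v1; apply: le_trans AC; apply: ub_le_sup => //; by exists v.
have C0 : 0 <= C.
  have : norm2 (0 : 'cV[R]_p) <= 1 by rewrite norm2E /dot mulmx0 mxE sqrtr0.
  by move/op; apply: le_trans; exact: sqrtr_ge0.
have [u0|u0] := eqVneq (dot u u) 0.
  have -> : u = 0 by apply: sqn_eq0; rewrite u0.
  by rewrite mulmx0 /dot !mulmx0 mxE mulr0.
have up : 0 < dot u u by rewrite lt_neqAle eq_sym u0 sqn_ge0.
have np : 0 < norm2 u by rewrite norm2E sqrtr_gt0.
have : norm2 ((norm2 u)^-1 *: u) <= 1.
  rewrite -(@ler_pXn2r _ 2)// ?nnegrE ?sqrtr_ge0// norm2_sq dotZl dotZr -norm2_sq.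
  by rewrite expr1n mulrA -expr2 -exprMn mulVf ?gt_eqF// expr1n.
move/op; rewrite -(@ler_pXn2r _ 2)// ?nnegrE ?sqrtr_ge0// norm2_sq -scalemxAr dotZl dotZr.
rewrite mulrA -expr2 exprVn norm2_sq => h.
by rewrite -ler_pdivrMr// mulrC.
Qed.

End OperatorNorm.

(** * Weak convergence and averages over spectra *)

Section Support.
Context {R : realType} {d} {T : measurableType d} (P : probability T R).

Lemma Ex_eq_on (E : set T) (f g : T -> R) : measurable E -> P E = 1%E ->
  measurable_fun setT f -> measurable_fun setT g ->
  (forall t, E t -> f t = g t) -> Ex P f = Ex P g.
Proof.
move=> mE PE mf mg fg; congr fine; apply: ae_eq_integral => //.
- exact/measurable_EFinP.
- exact/measurable_EFinP.
have PC : P (~` E) = 0%E by rewrite probability_setC// PE subee.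
exists (~` E); split; [exact: measurableC|exact: PC|].
move=> t /= nfg Et; apply: nfg => _; by rewrite fg.
Qed.

Lemma measurable_on_support (E : set T) (f : T -> R) : measurable E ->
  measurable_fun setT f -> measurable_fun setT (fun t => \1_E t * f t).
Proof. by move=> mE mf; apply: measurable_funM => //; exact: measurable_indic. Qed.

Lemma Ex_on_support (E : set T) (f : T -> R) : measurable E -> P E = 1%E ->
  measurable_fun setT f -> Ex P f = Ex P (fun t => \1_E t * f t).
Proof.
move=> mE PE mf; apply: (Ex_eq_on mE) => //; first exact: measurable_on_support.
by move=> t Et; rewrite indicE mem_set// mul1r.
Qed.

Lemma probability_setI1 (E E' : set T) : measurable E -> measurable E' ->
  P E = 1%E -> P E' = 1%E -> P (E `&` E') = 1%E.
Proof.
move=> mE mE' PE PE'.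
have PC : P (~` E) = 0%E by rewrite probability_setC// PE subee.
have PC' : P (~` E') = 0%E by rewrite probability_setC// PE' subee.
have PU : P (~` E `|` ~` E') = 0%E.
  by apply: (etrans (measureU0 _ _ PC') PC); exact: measurableC.
have mEE : measurable (E `&` E') by exact: measurableI.
rewrite -[E `&` E']setCK probability_setC ?setCI; last first.
  by apply: measurableU; exact: measurableC.
have -> : P (~` E `|` ~` E') = 0%E := PU.
by rewrite sube0.
Qed.

End Support.

Lemma measurable_ge0_set {R : realType} : @measurable _ (measurableTypeR R) [set t : R | 0 <= t].
Proof.
rewrite (_ : [set t | _] = `[0, +oo[%classic); first exact: measurable_itv.
by apply/seteqP; split=> t /=; rewrite in_itv /= andbT.
Qed.
Lemma cvg_bigsum {R : realType} (I : Type) (r : seq I) (u : I -> nat -> R) (l : I -> R) :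
  (forall i, u i n @[n --> \oo] --> l i) ->
  \sum_(i <- r) u i n @[n --> \oo] --> \sum_(i <- r) l i.
Proof.
move=> ul; elim: r => [|i r IH].
  by rewrite big_nil; apply: cvg_near_cst; apply: nearW => n; rewrite big_nil.
rewrite big_cons; under eq_fun do rewrite big_cons.
exact: cvgD.
Qed.

Section HellyBray.
Context {R : realType} (H : probability (measurableTypeR R) R).
Local Notation F := (cdf_of H).

Lemma measurable_le_set (x : R) : measurable [set t : R | t <= x].
Proof.
rewrite (_ : [set t | _] = `]-oo, x]%classic); first exact: measurable_itv.
by apply/seteqP; split=> t /=; rewrite in_itv.
Qed.

Lemma cdf_of_nondecreasing (x y : R) : x <= y -> F x <= F y.
Proof.
move=> xy; rewrite /cdf_of fine_le ?fin_num_measure//; try exact: measurable_le_set.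
by apply: le_measure; rewrite ?inE; [exact: measurable_le_set..|move=> t /= /le_trans; apply].
Qed.

Lemma cdf_of_sub (x y : R) : x <= y -> F y - F x = fine (H `]x, y]%classic).
Proof.
move=> xy; rewrite /cdf_of.
have mx := measurable_le_set x; have my := measurable_le_set y.
rewrite (_ : [set t : R | t <= y] = [set t : R | t <= x] `|` `]x, y]%classic); last first.
  apply/seteqP; split=> t /=; rewrite in_itv /=.
    by move=> ty; case: (lerP t x) => tx; [left|right].
  by move=> [tx|/andP[]//]; exact: le_trans xy.
rewrite measureU//; last first.
  by apply/seteqP; split=> t //= []; rewrite in_itv /= leNgt => /negP ? /andP[].
by rewrite fineD ?fin_num_measure// addrC addKr.
Qed.

(** The increment of the distribution function across [x] is at most the measure of
    small intervals around [x], which decreases to the measure of [[set x]]. *)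
Lemma nonatom_continuous (x : R) : H [set x] = 0%E -> {for x, continuous F}.
Proof.
move=> Hx; pose I n := `]x - n.+1%:R^-1, x + n.+1%:R^-1]%classic : set R.
have cI : H (I n) @[n --> \oo] --> 0%E.
  rewrite -Hx (_ : [set x] = \bigcap_n I n); last first.
    apply/seteqP; split=> [t -> n _|t It] /=.
      suff : x - n.+1%:R^-1 < x <= x + n.+1%:R^-1 by [].
      by rewrite ltrBlDr ltrDl invr_gt0 ltr0n lerDl invr_ge0 ler0n.
    apply/eqP; rewrite eq_le; apply/andP; split; apply/ler_addgt0Pr => e e0.
      have [n ne] := ltr_add_invr e0; rewrite add0r in ne.
      have /andP[_ h] : x - n.+1%:R^-1 < t <= x + n.+1%:R^-1 by have := It n Logic.I.
      by rewrite (le_trans h)// lerD2l ltW.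
    have [n ne] := ltr_add_invr e0; rewrite add0r in ne.
    have /andP[h _] : x - n.+1%:R^-1 < t <= x + n.+1%:R^-1 by have := It n Logic.I.
    by rewrite -lerBlDr (le_trans _ (ltW h))// lerD2l lerN2 ltW.
  apply: nonincreasing_cvg_mu => //=.
  - by apply: le_lt_trans (probability_le1 H _) (ltry _); exact: measurable_itv.
  - by move=> i; exact: measurable_itv.
  - by apply: bigcapT_measurable => i; exact: measurable_itv.
  - move=> m n mn; apply/subsetPset => t It.
    have /andP[h1 h2] : x - n.+1%:R^-1 < t <= x + n.+1%:R^-1 by exact: It.
    suff : x - m.+1%:R^-1 < t <= x + m.+1%:R^-1 by [].
    have : n.+1%:R^-1 <= m.+1%:R^-1 :> R by rewrite lef_pV2 ?posrE// ler_nat.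
    by move: h1 h2; move: (n.+1%:R^-1 : R) (m.+1%:R^-1 : R) => u v h1 h2 h; apply/andP; split; lra.
apply/cvgrPdist_le => e e0.
have /cvgrPdist_le/(_ _ e0) : fine (H (I n)) @[n --> \oo] --> (0 : R).
  by apply: fine_cvg; exact: cI.
move=> [N _ /(_ N (leqnn N))] /=; rewrite sub0r normrN.
have iN : 0 < N.+1%:R^-1 :> R by rewrite invr_gt0.
rewrite /I; move: (N.+1%:R^-1 : R) iN => w w0.
have ww : x - w <= x + w by lra.
rewrite -(cdf_of_sub ww) => FN.
near=> y.
have : `|x - y| < w.
  by near: y; apply/nbhs_ballP; exists w.
rewrite ltr_norml => /andP[y1 y2].
have h1 : x <= x + w by lra.
have h2 : x - w <= x by lra.
have h3 : y <= x + w by lra.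
have h4 : x - w <= y by lra.
have := cdf_of_nondecreasing h1; have := cdf_of_nondecreasing h2.
have := cdf_of_nondecreasing h3; have := cdf_of_nondecreasing h4.
have := ler_norm (F (x + w) - F (x - w)).
by move=> H1 H2 H3 H4 H5; rewrite ler_norml; apply/andP; split; lra.
Unshelve. all: by end_near. Qed.

(** A random variable of law [H], whose atoms are known to be countable. *)
Let idR : measurableTypeR R -> R := idfun.

#[local] HB.instance Definition _ :=
  @isMeasurableFun.Build _ _ _ _ idR (@measurable_id _ _ setT).

Lemma countable_atoms : countable [set x : R | H [set x] != 0%E].
Proof.
pose X := idR : {RV H >-> R}.
apply: sub_countable (pmf_gt0_countable X); apply: subset_card_le => x /= Hx.
rewrite /pmf lt_neqAle eq_sym; apply/andP; split; last first.
  by rewrite fine_ge0.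
by rewrite fine_eq0 ?fin_num_measure.
Qed.

(** The offsets that put some grid point on an atom are countable, whereas the interval of
    offsets has positive length. *)
Lemma exists_nonatomic_grid (eta : R) : 0 < eta ->
  exists2 delta, 0 < delta < eta &
    forall k : nat, H [set delta - eta + k%:R * eta] = 0%E.
Proof.
move=> eta0; apply: contrapT => no.
pose D (k : nat) := (fun y => y + eta - k%:R * eta) @` [set x : R | H [set x] != 0%E].
have cD : countable (\bigcup_k D k).
  apply: bigcup_countable => // k _.
  exact: sub_countable (card_image_le _ _) countable_atoms.
have sub : `]0, eta[%classic `<=` \bigcup_k D k.
  move=> x x0; apply: contrapT => xD; apply: no; exists x; first exact: x0.
  move=> k; apply/eqP; apply: contrapT => /negP Hk; apply: xD; exists k => //.
  by exists (x - eta + k%:R * eta) => //; ring.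
have := countable_lebesgue_measure0 (sub_countable (subset_card_le sub) cD).
rewrite lebesgue_measure_itv /= lte_fin eta0 oppr0 adde0 => -[] /eqP.
by rewrite gt_eqF.
Qed.

Let le_indicatorE (x t : R) : \1_[set t : R | t <= x] t = (t <= x)%R%:R :> R.
Proof. by rewrite indicE; congr (_%:R); congr nat_of_bool; apply/idP/idP; rewrite inE. Qed.

Lemma measurable_le_indicator (x : R) :
  measurable_fun [set: measurableTypeR R] (fun t : R => (t <= x)%R%:R : R).
Proof.
rewrite -(funext (le_indicatorE x)).
by apply: measurable_indic; exact: measurable_le_set.
Qed.

Lemma le_indicator_int (x : R) : Rintegrable H (fun t : R => (t <= x)%R%:R : R).
Proof.
apply: (@Rintegrable_bounded _ _ _ _ _ 1); first exact: measurable_le_indicator.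
by move=> t; rewrite ger0_norm ?ler0n// lern1 leq_b1.
Qed.

Lemma Ex_le_indicator (x : R) : Ex H (fun t : R => (t <= x)%R%:R : R) = F x.
Proof.
rewrite -(eq_Ex H (le_indicatorE x)) /Ex /Rintegral integral_indic//; last exact: measurable_le_set.
by rewrite setIT.
Qed.

Section Step.
Variables (x : nat -> R) (phi : R -> R) (m : nat).

(** The step function with value [phi (x k.+1)] between [x k] and [x k.+1], written with
    indicators of half-lines so that its averages are combinations of values of
    distribution functions. *)
Definition step_fun (t : R) : R :=
  \sum_(k < m) phi (x k.+1) * ((t <= x k.+1)%R%:R - (t <= x k)%R%:R).

Lemma step_funE (t : R) : {homo x : i j / (i <= j)%N >-> i <= j} ->
  x 0 < t -> t <= x m -> exists2 j, x j < t <= x j.+1 & step_fun t = phi (x j.+1).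
Proof.
move=> ndx x0t txm; have ex : exists k, t <= x k by exists m.
case: (ex_minnP ex) => -[|j] tj jmin; first by move: x0t; rewrite ltNge tj.
have xjt : x j < t by rewrite ltNge; apply/negP => /jmin; rewrite ltnn.
have jm : (j < m)%N by exact: jmin.
exists j; first by rewrite xjt.
rewrite /step_fun (bigD1 (Ordinal jm))//= tj (lt_geF xjt) subr0 mulr1 big1 ?addr0// => i.
rewrite -val_eqE /= neq_ltn => /orP[ij|ji].
  have h : x i.+1 < t by apply: le_lt_trans xjt; exact: ndx.
  have h' : x i < t by apply: le_lt_trans xjt; apply: ndx; exact: ltnW.
  by rewrite (lt_geF h) (lt_geF h') subrr mulr0.
have h : t <= x i by apply: le_trans tj _; exact: ndx.
have h' : t <= x i.+1 by apply: le_trans tj _; apply: ndx; exact: ltnW.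
by rewrite h h' subrr mulr0.
Qed.

Lemma measurable_step_fun : measurable_fun [set: measurableTypeR R] step_fun.
Proof.
apply: measurable_sum => k; apply: measurable_funM; first exact: measurable_cst.
by apply: measurable_funB; exact: measurable_le_indicator.
Qed.

Lemma Ex_step_fun : Ex H step_fun = \sum_(k < m) phi (x k.+1) * (F (x k.+1) - F (x k)).
Proof.
have ii (k : 'I_m) : Rintegrable H (fun t : R => (t <= x k.+1)%R%:R - (t <= x k)%R%:R).
  by apply: RintegrableB; exact: le_indicator_int.
rewrite Ex_sum => [|k]; last exact: RintegrableZl.
apply: eq_bigr => k _; rewrite ExZl// ExB; try exact: le_indicator_int.
by rewrite !Ex_le_indicator.
Qed.

Lemma sum_step_fun (s : seq R) : \sum_(a <- s) step_fun a =
  \sum_(k < m) phi (x k.+1) * ((count (fun a => a <= x k.+1) s)%:R - (count (fun a => a <= x k) s)%:R).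
Proof.
rewrite exchange_big /=; apply: eq_bigr => k _; rewrite -mulr_sumr sumrB.
have e y : \sum_(a <- s) ((a <= y)%R%:R : R) = (count (fun a => a <= y) s)%:R.
  by rewrite -sum1_count natr_sum [RHS]big_mkcond; apply: eq_bigr => a _; case: ifP.
by rewrite !e.
Qed.

End Step.

(** On a grid of continuity points, weak convergence gives the averages of step functions;
    a Lipschitz function is uniformly close to such a step function on the bounded
    interval that carries all the measures. *)
Lemma helly_bray (s : nat -> seq R) (C L : R) (phi : R -> R) :
  (forall x : R, {for x, continuous F} ->
     (count (fun a => a <= x) (s n))%:R / (size (s n))%:R @[n --> \oo] --> F x) ->
  (forall n a, a \in s n -> 0 <= a <= C) ->
  (\forall n \near \oo, (0 < size (s n))%N) ->
  H [set t | 0 <= t] = 1%E -> 0 < L -> measurable_fun [set: measurableTypeR R] phi ->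
  (forall x y : R, 0 <= x -> 0 <= y -> `|phi x - phi y| <= L * `|x - y|) ->
  (\sum_(a <- s n) phi a) / (size (s n))%:R @[n --> \oo] --> Ex H phi.
Proof.
move=> sF sC s0 H0 L0 mphi phiL; apply/cvgrPdist_le => e e0.
(* The mesh makes the step function [e / 3]-close to [phi]. *)
pose eta := e / (3 * L); have eta0 : 0 < eta by rewrite divr_gt0// mulr_gt0.
have [delta /andP[d0 d1] grid] := exists_nonatomic_grid eta0.
pose x (k : nat) := delta - eta + k%:R * eta.
have xc k : {for x k, continuous F} by apply: nonatom_continuous; exact: grid.
have ndx : {homo x : i j / (i <= j)%N >-> i <= j}.
  by move=> i j ij; rewrite /x lerD2l ler_pM2r// ler_nat.
have x0 : x 0 < 0 by rewrite /x mul0r addr0 subr_lt0.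
have xS k : x k.+1 - x k = eta by rewrite /x -natr1; ring.
have x1 k : 0 <= x k.+1 by rewrite /x -natr1 mulrDl mul1r; have : 0 <= k%:R * eta; [rewrite mulr_ge0// ltW|lra].
have [m Cm] : exists m, C < x m.
  pose b := (C + eta) / eta.
  exists (Num.bound `|b|); rewrite /x.
  have := le_lt_trans (ler_norm b) (archi_boundP (normr_ge0 b)).
  by rewrite ltr_pdivrMr//; lra.
pose psi := step_fun x phi m.
have phipsi t : 0 <= t -> t <= x m -> `|phi t - psi t| <= L * eta.
  move=> t0 tm; have [j /andP[jt tj] e1] := step_funE phi ndx (lt_le_trans x0 t0) tm.
  rewrite /psi e1.
  apply: le_trans (phiL _ _ t0 (x1 j)) _; rewrite ler_pM2l//.
  by rewrite ler0_norm ?subr_le0// opprB -(xS j) lerD2l lerN2 ltW.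
have Fm : F (x m) = 1.
  apply: (cvg_unique _ (sF _ (xc m))) => //.
  apply: cvg_near_cst; near=> n.
  have /eqP -> : count (fun a => a <= x m) (s n) == size (s n).
    by rewrite -all_count; apply/allP => a /sC /andP[_ aC]; exact: le_trans aC (ltW Cm).
  by rewrite divff// pnatr_eq0 -lt0n; near: n.
pose E : set R := [set t | 0 <= t] `&` [set t | t <= x m].
have mge0 := @measurable_ge0_set R.
have mE : @measurable _ (measurableTypeR R) E by apply: measurableI => //; exact: measurable_le_set.
have HE : H E = 1%E.
  have Hm : H [set t | t <= x m] = 1%E.
    by rewrite -Fm /cdf_of fineK// fin_num_measure//; exact: measurable_le_set.
  exact: (@probability_setI1 _ _ (measurableTypeR R) H _ _ mge0 (measurable_le_set (x m)) H0 Hm).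
have mpsi := measurable_step_fun x phi m; rewrite -/psi in mpsi.
have psiL : `|Ex H phi - Ex H psi| <= L * eta.
  rewrite (Ex_on_support mE HE mphi) (Ex_on_support mE HE mpsi).
  have E1 t : E t -> \1_E t = 1 :> R by move=> Et; rewrite indicE mem_set.
  have E0 t : ~ E t -> \1_E t = 0 :> R by move=> Et; rewrite indicE memNset.
  have phi_int : Rintegrable H (fun t : R => \1_E t * phi t).
    apply: (@Rintegrable_bounded _ _ _ _ _ (`|phi 0| + L * `|x m|)).
      exact: measurable_on_support.
    move=> t; case: (pselect (E t)) => Et; last first.
      by rewrite E0// mul0r normr0 addr_ge0// mulr_ge0// ltW.
    rewrite E1// mul1r; case: Et => t0 tm.
    rewrite -[phi t](subrK (phi 0)) addrC; apply: le_trans (ler_normD _ _) _.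
    rewrite lerD2l; apply: le_trans (phiL _ _ t0 (lexx _)) _.
    by rewrite ler_pM2l// subr0 !ger0_norm// (le_trans t0).
  have psi_int : Rintegrable H (fun t : R => \1_E t * psi t).
    apply: (@Rintegrable_le _ _ (measurableTypeR R) H _ (fun t : R => `|\1_E t * phi t| + L * eta)).
    - exact: measurable_on_support.
    - move=> t; case: (pselect (E t)) => Et; last first.
        by rewrite E0// !mul0r normr0 add0r mulr_ge0// ltW.
      rewrite E1// !mul1r; case: Et => t0 tm.
      have := phipsi t t0 tm; rewrite distrC => h.
      rewrite -[psi t](subrK (phi t)) addrC; apply: le_trans (ler_normD _ _) _.
      by rewrite lerD2l.
    - by apply: RintegrableD; [exact: Rintegrable_abs|exact: Rintegrable_cst].
  rewrite -ExB//; apply: Ex_bounded; first exact: RintegrableB.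
  move=> t; case: (pselect (E t)) => Et; last first.
    by rewrite E0// !mul0r subr0 normr0 mulr_ge0// ltW.
  by rewrite E1// !mul1r; case: Et => t0 tm; exact: phipsi.
have avg_psi : (\sum_(a <- s n) psi a) / (size (s n))%:R @[n --> \oo] --> Ex H psi.
  rewrite Ex_step_fun.
  rewrite (_ : (fun n => _) = (fun n => \sum_(k < m) phi (x k.+1) *
     ((count (fun a => a <= x k.+1) (s n))%:R / (size (s n))%:R -
      (count (fun a => a <= x k) (s n))%:R / (size (s n))%:R))); last first.
    apply/funext => n; rewrite sum_step_fun mulr_suml; apply: eq_bigr => k _.
    by rewrite -mulrA -mulrBl.
  apply: cvg_bigsum => k; apply: cvgM; first exact: cvg_cst.
  by apply: cvgB; exact: sF.
have e3 : 0 < e / 3 by rewrite divr_gt0.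
have Le : L * eta = e / 3 by rewrite /eta; field; rewrite gt_eqF.
move/cvgrPdist_le: avg_psi => /(_ _ e3) avg_psi.
near=> n.
have sn : (0 < size (s n))%N by near: n.
have avgs : `|(\sum_(a <- s n) psi a) / (size (s n))%:R - (\sum_(a <- s n) phi a) / (size (s n))%:R|
    <= L * eta.
  have sR : 0 < (size (s n))%:R :> R by rewrite ltr0n.
  rewrite -mulrBl -sumrB normrM [X in _ * X]ger0_norm ?invr_ge0 ?(ltW sR)// ler_pdivrMr//.
  apply: le_trans (ler_norm_sum _ _ _) _.
  rewrite big_seq; apply: (@le_trans _ _ (\sum_(a <- s n | a \in s n) (L * eta))).
    apply: ler_sum => a /sC /andP[a0 aC]; rewrite distrC; apply: phipsi => //.
    exact: le_trans aC (ltW Cm).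
  by rewrite -big_seq big_const_seq count_predT iter_addr_0 mulr_natr.
have hn : `|Ex H psi - (\sum_(a <- s n) psi a) / (size (s n))%:R| <= e / 3 by near: n.
move: psiL avgs hn; rewrite Le.
set u := Ex H phi; set v := Ex H psi; set w := (\sum_(a <- s n) psi a) / _; set z := (\sum_(a <- s n) phi a) / _.
move=> h1 h2 h3.
have -> : u - z = (u - v) + (v - w) + (w - z) by ring.
apply: le_trans (ler_normD _ _) _; have := ler_normD (u - v) (v - w).
lra.
Unshelve. all: by end_near. Qed.

End HellyBray.

(** * Stieltjes transforms on the negative half-line *)

Section OnSupport.
Context {R : realType} {d} {T : measurableType d} (P : probability T R).
Variables (E : set T) (mE : measurable E) (PE : P E = 1%E).

Lemma Rintegrable_on (f : T -> R) K : measurable_fun setT f ->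
  (forall t, E t -> `|f t| <= K) -> Rintegrable P f.
Proof.
move=> mf fK; apply/integrableP; split; first exact/measurable_EFinP.
have PC : P (~` E) = 0%E by rewrite probability_setC// PE subee.
have m1 : measurable_fun setT (fun t => \1_E t * f t) by exact: measurable_on_support.
rewrite (ae_eq_integral (fun t => `|(\1_E t * f t)%:E|%E))//.
- have : Rintegrable P (fun t => \1_E t * f t).
    apply: (@Rintegrable_bounded _ _ _ _ _ `|K|) => // t.
    case: (pselect (E t)) => Et; last by rewrite indicE memNset// mul0r normr0.
    by rewrite indicE mem_set// mul1r (le_trans (fK _ Et))// ler_norm.
  by move=> /integrableP[].
- by apply: measurableT_comp => //; exact/measurable_EFinP.
- by apply: measurableT_comp => //; exact/measurable_EFinP.
exists (~` E); split; [exact: measurableC|exact: PC|].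
by move=> t /= nfg Et; apply: nfg => _; rewrite indicE mem_set// mul1r.
Qed.

Lemma Ex_bounded_on (f : T -> R) K : measurable_fun setT f ->
  (forall t, E t -> `|f t| <= K) -> 0 <= K -> `|Ex P f| <= K.
Proof.
move=> mf fK K0; rewrite (Ex_on_support mE PE mf); apply: Ex_bounded.
  apply: (Rintegrable_on (K := K)); first exact: measurable_on_support.
  by move=> t Et; rewrite indicE mem_set// mul1r fK.
move=> t; case: (pselect (E t)) => Et; last by rewrite indicE memNset// mul0r normr0.
by rewrite indicE mem_set// mul1r fK.
Qed.

Lemma Ex_le_on (f g : T -> R) : measurable_fun setT f -> measurable_fun setT g ->
  Rintegrable P f -> Rintegrable P g -> (forall t, E t -> f t <= g t) -> Ex P f <= Ex P g.
Proof.
move=> mf mg fi gi fg; rewrite (Ex_on_support mE PE mf) (Ex_on_support mE PE mg).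
have h u : measurable_fun setT u -> Rintegrable P u -> Rintegrable P (fun t => \1_E t * u t).
  move=> mu ui; apply: (Rintegrable_le _ _ (Rintegrable_abs ui)).
    exact: measurable_on_support.
  move=> t; rewrite indicE; case: (_ \in _); first by rewrite mul1r.
  by rewrite mul0r normr0.
apply: Ex_le; [exact: h|exact: h|move=> t].
case: (pselect (E t)) => Et; last by rewrite indicE memNset// !mul0r.
by rewrite indicE mem_set// !mul1r fg.
Qed.

End OnSupport.

Section RealStieltjes.
Context {R : realType} (F : probability (measurableTypeR R) R).
Hypothesis F0 : F [set t | 0 <= t] = 1%E.
Let E : set (measurableTypeR R) := [set t : R | 0 <= t].

Let mE : measurable E.
Proof. exact: measurable_ge0_set. Qed.

Lemma measurable_affine_inv (l : R) :
  measurable_fun [set: measurableTypeR R] (fun t : R => (t + l)^-1).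
Proof.
apply: (measurableT_comp measurable_inv); apply: measurable_funD => //.
Qed.

Definition resolvent_mean (l : R) := Ex F (fun t : R => (t + l)^-1).
Definition resolvent_mean2 (l : R) := Ex F (fun t : R => (t + l)^-1 ^+ 2).

Lemma affine_inv_bound (l t : R) : 0 < l -> 0 <= t -> 0 < (t + l)^-1 <= l^-1.
Proof.
move=> l0 t0; have tl : 0 < t + l by rewrite ltr_wpDl.
by rewrite invr_gt0 tl /= lef_pV2// lerDr.
Qed.

Lemma affine_inv_int l : 0 < l -> Rintegrable F (fun t : R => (t + l)^-1).
Proof.
move=> l0; apply: (Rintegrable_on mE F0 (K := l^-1)); first exact: measurable_affine_inv.
move=> t t0; have /andP[h1 h2] := affine_inv_bound l0 t0.
by rewrite gtr0_norm.
Qed.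

Lemma resolvent_mean_diff l l' : 0 < l -> 0 < l' ->
  `|resolvent_mean l - resolvent_mean l'| <= `|l - l'| / (l * l').
Proof.
move=> l0 l0'; rewrite -ExB; try exact: affine_inv_int.
apply: (Ex_bounded_on mE F0).
- by apply: measurable_funB; exact: measurable_affine_inv.
- move=> t t0.
  have tl : 0 < t + l by rewrite ltr_wpDl.
  have tl' : 0 < t + l' by rewrite ltr_wpDl.
  have -> : (t + l)^-1 - (t + l')^-1 = (l' - l) * ((t + l)^-1 * (t + l')^-1).
    by field; rewrite !gt_eqF.
  rewrite normrM distrC; apply: ler_wpM2l => //.
  have /andP[h1 h2] := affine_inv_bound l0 t0.
  have /andP[h1' h2'] := affine_inv_bound l0' t0.
  by rewrite ger0_norm ?mulr_ge0 ?(ltW h1) ?(ltW h1')// invfM ler_pM// ltW.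
by rewrite divr_ge0// mulr_ge0// ltW.
Qed.

(** [F] carries mass at least [1 - e / 2] on a bounded interval, where [L / (t + L)] is
    close to one for large [L]. *)
Lemma resolvent_mean_large (e : R) : 0 < e ->
  exists2 L0 : R, 0 < L0 & forall L, L0 <= L -> 1 - L * resolvent_mean L <= e.
Proof.
move=> e0.
have [k Hk] : exists k : nat, 1 - e / 2 < cdf_of F k%:R.
  have cF : F [set t : R | t <= k%:R] @[k --> \oo] --> F (\bigcup_k [set t : R | t <= k%:R]).
    apply: nondecreasing_cvg_mu.
    - by move=> k; exact: measurable_le_set.
    - by apply: bigcup_measurable => k _; exact: measurable_le_set.
    - by move=> i j ij; apply/subsetPset => t /= /le_trans; apply; rewrite ler_nat.
  have FT : F (\bigcup_k [set t : R | t <= k%:R]) = 1%E.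
    rewrite (_ : \bigcup_k _ = setT) ?probability_setT//.
    apply/seteqP; split=> // t _; exists (Num.bound `|t|) => //=.
    by apply: ltW; apply: le_lt_trans (ler_norm t) (archi_boundP (normr_ge0 t)).
  have c1 : cdf_of F k%:R @[k --> \oo] --> (1 : R).
    by apply: fine_cvg; rewrite -FT; exact: cF.
  have e2 : 0 < e / 2 by rewrite divr_gt0.
  have /cvgrPdist_lt/(_ _ e2)[N _ /(_ N (leqnn N))] := c1.
  by rewrite /= ltr_norml => /andP[_ h]; exists N; lra.
pose K : R := k%:R; have K0 : 0 <= K by rewrite ler0n.
exists (2 * K / e + 1) => [|L LL].
  by rewrite ltr_wpDl// divr_ge0// ?mulr_ge0// ltW.
have KL : 2 * K / e <= L by lra.
have L0 : 0 < L by apply: lt_le_trans LL; rewrite ltr_wpDl// divr_ge0// ?mulr_ge0// ltW.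
have KL2 : K / (K + L) <= e / 2.
  rewrite ler_pdivrMr ?ltr_wpDl//.
  have : 2 * K <= L * e by rewrite -ler_pdivrMr.
  have : 0 <= e * K by rewrite mulr_ge0// ltW.
  by lra.
rewrite -[1](Ex_cst F) /resolvent_mean -ExZl; last exact: affine_inv_int.
rewrite -ExB; [|exact: Rintegrable_cst|by apply: RintegrableZl; exact: affine_inv_int].
apply: (@le_trans _ _ (Ex F (fun t : R => (1 - (t <= K)%R%:R) + K / (K + L)))).
  have ind := le_indicator_int F K.
  apply: (Ex_le_on mE F0).
  - apply: measurable_funB; first exact: measurable_cst.
    by apply: measurable_funM; [exact: measurable_cst|exact: measurable_affine_inv].
  - apply: measurable_funD; last exact: measurable_cst.
    by apply: measurable_funB; [exact: measurable_cst|exact: measurable_le_indicator].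
  - by apply: RintegrableB; [exact: Rintegrable_cst|apply: RintegrableZl; exact: affine_inv_int].
  - apply: RintegrableD; last exact: Rintegrable_cst.
    by apply: RintegrableB => //; exact: Rintegrable_cst.
  - move=> t t0.
    have tL : 0 < t + L by rewrite ltr_wpDl.
    have -> : 1 - L * (t + L)^-1 = t / (t + L) by field; rewrite gt_eqF.
    have kl : 0 < K + L by rewrite ltr_wpDl.
    case: (lerP t K) => tK /=.
      rewrite subrr add0r ler_pdivrMr// mulrAC ler_pdivlMr//.
      have : t * L <= K * L by rewrite ler_wpM2r// ltW.
      by lra.
    rewrite subr0; apply: (@le_trans _ _ 1).
      by rewrite ler_pdivrMr// mul1r lerDl ltW.
    by rewrite lerDl divr_ge0// ltW.
have ind := le_indicator_int F K.
have i1 : Rintegrable F (fun t : R => 1 - (t <= K)%R%:R).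
  by apply: RintegrableB => //; exact: Rintegrable_cst.
rewrite ExD//; last exact: Rintegrable_cst.
rewrite ExB//; last exact: Rintegrable_cst.
rewrite !Ex_cst Ex_le_indicator -/K; move: Hk; rewrite -/K; lra.
Qed.

Variable gamma : R.
Hypothesis gamma0 : 0 < gamma.
(** The companion transform at [- l], which is real. *)
Definition companion_real (l : R) : R := gamma * (resolvent_mean l - l^-1) + l^-1.

(** The transform is positive for large [l] and continuous, so without zeros it cannot
    change sign. *)
Lemma companion_real_pos (l : R) : (forall l, 0 < l -> companion_real l != 0) ->
  0 < l -> 0 < companion_real l.
Proof.
move=> vn0 l0; rewrite ltNge; apply/negP => vl.
have {}vl : companion_real l < 0 by rewrite lt_neqAle vn0.
have e0 : 0 < (2 * gamma)^-1 by rewrite invr_gt0 mulr_gt0.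
have [L0 L00 HL] := resolvent_mean_large e0.
pose L := Num.max l L0.
have lL : l <= L by rewrite le_max lexx.
have Lp : 0 < L by apply: lt_le_trans lL.
have vL : 0 < companion_real L.
  have LL : L0 <= L by rewrite le_max lexx orbT.
  have := HL L LL; rewrite /companion_real => h.
  have : gamma * (1 - L * resolvent_mean L) <= 2^-1.
    apply: le_trans (ler_wpM2l (ltW gamma0) h) _.
    by rewrite le_eqVlt; apply/orP; left; apply/eqP; field; rewrite gt_eqF.
  move=> h2; rewrite -(pmulr_rgt0 _ Lp).
  have -> : L * (gamma * (resolvent_mean L - L^-1) + L^-1) =
    1 - gamma * (1 - L * resolvent_mean L) by field; rewrite gt_eqF.
  by lra.
have cont : {within `[l, L], continuous companion_real}.
  apply: continuous_in_subspaceT => x; rewrite inE /= in_itv /= => /andP[lx _].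
  have x0 : 0 < x by exact: lt_le_trans lx.
  have ci : (y : R)^-1 @[y --> x] --> x^-1 by apply: inv_continuous; rewrite gt_eqF.
  have cm : resolvent_mean y @[y --> x] --> resolvent_mean x.
    apply/cvgrPdist_le => e e_gt0; near=> y.
    have y0 : x / 2 < y.
      near: y; apply: lt_nbhsr; rewrite ltr_pdivrMr//; lra.
    have yp : 0 < y by apply: lt_trans y0; rewrite divr_gt0.
    apply: le_trans (resolvent_mean_diff x0 yp) _.
    have dxy : `|x - y| <= e * (x * (x / 2)).
      near: y; apply: cvgr_dist_le; first exact: cvg_id.
      by rewrite !mulr_gt0// divr_gt0.
    rewrite ler_pdivrMr ?mulr_gt0//; apply: le_trans dxy _.
    by rewrite ler_wpM2l ?(ltW e_gt0)// ler_wpM2l ?(ltW x0)// ltW.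
  apply: cvgD => //; apply: cvgM; first exact: cvg_cst.
  exact: cvgB.
have [|c] := IVT lL cont (v := 0).
  by rewrite ge_min le_max (ltW vl) (ltW vL) orbT.
rewrite in_itv /= => /andP[lc _] /eqP.
by apply/negP; apply: vn0; exact: lt_le_trans lc.
Unshelve. all: by end_near. Qed.

End RealStieltjes.

(** * The companion transform and its derivative *)

Section ComplexStieltjes.
Import Normc.
Local Open Scope complex_scope.
Context {R : realType}.
Implicit Types (H F : probability (measurableTypeR R) R) (z h : R[i]).

Lemma Re_inv z : complex.Re z^-1 = complex.Re z / (complex.Re z ^+ 2 + complex.Im z ^+ 2).
Proof. by case: z. Qed.

Lemma Im_inv z : complex.Im z^-1 = - (complex.Im z / (complex.Re z ^+ 2 + complex.Im z ^+ 2)).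
Proof. by case: z. Qed.

Lemma real_complex_inv (x : R) : (x%:C)^-1 = (x^-1)%:C.
Proof. by rewrite -[_%:C]/(real_complex R x) -fmorphV. Qed.

Lemma stieltjes_real F (l : R) : stieltjes F (- l)%:C = (resolvent_mean F l)%:C.
Proof.
have e t : (t%:C - (- l)%:C)^-1 = ((t + l)^-1)%:C :> R[i].
  by rewrite -real_complex_inv rmorphN opprK -rmorphD.
rewrite -[RHS]complexr0 /stieltjes /cintegral; congr (_ +i* _).
  by apply: eq_Rintegral => t _; rewrite e.
by rewrite -[RHS](Ex_cst F); apply: eq_Rintegral => t _; rewrite e.
Qed.

Lemma companion_at_real (gamma : R) F (l : R) :
  companion gamma F (- l)%:C = (companion_real F gamma l)%:C.
Proof.
rewrite /companion stieltjes_real real_complex_inv invrN /companion_real.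
by rewrite -!rmorphD /= -rmorphM /= -rmorphB /= opprK.
Qed.

Lemma v_at_real (gamma : R) F (l : R) : v_at gamma F l = companion_real F gamma l.
Proof. by rewrite /v_at companion_at_real. Qed.

Lemma silverstein_real (gamma : R) H F (l : R) : marchenko_pastur gamma H F -> 0 < l ->
  (companion_real F gamma l)^-1 =
  l + gamma * Ex H (fun t : R => t / (1 + t * companion_real F gamma l)).
Proof.
move=> [_ mp] l0; have := mp (- l)%:C.
rewrite companion_at_real; set v := companion_real F gamma l => {}mp.
have : ~ (complex.Im (- l)%:C = 0 /\ 0 <= complex.Re (- l)%:C).
  by move=> [_] /=; rewrite oppr_ge0 leNgt l0.
have e t : t%:C / (1 + t%:C * v%:C) = (t / (1 + t * v))%:C :> R[i].
  by rewrite -rmorphM -(rmorph1 (real_complex R)) -rmorphD real_complex_inv -rmorphM.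
have ci : cintegral H (fun t => t%:C / (1 + t%:C * v%:C)) =
    (Ex H (fun t : R => t / (1 + t * v)))%:C.
  rewrite -[RHS]complexr0 /cintegral; congr (_ +i* _).
    by apply: eq_Rintegral => t _; rewrite e.
  by rewrite -[RHS](Ex_cst H); apply: eq_Rintegral => t _; rewrite e.
move/mp; rewrite ci real_complex_inv -rmorphM -rmorphB -rmorphN => /complexI h.
by rewrite -[LHS]opprK h; ring.
Qed.

(** At a zero of the transform, Silverstein's equation would read
    [0 = l + gamma * E t] with a positive right-hand side. *)
Lemma companion_real_gt0 (gamma : R) H F (l : R) : 0 < gamma -> H [set t | 0 <= t] = 1%E ->
  marchenko_pastur gamma H F -> 0 < l -> 0 < companion_real F gamma l.
Proof.
move=> g0 H0 mp l0; have F0 := mp.1.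
apply: companion_real_pos => // l' l0'; apply/eqP => v0.
have := silverstein_real mp l0'; rewrite v0 invr0 => /esym/eqP.
rewrite gt_eqF// ltr_wpDr// mulr_ge0 ?(ltW g0)//.
have mE := @measurable_ge0_set R.
rewrite (@Ex_on_support _ _ (measurableTypeR R) H _ _ mE H0).
  apply: Ex_ge0 => t; rewrite indicE.
  case: (boolP (t \in _)); last by rewrite mul0r.
  by rewrite inE /= mulr0 addr0 divr1 mul1r.
rewrite (_ : (fun t : R => _) = (fun t : R => t)); first exact: measurable_id.
by apply/funext => t; rewrite mulr0 addr0 divr1.
Qed.

Lemma normc_Re z : `|complex.Re z| <= normc z.
Proof.
case: z => a b /=; rewrite -sqrtr_sqr; apply: ler_wsqrtr.
by rewrite lerDl sqr_ge0.
Qed.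

Lemma normc_Im z : `|complex.Im z| <= normc z.
Proof.
case: z => a b /=; rewrite -sqrtr_sqr; apply: ler_wsqrtr.
by rewrite lerDr sqr_ge0.
Qed.

Lemma normc_le z : normc z <= `|complex.Re z| + `|complex.Im z|.
Proof.
case: z => a b /=; rewrite -[leRHS]ger0_norm ?addr_ge0// -sqrtr_sqr.
apply: ler_wsqrtr; rewrite -(real_normK (num_real a)) -(real_normK (num_real b)).
by have := mulr_ge0 (normr_ge0 a) (normr_ge0 b); nra.
Qed.

Lemma normc_ge0 z : 0 <= normc z.
Proof. by case: z => a b; exact: sqrtr_ge0. Qed.

Lemma normc_real (x : R) : normc x%:C = `|x|.
Proof. by rewrite /normc /= expr0n addr0 sqrtr_sqr. Qed.

Lemma norm_normc z : `|z| = (normc z)%:C. Proof. by []. Qed.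

Definition cintegrable F (f : R -> R[i]) :=
  Rintegrable F (fun t : R => complex.Re (f t)) /\ Rintegrable F (fun t : R => complex.Im (f t)).

Lemma cintegralB F f g : cintegrable F f -> cintegrable F g ->
  cintegrable F (fun t => f t - g t) /\
  cintegral F (fun t => f t - g t) = cintegral F f - cintegral F g.
Proof.
move=> [f1 f2] [g1 g2].
have eR t : complex.Re (f t) - complex.Re (g t) = complex.Re (f t - g t).
  by case: (f t) (g t) => a b [].
have eI t : complex.Im (f t) - complex.Im (g t) = complex.Im (f t - g t).
  by case: (f t) (g t) => a b [].
split.
  by split; [apply: (@eq_Rintegrable _ _ (measurableTypeR R) F _ _ eR)|
    apply: (@eq_Rintegrable _ _ (measurableTypeR R) F _ _ eI)]; exact: RintegrableB.
rewrite /cintegral -[RHS]/((_ - _) +i* (_ - _)); congr (_ +i* _).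
  by rewrite -[RHS](ExB f1 g1); apply: eq_Rintegral => t _; rewrite eR.
by rewrite -[RHS](ExB f2 g2); apply: eq_Rintegral => t _; rewrite eI.
Qed.

Lemma cintegralZ F c f : cintegrable F f ->
  cintegrable F (fun t => c * f t) /\ cintegral F (fun t => c * f t) = c * cintegral F f.
Proof.
move=> [f1 f2]; case: c => a b.
have eR t : a * complex.Re (f t) - b * complex.Im (f t) = complex.Re ((a +i* b) * f t).
  by case: (f t).
have eI t : a * complex.Im (f t) + b * complex.Re (f t) = complex.Im ((a +i* b) * f t).
  by case: (f t).
split.
  split; [apply: (@eq_Rintegrable _ _ (measurableTypeR R) F _ _ eR)|
    apply: (@eq_Rintegrable _ _ (measurableTypeR R) F _ _ eI)].
    by apply: RintegrableB; exact: RintegrableZl.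
  by apply: RintegrableD; exact: RintegrableZl.
rewrite /cintegral -[RHS]/((_ - _) +i* (_ + _)); congr (_ +i* _).
  rewrite -!(ExZl (P := F))// -(ExB (P := F)); try exact: RintegrableZl.
  by apply: eq_Rintegral => t _; rewrite eR.
rewrite -!(ExZl (P := F))// -(ExD (P := F)); try exact: RintegrableZl.
by apply: eq_Rintegral => t _; rewrite eI.
Qed.

Section Derivative.
Variables (F : probability (measurableTypeR R) R) (l : R).
Hypotheses (F0 : F [set t | 0 <= t] = 1%E) (l0 : 0 < l).

Let mE : @measurable _ (measurableTypeR R) [set t : R | 0 <= t].
Proof. exact: measurable_ge0_set. Qed.

Lemma cintegral_bound f K : cintegrable F f -> (forall t, 0 <= t -> normc (f t) <= K) ->
  0 <= K -> normc (cintegral F f) <= 2 * K.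
Proof.
move=> [f1 f2] fK K0; apply: le_trans (normc_le _) _; rewrite mulr_natl mulr2n; apply: lerD.
  apply: (Ex_bounded_on mE F0) => //; first exact: Rintegrable_measurable f1.
  by move=> t t0; apply: le_trans (normc_Re _) (fK t t0).
apply: (Ex_bounded_on mE F0) => //; first exact: Rintegrable_measurable f2.
by move=> t t0; apply: le_trans (normc_Im _) (fK t t0).
Qed.

Lemma shifted_norm t h : 0 <= t -> normc h <= l / 2 ->
  l / 2 <= normc (t%:C - (h + (- l)%:C)).
Proof.
move=> t0 hl.
apply: le_trans (normc_Re _); case: h hl => a b hl /=.
have : `|a| <= l / 2 by apply: le_trans hl; exact: (normc_Re (a +i* b)).
rewrite ler_norml => /andP[_ al].
apply: le_trans (ler_norm _); lra.
Qed.

Lemma kernel_cintegrable h : normc h <= l / 2 ->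
  cintegrable F (fun t => (t%:C - (h + (- l)%:C))^-1).
Proof.
move=> hl; have kb t : 0 <= t -> normc (t%:C - (h + (- l)%:C))^-1 <= (l / 2)^-1.
  move=> t0; have := shifted_norm t0 hl => s.
  have l2 : 0 < l / 2 by rewrite divr_gt0.
  by rewrite normcV lef_pV2// posrE (lt_le_trans l2).
have mden : measurable_fun [set: measurableTypeR R]
    (fun t : R => (t - (complex.Re h - l)) ^+ 2 + complex.Im h ^+ 2 : R).
  apply: measurable_funD; last exact: measurable_cst.
  by apply: measurable_funX; apply: measurable_funB => //; exact: measurable_cst.
have minv := measurableT_comp measurable_inv mden.
split; apply: (@Rintegrable_on _ _ (measurableTypeR R) F _ mE F0 _ ((l / 2)^-1)).
- rewrite (_ : (fun t : R => _) = (fun t : R => (t - (complex.Re h - l)) *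
     ((t - (complex.Re h - l)) ^+ 2 + complex.Im h ^+ 2)^-1)).
    apply: measurable_funM => //.
    by apply: measurable_funB => //; exact: measurable_cst.
  apply/funext => t; rewrite Re_inv; case: (h) => a b /=.
  by rewrite sub0r addr0 sqrrN.
- by move=> t t0; apply: le_trans (normc_Re _) (kb t t0).
- rewrite (_ : (fun t : R => _) = (fun t : R => complex.Im h *
     ((t - (complex.Re h - l)) ^+ 2 + complex.Im h ^+ 2)^-1)).
    by apply: measurable_funM => //; exact: measurable_cst.
  apply/funext => t; rewrite Im_inv; case: (h) => a b /=.
  by rewrite sub0r addr0 sqrrN mulNr opprK.
- by move=> t t0; apply: le_trans (normc_Im _) (kb t t0).
Qed.

(** Remainder of the first-order expansion of the Cauchy kernel at [- l]. *)
Let rem h t := h^-1 * ((t%:C - (h + (- l)%:C))^-1 - (t%:C - (- l)%:C)^-1) -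
  ((t + l)^-1 ^+ 2)%:C.

Lemma rem_bound h t : 0 <= t -> h != 0 -> normc h <= l / 2 ->
  normc (rem h t) <= normc h * (2 / l ^+ 3).
Proof.
move=> t0 h0 hl; have tl : 0 < t + l by rewrite ltr_wpDl.
pose a : R[i] := (t + l)%:C.
have a0 : a != 0 by rewrite eq_complex /= eqxx andbT gt_eqF.
have ah : t%:C - (h + (- l)%:C) = a - h.
  by rewrite /a rmorphD rmorphN opprD opprK addrCA addrC.
have a1 : t%:C - (- l)%:C = a by rewrite /a rmorphD rmorphN opprK.
have s := shifted_norm t0 hl; rewrite ah in s.
have l2 : 0 < l / 2 by rewrite divr_gt0.
have ah0 : a - h != 0.
  by apply/eqP => e; rewrite e normc0 in s; move: s; rewrite leNgt l2.
have fid (x y : R[i]) : x != 0 -> y != 0 -> y - x != 0 ->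
    x^-1 * ((y - x)^-1 - y^-1) - y^-1 * y^-1 = x * ((y - x)^-1 * (y^-1 * y^-1)).
  by move=> x0 y0 yx0; field; rewrite x0 y0 yx0.
have -> : rem h t = h * ((a - h)^-1 * (a^-1 * a^-1)).
  have e : ((t + l)^-1 ^+ 2)%:C = a^-1 * a^-1 :> R[i] by rewrite expr2 rmorphM /a !real_complex_inv.
  rewrite /rem ah a1 e.
  exact: fid.
rewrite normcM; apply: ler_wpM2l; first exact: normc_ge0.
rewrite !normcM !normcV.
have na : l <= normc a by rewrite normc_real gtr0_norm// lerDr.
have nai : (normc a)^-1 <= l^-1 by rewrite lef_pV2 ?posrE// (lt_le_trans l0).
have -> : 2 / l ^+ 3 = (l / 2)^-1 * (l^-1 * l^-1) by field; rewrite gt_eqF.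
have ai0 : 0 <= (normc a)^-1 by rewrite invr_ge0 normc_ge0.
apply: ler_pM; rewrite ?invr_ge0 ?normc_ge0 ?mulr_ge0//.
  by rewrite lef_pV2 ?posrE// (lt_le_trans l2).
exact: ler_pM.
Qed.

Lemma kernel0_cintegrable : cintegrable F (fun t => (t%:C - (- l)%:C)^-1).
Proof.
have : cintegrable F (fun t => (t%:C - (0 + (- l)%:C))^-1).
  by apply: kernel_cintegrable; rewrite normc0 divr_ge0// ltW.
by rewrite add0r.
Qed.

Lemma square_cintegrable : cintegrable F (fun t => ((t + l)^-1 ^+ 2)%:C) /\
  cintegral F (fun t => ((t + l)^-1 ^+ 2)%:C) = (resolvent_mean2 F l)%:C.
Proof.
split.
  split; last exact: Rintegrable_cst.
  apply: (@Rintegrable_on _ _ (measurableTypeR R) F _ mE F0 _ (l^-1 ^+ 2)).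
    by apply: measurable_funX; exact: measurable_affine_inv.
  move=> t t0 /=; have /andP[h1 h2] := affine_inv_bound l0 t0.
  by rewrite normrX gtr0_norm// lerXn2r// nnegrE ltW// invr_gt0.
rewrite -[RHS]complexr0 /cintegral; congr (_ +i* _).
by rewrite -[RHS](Ex_cst F).
Qed.

Lemma stieltjes_increment h : h != 0 -> normc h <= l / 2 ->
  normc (h^-1 * (stieltjes F (h + (- l)%:C) - stieltjes F (- l)%:C) - (resolvent_mean2 F l)%:C)
  <= 2 * (normc h * (2 / l ^+ 3)).
Proof.
move=> h0 hl.
have [i1 e1] := cintegralB (kernel_cintegrable hl) kernel0_cintegrable.
have [i2 e2] := cintegralZ h^-1 i1.
have [i3 e3] := square_cintegrable.
have [i4 e4] := cintegralB i2 i3.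
rewrite /stieltjes -e1 -e2 -e3 -e4; apply: cintegral_bound => //.
  by move=> t t0; exact: rem_bound.
by rewrite mulr_ge0 ?normc_ge0// divr_ge0// exprn_ge0// ltW.
Qed.

Variable gamma : R.

(** The value of v'(- l) obtained by differentiating under the integral sign. *)
Definition companion_slope : R := gamma * (resolvent_mean2 F l - l^-1 ^+ 2) + l^-1 ^+ 2.

(** The remainder of the Cauchy kernel is of order [h], uniformly over the support of [F];
    the terms in [z^-1] of the companion transform are this kernel at [t = 0]. *)
Lemma companion_increment h : h != 0 -> normc h <= l / 2 ->
  normc (h^-1 * (companion gamma F (h + (- l)%:C) - companion gamma F (- l)%:C) -
         companion_slope%:C) <= normc h * ((2 * `|gamma| + `|1 - gamma|) * (2 / l ^+ 3)).
Proof.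
move=> h0 hl; have s := stieltjes_increment h0 hl.
have r0 := rem_bound (lexx 0) h0 hl.
set D := h^-1 * _ - _ in s.
have -> : h^-1 * (companion gamma F (h + (- l)%:C) - companion gamma F (- l)%:C) -
    companion_slope%:C = gamma%:C * D + (1 - gamma)%:C * rem h 0.
  rewrite /D /rem /companion_slope /companion.
  rewrite !(rmorphB, rmorphD, rmorphM, rmorph1, rmorph0) /= !sub0r !add0r.
  rewrite !invrN; ring.
apply: le_trans (le_normcD _ _) _; rewrite !normcM !normc_real mulrDl mulrDr.
apply: lerD.
  apply: le_trans (ler_wpM2l (normr_ge0 _) s) _.
  by rewrite le_eqVlt; apply/orP; left; apply/eqP; ring.
apply: le_trans (ler_wpM2l (normr_ge0 _) r0) _.
by rewrite le_eqVlt; apply/orP; left; apply/eqP; ring.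
Qed.

Lemma companion_real_increment (eta : R) : eta != 0 -> `|eta| <= l / 2 ->
  `|(companion_real F gamma (l + eta) - companion_real F gamma l) / eta + companion_slope|
  <= `|eta| * ((2 * `|gamma| + `|1 - gamma|) * (2 / l ^+ 3)).
Proof.
move=> eta0 etal.
have h0 : (- eta)%:C != 0 :> R[i] by rewrite eq_complex /= oppr_eq0 eqxx andbT.
have hl : normc (- eta)%:C <= l / 2 by rewrite normc_real normrN.
have := companion_increment h0 hl; rewrite [X in _ <= X * _ -> _]normc_real normrN.
have -> : (- eta)%:C + (- l)%:C = (- (l + eta))%:C :> R[i] by rewrite -rmorphD -opprD addrC.
rewrite !companion_at_real -rmorphB real_complex_inv -rmorphM -rmorphB normc_real.
by rewrite invrN mulNr -opprD normrN [_^-1 * _]mulrC.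
Qed.

Lemma dv_at_real : dv_at gamma F l = companion_slope.
Proof.
rewrite /dv_at /derive1.
set f : R[i]^o -> R[i]^o := companion gamma F.
have : (fun h : R[i]^o => h^-1 *: (f (h + (- l)%:C) - f (- l)%:C)) @ 0^' --> (companion_slope%:C : R[i]^o).
  apply/cvgrPdist_le => e e0.
  have [e1 e1p ee] : exists2 e1 : R, 0 < e1 & e = e1%:C.
    move: e0; case: (e) => a b; rewrite ltcE /= => /andP[/eqP b0 a0].
    by exists a => //; rewrite -complexr0 -b0.
  pose K := (2 * `|gamma| + `|1 - gamma|) * (2 / l ^+ 3) + 1.
  have K0 : 0 < K.
    rewrite ltr_wpDl//; apply: mulr_ge0; first by rewrite addr_ge0// mulr_ge0.
    by rewrite divr_ge0// exprn_ge0// ltW.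
  pose b := Num.min (l / 2) (e1 / K).
  have b0 : 0 < b by rewrite lt_min !divr_gt0.
  have bC : 0 < b%:C :> R[i] by rewrite ltcR.
  near=> h.
  have h0 : h != 0 by near: h; exact: nbhs_dnbhs_neq.
  have hb : normc h <= b.
    rewrite -lecR -norm_normc ltW//; near: h; exact: dnbhs0_lt.
  have hl : normc h <= l / 2 by apply: le_trans hb _; rewrite ge_min lexx.
  rewrite distrC norm_normc ee lecR.
  apply: le_trans (companion_increment h0 hl) _.
  apply: (@le_trans _ _ (normc h * K)).
    by apply: ler_wpM2l; [exact: normc_ge0|rewrite lerDl].
  by rewrite -ler_pdivlMr//; apply: le_trans hb _; rewrite ge_min lexx orbT.
move/cvg_lim => ->//; exact: norm_hausdorff.
Unshelve. all: by end_near. Qed.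

End Derivative.
End ComplexStieltjes.

(** * From the approximate to the limiting fixed point *)

Section FixedPointLimit.
Context {R : realType} (gamma l v C : R) (p : nat -> nat)
  (Sg : forall n, 'M[R]_(p n)) (tb : nat -> R) (H : probability (measurableTypeR R) R).
Hypothesis p_infty : p n @[n --> \oo] --> \oo.
Hypothesis p_ratio : (p n)%:R / n%:R @[n --> \oo] --> gamma.
Hypothesis Sg_psd : forall n, psd (Sg n).
Hypothesis Sg_bound : forall n u, dot u (Sg n *m u) <= C * dot u u.
Hypothesis H0 : H [set t | 0 <= t] = 1%E.
Hypothesis Sg_H : weakly_converges (fun n => spectral_cdf (Sg n)) H.
Hypotheses (l0 : 0 < l) (v0 : 0 < v).
Hypothesis silverstein : 1 = l * v + gamma * Ex H (fun t : R => t * v / (1 + t * v)).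
Hypothesis tb0 : forall n, 0 <= tb n.
Hypothesis tb_fixed : (tb n - n%:R^-1 *
  \tr (Sg n *m resolvent ((1 + tb n)^-1 *: Sg n) l)) @[n --> \oo] --> (0 : R).

Let sp n := spectrum (Sg n).
Let phi (s t : R) := t * s / (1 + t * s).
(** The candidate for [v] in dimension [n]. *)
Let s n := (l * (1 + tb n))^-1.

Let sp_facts n := psd_spectrum (Sg_psd n) (@Sg_bound n).

Let p_pos : \forall n \near \oo, (0 < p n)%N.
Proof. by have /cvgnyPgt/(_ 0%N) := p_infty. Qed.

Lemma phi_average : (\sum_(a <- sp n) phi v a) / (size (sp n))%:R @[n --> \oo] --> Ex H (phi v).
Proof.
apply: (@helly_bray _ H sp C v).
- move=> x xc; have := Sg_H xc; rewrite /spectral_cdf => h.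
  rewrite (_ : (fun n => _) = (fun n => (count (fun a => a <= x) (spectrum (Sg n)))%:R / (p n)%:R))//.
  by apply/funext => n; have [-> _ _] := sp_facts n.
- by move=> n a an; have [_ h _] := sp_facts n; exact: h.
- by near=> n; have [-> _ _] := sp_facts n; near: n.
- by [].
- by [].
- apply: measurable_funM; first by apply: measurable_funM => //; exact: measurable_cst.
  apply: (measurableT_comp measurable_inv); apply: measurable_funD; first exact: measurable_cst.
  by apply: measurable_funM => //; exact: measurable_cst.
move=> x y x0 y0.
have xv : 0 < 1 + x * v by rewrite ltr_wpDr// mulr_ge0// ltW.
have yv : 0 < 1 + y * v by rewrite ltr_wpDr// mulr_ge0// ltW.
have -> : phi v x - phi v y = v * ((x - y) * ((1 + x * v) * (1 + y * v))^-1).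
  by rewrite /phi; field; rewrite !gt_eqF.
rewrite normrM (gtr0_norm v0) ler_pM2l// normrM -[leRHS]mulr1; apply: ler_pM => //.
rewrite gtr0_norm ?invr_gt0 ?mulr_gt0// invf_le1 ?mulr_gt0//.
by rewrite mulr_ege1// lerDl mulr_ge0// ltW.
Unshelve. all: by end_near. Qed.

(** Silverstein's equation for the spectrum of [Sg n] reads [Theta n u = 1]. *)
Let Theta n (u : R) := l * u + n%:R^-1 * \sum_(a <- sp n) phi u a.

Let Theta_v : Theta n v @[n --> \oo] --> (1 : R).
Proof.
rewrite silverstein; apply: cvgD; first exact: cvg_cst.
apply: cvg_trans (cvgM p_ratio phi_average); apply: near_eq_cvg; near=> n.
have sz : size (sp n) = p n by have [] := sp_facts n.
rewrite /= sz; have pn : (p n)%:R != 0 :> R by rewrite pnatr_eq0 -lt0n; near: n.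
have id3 (a b q : R) : q != 0 -> q * a * (b / q) = a * b by move=> q0; field.
exact: id3.
Unshelve. all: by end_near. Qed.

Let tb1 n : 0 < 1 + tb n. Proof. by rewrite ltr_pwDl. Qed.
Let s0 n : 0 < s n. Proof. by rewrite invr_gt0 mulr_gt0. Qed.

Let Theta_s n : `|Theta n (s n) - 1| <= `|tb n - n%:R^-1 *
  \tr (Sg n *m resolvent ((1 + tb n)^-1 *: Sg n) l)|.
Proof.
have [_ spC tr_sp] := sp_facts n.
rewrite tr_sp//; last by rewrite invr_ge0 ltW.
have ls : l * s n = (1 + tb n)^-1 by rewrite /s; field; rewrite !gt_eqF.
have -> : Theta n (s n) = (1 + tb n)^-1 * (1 + n%:R^-1 *
    \sum_(a <- spectrum (Sg n)) a / ((1 + tb n)^-1 * a + l)).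
  rewrite /Theta ls mulrDr mulr1 mulrCA; congr (_ + _ * _).
  rewrite mulr_sumr !big_seq; apply: eq_bigr => a /spC /andP[a0 _].
  rewrite -ls /phi.
  have as0 : 0 < 1 + a * s n by rewrite ltr_wpDr// mulr_ge0// ltW.
  have as1 : 0 < l * s n * a + l.
    by rewrite ltr_wpDl// mulr_ge0// mulr_ge0// ltW.
  have -> : l * s n * a + l = l * (1 + a * s n) by ring.
  by field; rewrite !gt_eqF.
set q := n%:R^-1 * _.
have -> : (1 + tb n)^-1 * (1 + q) - 1 = (1 + tb n)^-1 * (q - tb n).
  by field; rewrite gt_eqF.
rewrite normrM distrC gtr0_norm ?invr_gt0// ler_piMl//.
by rewrite invf_le1// lerDl.
Qed.

Let Theta_inc n u u' : 0 <= u -> 0 <= u' -> l * `|u - u'| <= `|Theta n u - Theta n u'|.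
Proof.
wlog uu : u u' / u' <= u.
  move=> h u_0 u'_0; case: (leP u' u) => [|/ltW] uu; first exact: h.
  by rewrite distrC [leRHS]distrC; exact: h.
move=> u_0 u'_0; rewrite ger0_norm ?subr_ge0//.
apply: le_trans (ler_norm _); rewrite /Theta mulrBr opprD addrACA lerDl.
rewrite -mulrBr mulr_ge0 ?invr_ge0 ?ler0n// subr_ge0.
have [_ spC _] := sp_facts n.
rewrite !big_seq; apply: ler_sum => a /spC /andP[a0 _].
have h x : 0 <= x -> 0 < 1 + a * x by move=> x0; rewrite ltr_wpDr// mulr_ge0.
have e x : 0 <= x -> phi x a = 1 - (1 + a * x)^-1.
  by move=> x0; rewrite /phi; field; rewrite gt_eqF// h.
rewrite !e// lerD2l lerN2 lef_pV2 ?posrE ?h//.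
by rewrite lerD2l ler_wpM2l.
Qed.

(** Both [s n] and [v] solve [Theta n u = 1] up to a vanishing error: the former is the
    hypothesis [tb_fixed], the latter weak convergence of the spectra.  Since [Theta n]
    has slope at least [l], the two must merge. *)
Lemma fixed_point_limit : 1 + tb n @[n --> \oo] --> (l * v)^-1.
Proof.
have sv : s n @[n --> \oo] --> v.
  apply/cvgrPdist_le => e e0.
  have e1 : 0 < l * e / 2 by rewrite divr_gt0// mulr_gt0.
  have /cvgrPdist_le/(_ _ e1) h1 := Theta_v.
  have /cvgrPdist_le/(_ _ e1) h2 := tb_fixed.
  near=> n.
  rewrite -(ler_pM2l l0).
  apply: le_trans (Theta_inc n (ltW v0) (ltW (s0 n))) _.
  have t1 : `|1 - Theta n v| <= l * e / 2 by near: n.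
  have t2 : `|tb n - n%:R^-1 * \tr (Sg n *m resolvent ((1 + tb n)^-1 *: Sg n) l)| <= l * e / 2.
    by rewrite -normrN -sub0r; near: n.
  have t3 := le_trans (Theta_s n) t2.
  have -> : Theta n v - Theta n (s n) = - (1 - Theta n v) - (Theta n (s n) - 1) by ring.
  apply: le_trans (ler_normB _ _) _; rewrite normrN; lra.
have -> : (fun n => 1 + tb n) = (fun n => (l * s n)^-1).
  by apply/funext => n; rewrite /s; field; rewrite !gt_eqF.
apply: cvgV; first by rewrite gt_eqF// mulr_gt0.
by apply: cvgM => //; exact: cvg_cst.
Unshelve. all: by end_near. Qed.

End FixedPointLimit.

(** * Conditional second moments *)

Section ConditionalExpectation.
Context {R : realType} {d} {T : measurableType d} (P : probability T R).
Local Notation Rintegrable := (Rintegrable P).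
Local Notation Ex := (Ex P).

Lemma ge0_Rintegrable (f : T -> R) (a : R) : measurable_fun setT f -> (forall t, 0 <= f t) ->
  (\int[P]_t (f t)%:E)%E = a%:E -> Rintegrable f /\ Ex f = a.
Proof.
move=> mf f0 fa; split; last by rewrite /Ex /Rintegral fa.
apply/integrableP; split; first exact/measurable_EFinP.
under eq_integral do rewrite /= ger0_norm//.
by rewrite fa ltry.
Qed.

Lemma Rintegrable_sq (f : T -> R) : measurable_fun setT f ->
  Rintegrable (fun t => f t ^+ 2) -> Rintegrable f.
Proof.
move=> mf f2; apply: (Rintegrable_le mf _ (RintegrableD (Rintegrable_cst P 1) f2)) => t.
rewrite -[f t ^+ 2]real_normK ?num_real//; have := sqr_ge0 (`|f t| - 1).
by have := normr_ge0 (f t); nra.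
Qed.

Lemma centred_covariance (X Y : T -> R) : 'E_P[X]%E = 0%E -> 'E_P[Y]%E = 0%E ->
  covariance P X Y = (\int[P]_t (X t * Y t)%:E)%E.
Proof.
move=> EX EY; rewrite covariance.unlock EX EY /= expectation.unlock; apply: eq_integral => t _ /=.
by rewrite -[LHS]/(((X t - 0) * (Y t - 0))%:E) !subr0.
Qed.

Lemma centred_moments (X : T -> R) (v : R) : measurable_fun setT X ->
  'E_P[X]%E = 0%E -> 'V_P[X]%E = v%:E ->
  [/\ Rintegrable X, Rintegrable (fun t => X t ^+ 2), Ex X = 0 & Ex (fun t => X t ^+ 2) = v].
Proof.
move=> mX EX VX.
have [h1 h2] : Rintegrable (fun t => X t ^+ 2) /\ Ex (fun t => X t ^+ 2) = v.
  apply: ge0_Rintegrable => [|t|]; [exact: measurable_funX|exact: sqr_ge0|].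
  by rewrite -VX /variance centred_covariance//.
split=> //; first exact: Rintegrable_sq.
by have := EX; rewrite expectation.unlock /Ex /Rintegral => ->.
Qed.

Lemma same_distribution_Ex (U V : T -> R) : measurable_fun setT U -> measurable_fun setT V ->
  (forall B : set R, measurable B -> P (U @^-1` B) = P (V @^-1` B)) ->
  Rintegrable U -> Rintegrable V /\ Ex V = Ex U.
Proof.
move=> mU mV UV iU.
pose U' : {mfun T >-> measurableTypeR R} :=
  MeasurableFun.Pack (MeasurableFun.Class (isMeasurableFun.Build _ _ _ (measurableTypeR R) _ mU)).
pose V' : {mfun T >-> measurableTypeR R} :=
  MeasurableFun.Pack (MeasurableFun.Class (isMeasurableFun.Build _ _ _ (measurableTypeR R) _ mV)).
have dE (f : measurableTypeR R -> \bar R) :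
    (\int[distribution P U']_y f y = \int[distribution P V']_y f y)%E.
  by apply: eq_measure_integral => A mA _; exact: UV.
have mE : measurable_fun [set: measurableTypeR R] (EFin : measurableTypeR R -> \bar R).
  exact: EFin_measurable.
have iV : Rintegrable V.
  apply/integrableP; split; first exact/measurable_EFinP.
  have [_] := integrableP _ _ _ iU.
  have mabs : measurable_fun [set: measurableTypeR R] (fun y : measurableTypeR R => `|y%:E|%E).
    exact: measurableT_comp.
  have e1 := @ge0_integral_distribution _ _ _ _ _ P U' (fun y => `|y%:E|%E) mabs (fun y => abse_ge0 _).
  have e2 := @ge0_integral_distribution _ _ _ _ _ P V' (fun y => `|y%:E|%E) mabs (fun y => abse_ge0 _).
  by rewrite -[X in (X < _)%E -> _]e1 dE -[X in _ -> (X < _)%E]e2.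
split=> //; congr fine.
have e1 := @integral_distribution _ _ _ _ _ P U' (fun y => y%:E) mE iU.
have e2 := @integral_distribution _ _ _ _ _ P V' (fun y => y%:E) mE iV.
by rewrite -[LHS]e2 -[RHS]e1 dE.
Qed.

(** Two versions have equal integrals over all members of the sigma-algebra, hence agree
    almost everywhere for the law restricted to it. *)
Lemma cond_expectation_unique (G : set (set T)) (f r r' : T -> R) : G `<=` measurable ->
  is_cond_expectation P <<s G >> f r -> is_cond_expectation P <<s G >> f r' ->
  {ae P, forall t, r t = r' t}.
Proof.
move=> Gm [mr ir hr] [mr' ir' hr'].
have sGm : <<s G >> `<=` measurable.
  by apply: smallest_sub => //; exact: sigma_algebra_measurable.
pose T' := g_sigma_algebraType G.
have mwr g : (forall B : set R, measurable B -> <<s G >> (g @^-1` B)) -> measurable_wrt G g.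
  by move=> h _ B mB; rewrite setTI; exact: h.
have int_eq g A : measurable_wrt G g -> Rintegrable g -> <<s G >> A ->
    (\int[coarse_law P Gm]_(t in A) (g t)%:E = \int[P]_(t in A) (g t)%:E)%E.
  move=> mg ig sA; apply: (integral_pushforward (measurable_coarsen Gm)) => //.
  - exact/measurable_EFinP.
  - by apply: (integrableS _ _ _ ig) => //; exact: sGm.
have : ae_eq (coarse_law P Gm) setT (EFin \o r : T' -> \bar R) (EFin \o r').
  apply: integral_ae_eq => //.
  - apply: coarse_law_integrable => //; apply/measurable_EFinP; exact: mwr.
  - apply/measurable_EFinP; exact: mwr.
  - move=> A _ mA.
    by rewrite !int_eq ?hr ?hr'//; exact: mwr.
move=> [N [mN N0 rN]]; exists N; split; [exact: sGm|exact: N0|].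
by move=> t /= rr'; apply: rN => /= h; apply: rr'; have [] := h Logic.I.
Qed.

Lemma integral_over_indic (A : set T) (f : T -> R) : measurable A -> Rintegrable f ->
  Rintegrable (fun t => \1_A t * f t) /\
  (\int[P]_(t in A) (f t)%:E)%E = (Ex (fun t => \1_A t * f t))%:E.
Proof.
move=> mA fi.
have i1 : Rintegrable (fun t => \1_A t * f t).
  apply: (Rintegrable_le _ _ (Rintegrable_abs fi)).
    apply: measurable_on_support => //; exact: Rintegrable_measurable fi.
  move=> t; rewrite indicE; case: (_ \in _); first by rewrite mul1r.
  by rewrite mul0r normr0.
split=> //; rewrite -Ex_fin// integral_mkcond; apply: eq_integral => t _.
rewrite patchE indicE; case: (_ \in _); first by rewrite mul1r.
by rewrite mul0r.
Qed.

(** The coefficients are known given [G] and the other factors are independent of [G], so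
    conditioning replaces each product of factors by its mean. *)
Lemma conditional_quadratic (S : finType) (C Q : S -> T -> R) (G G' : set (set T)) (K : R) :
  G `<=` measurable -> G' `<=` measurable -> independent2 P G G' ->
  (forall s, measurable_wrt G (C s)) -> (forall s t, `|C s t| <= K) ->
  (forall s s', measurable_wrt G' (fun t => Q s t * Q s' t)) ->
  (forall s s', Rintegrable (fun t => Q s t * Q s' t)) ->
  is_cond_expectation P <<s G >> (fun t => (\sum_s C s t * Q s t) ^+ 2)
    (fun t => \sum_s \sum_s' C s t * C s' t * Ex (fun u => Q s u * Q s' u)).
Proof.
move=> Gm Gm' GG' mC CK mQ iQ.
have sGm : <<s G >> `<=` measurable.
  by apply: smallest_sub => //; exact: sigma_algebra_measurable.
set e := (X in is_cond_expectation _ _ X); set rv := (X in is_cond_expectation _ _ _ X).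
have mCC s s' : measurable_wrt G (fun t => C s t * C s' t).
  exact: (measurable_funM (mC s) (mC s')).
have CCK s s' t : `|C s t * C s' t| <= K * K by rewrite normrM ler_pM.
have iCC s s' : Rintegrable (fun t => C s t * C s' t).
  apply: (@Rintegrable_bounded _ _ _ _ _ (K * K)) => //.
  exact: measurable_wrt_measurable (mCC s s').
have eE t : e t = \sum_s \sum_s' (C s t * C s' t) * (Q s t * Q s' t).
  rewrite /e expr2 mulr_suml; apply: eq_bigr => s _; rewrite mulr_sumr.
  by apply: eq_bigr => s' _; ring.
have irv : Rintegrable rv.
  apply: Rintegrable_sum => s; apply: Rintegrable_sum => s'.
  by apply: (eq_Rintegrable _ (RintegrableZl (Ex (fun u => Q s u * Q s' u)) (iCC s s'))) => t; rewrite mulrC.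
have h2 s s' := independent2_integrable_mul Gm Gm' GG' (mCC s s') (mQ s s') (iCC s s') (iQ s s').
have ie : Rintegrable e.
  apply: (eq_Rintegrable (fun t => esym (eE t))).
  by apply: Rintegrable_sum => s; apply: Rintegrable_sum => s'; exact: (h2 s s').1.
have mrv : measurable_wrt G rv.
  apply: measurable_sum => s; apply: measurable_sum => s'.
  by apply: measurable_funM; [exact: mCC|exact: measurable_cst].
split=> //.
  by move=> B mB; have := mrv measurableT B mB; rewrite setTI.
move=> A sA; have mA := sGm _ sA.
rewrite (integral_over_indic mA irv).2 (integral_over_indic mA ie).2; congr (_ %:E).
have mI : measurable_wrt G (\1_A : T -> R).
  by apply: (@measurable_indic _ (g_sigma_algebraType G)).
have mIC s s' : measurable_wrt G (fun t => \1_A t * (C s t * C s' t)).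
  exact: (measurable_funM mI (mCC s s')).
have iIC s s' : Rintegrable (fun t => \1_A t * (C s t * C s' t)).
  exact: (integral_over_indic mA (iCC s s')).1.
have h3 s s' := independent2_integrable_mul Gm Gm' GG' (mIC s s') (mQ s s') (iIC s s') (iQ s s').
have E1 t : \1_A t * rv t = \sum_s \sum_s' Ex (fun u => Q s u * Q s' u) *
    (\1_A t * (C s t * C s' t)).
  rewrite /rv mulr_sumr; apply: eq_bigr => s _; rewrite mulr_sumr.
  by apply: eq_bigr => s' _; ring.
have E2 t : \1_A t * e t = \sum_s \sum_s' (\1_A t * (C s t * C s' t)) * (Q s t * Q s' t).
  rewrite eE mulr_sumr; apply: eq_bigr => s _; rewrite mulr_sumr.
  by apply: eq_bigr => s' _; ring.
rewrite (eq_Ex P E1) (eq_Ex P E2) !Ex_sum; last first.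
- by move=> s; apply: Rintegrable_sum => s'; exact: RintegrableZl.
- by move=> s; apply: Rintegrable_sum => s'; exact: (h3 s s').1.
apply: eq_bigr => s _; rewrite !Ex_sum; last first.
- by move=> s'; exact: RintegrableZl.
- by move=> s'; exact: (h3 s s').1.
by apply: eq_bigr => s' _; rewrite ExZl// (h3 s s').2 mulrC.
Qed.

End ConditionalExpectation.

(** * Algebra of the ridge estimator *)

Section RidgeAlgebra.
Context {R : realType} {n p : nat}.
Variables (X : 'M[R]_(n, p)) (l : R).
Hypotheses (n0 : (0 < n)%N) (l0 : 0 < l).
Let Q := resolvent (sample_cov X) l.

Let nR : (n%:R : R) != 0. Proof. by rewrite pnatr_eq0 -lt0n. Qed.

Lemma ridge_invmx : invmx (X^T *m X + (l * n%:R)%:M) = n%:R^-1 *: Q.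
Proof.
apply: invmx_right.
have -> : X^T *m X + (l * n%:R)%:M = n%:R *: (sample_cov X + l%:M).
  by rewrite scalerDr scalerA mulfV// scale1r scale_scalar_mx mulrC.
rewrite -scalemxAl -scalemxAr scalerA mulfV// scale1r mul_resolvent//.
exact: sample_cov_psd.
Qed.

Lemma resolvent_sample_cov : Q *m sample_cov X = 1%:M - l *: Q.
Proof.
have := resolvent_mul (sample_cov_psd X) l0; rewrite mulmxDr mul_mx_scalar => <-.
by rewrite addrK.
Qed.

(** The shrinkage bias [l Q w] and the noise term, both linear in quantities independent
    of [X]. *)
Lemma ridge_error (w : 'cV[R]_p) (eps : 'cV[R]_n) :
  w - ridge X (X *m w + eps) l = (l *: Q) *m w - (n%:R^-1 *: (Q *m X^T)) *m eps.
Proof.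
rewrite /ridge ridge_invmx mulmxDr opprD addrA; congr (_ - _); last first.
  by rewrite -!scalemxAl.
have -> : n%:R^-1 *: Q *m X^T *m (X *m w) = Q *m sample_cov X *m w.
  by rewrite /sample_cov -!scalemxAl -scalemxAr -scalemxAl !mulmxA.
by rewrite resolvent_sample_cov mulmxBl mul1mx opprB addrCA subrr addr0.
Qed.

(** The relation between [Q] and the sample covariance turns the Gram matrix of the noise
    coefficients into a polynomial in [Q]. *)
Lemma noise_gram : (n%:R^-1 *: (Q *m X^T)) *m (n%:R^-1 *: (Q *m X^T))^T =
  n%:R^-1 *: (Q - l *: (Q *m Q)).
Proof.
rewrite linearZ /= trmx_mul trmxK -scalemxAl -scalemxAr.
rewrite /Q resolvent_sym; last exact: sample_cov_psd.
rewrite -/Q; have -> : Q *m X^T *m (X *m Q) = n%:R *: (Q *m sample_cov X *m Q).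
  by rewrite /sample_cov -scalemxAr -scalemxAl scalerA mulfV// scale1r !mulmxA.
by rewrite [in X in _ *: X]scalerA mulVf// scale1r resolvent_sample_cov mulmxBl mul1mx -scalemxAl.
Qed.

(** The squared norm is at most [y = (n l)^-1]; the bound [1 + y] avoids [Num.sqrt y]. *)
Lemma noise_opbound : opbound (1 + (n%:R * l)^-1) (n%:R^-1 *: (X *m Q)).
Proof.
have nl : 0 < n%:R * l by rewrite mulr_gt0// ltr0n.
split=> [|u]; first by rewrite addr_ge0// invr_ge0 ltW.
have hp := sample_cov_psd X.
have -> : n%:R^-1 *: (X *m Q) = (n%:R^-1 *: (Q *m X^T))^T.
  by rewrite linearZ /= trmx_mul trmxK /Q resolvent_sym.
rewrite dot_mull mulmxA trmxK noise_gram -scalemxAl dotZr mulmxBl -scalemxAl dotC dotDl -scaleN1r dotZl dotZl.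
have h1 : dot (Q *m u) u <= l^-1 * sqn u by rewrite dotC; exact: resolvent_quad.
have h2 : 0 <= dot (Q *m Q *m u) u.
  by rewrite -mulmxA dot_mull [Q^T]resolvent_sym// sqn_ge0.
have h3 := sqn_ge0 u.
apply: (@le_trans _ _ ((n%:R * l)^-1 * sqn u)).
  rewrite invfM -mulrA ler_wpM2l ?invr_ge0 ?ler0n//.
  have h4 := mulr_ge0 (ltW l0) h2; lra.
rewrite ler_wpM2r//; have : 0 < (n%:R * l)^-1 by rewrite invr_gt0.
by set y := (n%:R * l)^-1; nra.
Qed.

End RidgeAlgebra.

(** * The predictive risk of one ridge problem *)

Section PredictiveRisk.
Context {R : realType} {d} {T : measurableType d} (P : probability T R).
Context {n p : nat} (M : ridge_problem P n p) (alpha l : R).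
Hypotheses (n0 : (0 < n)%N) (l0 : 0 < l) (Msetting : ridge_setting M alpha).
Hypothesis Z_cov_int : forall i a b, Rintegrable P (fun t => Z M i a t * Z M i b t).
Hypothesis Z_cov : forall i a b, Ex P (fun t => Z M i a t * Z M i b t) = (a == b)%:R.
Local Notation Rintegrable := (Rintegrable P).
Local Notation Ex := (Ex P).

Let X t := Xmx M t.
Let Q t := resolvent (sample_cov (X t)) l.
Let Sg := Sigma M.

Let mRV (f : {RV P >-> R}) : measurable_fun setT f.
Proof. exact: measurable_funPT. Qed.

Lemma measurable_Xmx : measurable_mx (fun t => X t).
Proof.
apply: measurable_mxM; last exact: measurable_mx_cst.
by move=> i j; apply: (measurable_ext (f := Z M i j)) => [t|]; rewrite ?mxE//; exact: mRV.
Qed.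

(** The blocks, in the order of the model: features, weights, noise, test point,
    test noise. *)
Let blk := tnth [tuple
    sigma_X M ;
    sigma_gen (fun j => weight M j : T -> R) ;
    sigma_gen (fun i => noise M i : T -> R) ;
    sigma_gen (fun j => test_x M j : T -> R) ;
    sigma_rv (test_noise M)].
Let b0 : 'I_5 := @Ordinal 5 0 isT.
Let b1 : 'I_5 := @Ordinal 5 1 isT.
Let b2 : 'I_5 := @Ordinal 5 2 isT.
Let b3 : 'I_5 := @Ordinal 5 3 isT.
Let b4 : 'I_5 := @Ordinal 5 4 isT.

Let ord5 (i : 'I_5) : i \in [:: b0; b1; b2; b3; b4].
Proof. by case: i => -[|[|[|[|[|]]]]] // h; rewrite !inE -!val_eqE. Qed.

Lemma sigma_gen_measurable (J : Type) (f : J -> T -> R) :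
  (forall j, measurable_fun setT (f j)) -> sigma_gen f `<=` measurable.
Proof.
move=> mf; apply: smallest_sub; first exact: sigma_algebra_measurable.
by move=> A [j _]; apply: sigma_rv_measurable; exact: mf.
Qed.

Lemma sigma_gen_measurable_wrt (J : Type) (f : J -> T -> R) j : measurable_wrt (sigma_gen f) (f j).
Proof.
apply: sigma_rv_measurable_wrt => A fA; apply: sub_sigma_algebra.
by exists j.
Qed.

Let blk_sigma i : sigma_algebra setT (blk i).
Proof.
have := ord5 i; rewrite !inE => /or4P[|||/orP[]] /eqP->; try exact: smallest_sigma_algebra.
exact: sigma_rv_sigma_algebra.
Qed.

Let blk_measurable i : blk i `<=` measurable.
Proof.
have := ord5 i; rewrite !inE => /or4P[|||/orP[]] /eqP->; try
 (apply: sigma_gen_measurable => j; try exact: mRV; exact: measurable_Xmx).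
apply: sigma_rv_measurable; exact: mRV.
Qed.

Let blk_indep : mutually_independent P blk := blocks_independent Msetting.

Let gen (J : {set 'I_5}) := gen_over blk J.
Let gen_m J : gen J `<=` measurable.
Proof. exact: (@gen_over_measurable _ _ _ blk blk_measurable J). Qed.
Let gen_indep (J K : {set 'I_5}) : {in J, forall i, i \notin K} -> independent2 P (gen J) (gen K).
Proof. exact: (gen_over_independent2 blk_sigma blk_measurable blk_indep). Qed.

Let w_wrt (J : {set 'I_5}) k : b1 \in J -> measurable_wrt (gen J) (weight M k).
Proof.
move=> h; apply: (gen_over_measurable_wrt h).
exact: (@sigma_gen_measurable_wrt _ (fun j => weight M j : T -> R)).
Qed.
Let e_wrt (J : {set 'I_5}) k : b2 \in J -> measurable_wrt (gen J) (noise M k).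
Proof.
move=> h; apply: (gen_over_measurable_wrt h).
exact: (@sigma_gen_measurable_wrt _ (fun j => noise M j : T -> R)).
Qed.
Let x_wrt (J : {set 'I_5}) k : b3 \in J -> measurable_wrt (gen J) (test_x M k).
Proof.
move=> h; apply: (gen_over_measurable_wrt h).
exact: (@sigma_gen_measurable_wrt _ (fun j => test_x M j : T -> R)).
Qed.
Let e0_wrt (J : {set 'I_5}) : b4 \in J -> measurable_wrt (gen J) (test_noise M).
Proof. by move=> h; apply: (gen_over_measurable_wrt h); exact: sigma_rv_measurable_wrt. Qed.

Let S_sym : (sqrtSigma M)^T = sqrtSigma M.
Proof. by have [[]] := sqrtSigmaP Msetting. Qed.

Lemma feature_second_moment i j j' : Rintegrable (fun t => X t i j * X t i j') /\
  Ex (fun t => X t i j * X t i j') = Sg j j'.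
Proof.
have E t : X t i j * X t i j' = \sum_a \sum_b
    (sqrtSigma M a j * sqrtSigma M b j') * (Z M i a t * Z M i b t).
  rewrite /X /Xmx !mxE mulr_suml; apply: eq_bigr => a _; rewrite mulr_sumr.
  by apply: eq_bigr => b _; rewrite !mxE; ring.
have i2 a b := RintegrableZl (sqrtSigma M a j * sqrtSigma M b j') (Z_cov_int i a b).
have i1 a := Rintegrable_sum (index_enum 'I_p) predT (i2 a).
split; first by apply: (eq_Rintegrable (fun t => esym (E t))); exact: Rintegrable_sum.
rewrite (eq_Ex P E) Ex_sum// /Sg -(sqrtSigmaP Msetting).2 mxE; apply: eq_bigr => a _.
rewrite Ex_sum// (bigD1 a)//= ExZl// Z_cov eqxx mulr1 big1 ?addr0 => [|b ba].
  by rewrite -{1}S_sym mxE.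
by rewrite ExZl// Z_cov eq_sym (negbTE ba) mulr0.
Qed.

Lemma test_second_moment j j' : Rintegrable (fun t => test_x M j t * test_x M j' t) /\
  Ex (fun t => test_x M j t * test_x M j' t) = Sg j j'.
Proof.
have [iX EX] := feature_second_moment (Ordinal n0) j j'.
rewrite -EX; apply: (same_distribution_Ex _ _ _ iX).
- by apply: measurable_funM; exact: measurable_Xmx.
- by apply: measurable_funM; exact: mRV.
move=> B mB; apply: esym.
apply: (test_x_law Msetting (Ordinal n0) (B := [set f | B (f j * f j')])).
pose G := \bigcup_j sigma_rv (fun f : 'I_p -> R => f j).
have m k : @measurable_fun _ _ (g_sigma_algebraType G) _ setT (fun f => f k).
  move=> _ A mA; apply: sub_sigma_algebra; exists k => //; by exists A.
have := measurable_funM (m j) (m j').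
move=> /(_ measurableT _ mB).
by rewrite setTI.
Qed.

(** Weights and training noise enter the error in the same way, so they are indexed
    together; [uv] lists their variances. *)
Let um (m : 'I_p + 'I_n) : T -> R :=
  match m with inl k => weight M k | inr i => noise M i end.
Let uv (m : 'I_p + 'I_n) : R := if m is inl _ then alpha ^+ 2 / p%:R else 1.

Let um_wrt (J : {set 'I_5}) m : b1 \in J -> b2 \in J -> measurable_wrt (gen J) (um m).
Proof. by move=> h1 h2; case: m => k; [exact: w_wrt|exact: e_wrt]. Qed.

Lemma weight_moments k : [/\ Rintegrable (weight M k), Rintegrable (fun t => weight M k t ^+ 2),
  Ex (weight M k) = 0 & Ex (fun t => weight M k t ^+ 2) = alpha ^+ 2 / p%:R].
Proof.
apply: centred_moments => //; first exact: weight_mean Msetting k.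
by rewrite /variance (weight_covariance Msetting) eqxx.
Qed.

Lemma noise_moments i : [/\ Rintegrable (noise M i), Rintegrable (fun t => noise M i t ^+ 2),
  Ex (noise M i) = 0 & Ex (fun t => noise M i t ^+ 2) = 1].
Proof.
by apply: centred_moments => //; [exact: noise_mean Msetting i|exact: noise_variance Msetting i].
Qed.

Lemma test_noise_moments : [/\ Rintegrable (test_noise M), Rintegrable (fun t => test_noise M t ^+ 2),
  Ex (test_noise M) = 0 & Ex (fun t => test_noise M t ^+ 2) = 1].
Proof.
by apply: centred_moments => //; [exact: test_noise_mean Msetting|exact: test_noise_variance Msetting].
Qed.

Lemma noise_second_moment i i' : i != i' -> Ex (fun t => noise M i t * noise M i' t) = 0.
Proof.
move=> ii'.
have Gs k : sigma_algebra setT (sigma_rv (noise M k)) by exact: sigma_rv_sigma_algebra.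
have Gm k : sigma_rv (noise M k) `<=` measurable by apply: sigma_rv_measurable; exact: mRV.
have E t : noise M i t * noise M i' t = \prod_(k <- [:: i; i']) noise M k t.
  by rewrite big_cons big_seq1.
rewrite (eq_Ex P E).
have -> := (independent_prod Gs Gm (noise_independent Msetting) (f := fun k => noise M k)
  (s := [:: i; i']) _ _ _).2; rewrite ?big_cons.
- by have [_ _ -> _] := noise_moments i; rewrite mul0r.
- by move=> k; exact: sigma_rv_measurable_wrt.
- by move=> k; have [] := noise_moments k.
- by rewrite /= inE ii'.
Qed.

Lemma um_second_moment m m' : Rintegrable (fun t => um m t * um m' t) /\
  Ex (fun t => um m t * um m' t) = uv m *+ (m == m').
Proof.
have sq m1 : Rintegrable (fun t => um m1 t ^+ 2).
  by case: m1 => k; [have [] := weight_moments k|have [] := noise_moments k].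
have mu m1 : measurable_fun setT (um m1) by case: m1 => k; exact: mRV.
split; first exact: Rintegrable_mul.
have fin (f g : T -> R) a : (\int[P]_t (f t * g t)%:E)%E = a%:E -> Ex (fun t => f t * g t) = a.
  by rewrite /Ex /Rintegral => ->.
case: m m' => k [] k' /=.
- apply: fin; rewrite -centred_covariance; last 2 first.
  + exact: weight_mean Msetting k.
  + exact: weight_mean Msetting k'.
  by rewrite (weight_covariance Msetting).
- have [iw _ Ew _] := weight_moments k; have [ie _ Ee _] := noise_moments k'.
  have [|_ ->] := independent2_integrable_mul (gen_m (J := [set b1])) (gen_m (J := [set b2])) _
    (w_wrt k (finset.set11 b1)) (e_wrt k' (finset.set11 b2)) iw ie.
    by apply: gen_indep => i; rewrite !inE => /eqP->.
  by rewrite Ew mul0r mulr0n.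
- have [iw _ Ew _] := weight_moments k'; have [ie _ Ee _] := noise_moments k.
  have [|_ ->] := independent2_integrable_mul (gen_m (J := [set b2])) (gen_m (J := [set b1])) _
    (e_wrt k (finset.set11 b2)) (w_wrt k' (finset.set11 b1)) ie iw.
    by apply: gen_indep => i; rewrite !inE => /eqP->.
  by rewrite Ee mul0r mulr0n.
- have -> : (inr k == inr k' :> 'I_p + 'I_n) = (k == k') by [].
  have [<-|kk'] := eqVneq k k'; last by rewrite noise_second_moment.
  have [_ _ _] := noise_moments k; by under eq_Ex do rewrite expr2.
Qed.

(** The prediction error is [\sum_s Cs s * Qs s], where [Cs] depends on the features and [Qs]
    on the other blocks.  A left index pairs a coordinate of the test point with a weight
    or a noise variable; the right index is the test noise. *)
Let St : finType := ('I_p * ('I_p + 'I_n) + 'I_1)%type.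
Let Cf t j (m : 'I_p + 'I_n) : R :=
  match m with inl k => (l *: Q t) j k | inr i => - (n%:R^-1 *: (Q t *m (X t)^T)) j i end.
Let Cs (s : St) t : R := if s is inl jm then Cf t jm.1 jm.2 else 1.
Let Qs (s : St) t : R := if s is inl jm then test_x M jm.1 t * um jm.2 t else test_noise M t.

Lemma sq_error_expansion t : sq_error M l t = (\sum_s Cs s t * Qs s t) ^+ 2.
Proof.
rewrite /sq_error; congr (_ ^+ 2).
have -> : y0 M t - (x0 M t *m ridge (Xmx M t) (Yvec M t) l) 0 0 =
    (x0 M t *m (wvec M t - ridge (Xmx M t) (Yvec M t) l)) 0 0 + test_noise M t.
  rewrite mulmxBr /y0; set u := x0 M t *m wvec M t; set u' := x0 M t *m _.
  by rewrite [in RHS]mxE [(- u') 0 0]mxE addrAC.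
rewrite /Yvec ridge_error// -/(X t) -/(Q t) big_sumType /= big_ord1 mul1r; congr (_ + _).
rewrite -(pair_bigA _ (fun j m => Cf t j m * (test_x M j t * um m t))) /= mxE.
have mxB (A B : 'cV[R]_p) j k : (A - B) j k = A j k - B j k by rewrite !mxE.
apply: eq_bigr => j _; rewrite big_sumType /= /x0 [in LHS]mxE mxB mulrBr -mulrN; congr (_ + _).
  rewrite [in LHS]mxE mulr_sumr; apply: eq_bigr => k _; rewrite [wvec M t _ _]mxE; ring.
rewrite [in LHS]mxE -sumrN mulr_sumr; apply: eq_bigr => k _; rewrite [(\col_i _) _ _]mxE; ring.
Qed.

Let Gx := \bigcup_(ij : 'I_n * 'I_p) sigma_rv (fun t => Xmx M t ij.1 ij.2).

Let Gx_measurable : Gx `<=` measurable.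
Proof. by move=> A [ij _]; apply: sigma_rv_measurable; exact: measurable_Xmx. Qed.

Let J' : {set 'I_5} := [set~ b0].

Let Gx_indep : independent2 P Gx (gen J').
Proof.
have h : independent2 P (gen [set b0]) (gen J').
  by apply: gen_indep => i; rewrite !inE => /eqP ->; rewrite eqxx.
move=> A B sA sB; apply: h => //; apply: sub_sigma_algebra.
by exists b0 => //=; rewrite inE.
Qed.

Let Cs_wrt s : measurable_wrt Gx (Cs s).
Proof.
have mX : @measurable_mx _ _ (g_sigma_algebraType Gx) _ _ X.
  move=> i j _ B mB; rewrite setTI; apply: sub_sigma_algebra; exists (i, j) => //.
  by exists B => //; rewrite setTI.
have mQ : @measurable_mx _ _ (g_sigma_algebraType Gx) _ _ Q.
  apply: measurable_resolvent => // [t|]; first exact: sample_cov_psd.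
  apply: measurable_mxZ; first exact: measurable_cst.
  by apply: measurable_mxM => //; exact: measurable_mx_tr.
move: s => -[[j [k|i]]|a]; last exact: measurable_cst.
  apply: (@measurable_mxZ _ _ (g_sigma_algebraType Gx) _ _ (fun=> l)) => //.
apply: (@measurable_ext _ _ (g_sigma_algebraType Gx) _
  (fun t => - (n%:R^-1 *: (Q t *m (X t)^T)) j i)) => //.
apply: measurableT_comp => //.
apply: (@measurable_mxZ _ _ (g_sigma_algebraType Gx) _ _ (fun=> n%:R^-1)) => //.
by apply: measurable_mxM => //; exact: measurable_mx_tr.
Qed.

Let Cs_bounded s t : `|Cs s t| <= 2 + (n%:R * l)^-1.
Proof.
have nl0 : 0 <= (n%:R * l)^-1 by rewrite invr_ge0 mulr_ge0 ?ler0n// ltW.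
have hp := sample_cov_psd (X t).
case: s => [[j [k|i]]|_] /=; last by rewrite normr1; lra.
  have := opbound_entry j k (opboundZ l (resolvent_bound hp l0)).
  by rewrite (ger0_norm (ltW l0)) divff ?gt_eqF// -/(Q t); lra.
have := opbound_entry i j (noise_opbound (X t) n0 l0).
have -> : n%:R^-1 *: (X t *m resolvent (sample_cov (X t)) l) = (n%:R^-1 *: (Q t *m (X t)^T))^T.
  by rewrite linearZ /= trmx_mul trmxK /Q resolvent_sym.
by rewrite mxE normrN; lra.
Qed.

Let Qs_moments s s' : measurable_wrt (gen J') (fun t => Qs s t * Qs s' t) /\
  (Rintegrable (fun t => Qs s t * Qs s' t) /\
   Ex (fun t => Qs s t * Qs s' t) =
   match s, s' with
   | inl u, inl u' => Sg u.1 u'.1 * (uv u.2 *+ (u.2 == u'.2))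
   | inr _, inr _ => 1
   | _, _ => 0 end).
Proof.
have bJ b : b != b0 -> b \in J' by rewrite !inE.
have mu (J : {set 'I_5}) m : b1 \in J -> b2 \in J -> measurable_wrt (gen J) (um m) := @um_wrt J m.
have m1 s1 : measurable_wrt (gen J') (Qs s1).
  case: s1 => [[j m]|a]; last by apply: e0_wrt; exact: bJ.
  by apply: measurable_funM; [apply: x_wrt|apply: mu]; exact: bJ.
split; first exact: (measurable_funM (m1 s) (m1 s')).
have i34 : independent2 P (gen [set b3]) (gen [set b1; b2]%SET).
  by apply: gen_indep => i; rewrite !inE => /eqP ->.
have i4 : independent2 P (gen [set b4]) (gen [set b1; b2; b3]%SET).
  by apply: gen_indep => i; rewrite !inE => /eqP ->.
have b3i : b3 \in [set b3]%SET by rewrite inE.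
have b4i : b4 \in [set b4]%SET by rewrite inE.
have b1i : b1 \in [set b1; b2]%SET by rewrite !inE.
have b2i : b2 \in [set b1; b2]%SET by rewrite !inE.
have b1j : b1 \in [set b1; b2; b3]%SET by rewrite !inE.
have b2j : b2 \in [set b1; b2; b3]%SET by rewrite !inE.
have b3j : b3 \in [set b1; b2; b3]%SET by rewrite !inE.
have x1 j : Rintegrable (test_x M j).
  by apply: Rintegrable_sq; [exact: mRV|have [] := test_second_moment j j].
have u1 m : Rintegrable (um m).
  by case: m => k; [have [] := weight_moments k|have [] := noise_moments k].
have xu j m : Rintegrable (fun t => test_x M j t * um m t).
  exact: (independent2_integrable_mul (gen_m (J := _)) (gen_m (J := _)) i34 (x_wrt j b3i)
    (mu _ m b1i b2i) (x1 j) (u1 m)).1.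
have [e1 e2 Ee Ee2] := test_noise_moments.
have cross j m : Rintegrable (fun t => test_noise M t * (test_x M j t * um m t)) /\
    Ex (fun t => test_noise M t * (test_x M j t * um m t)) = 0.
  have [|h1 h2] := independent2_integrable_mul (gen_m (J := _)) (gen_m (J := _)) i4 (e0_wrt b4i)
    (_ : measurable_wrt _ (fun t => test_x M j t * um m t)) e1 (xu j m).
    by apply: measurable_funM; [apply: x_wrt|apply: mu].
  by split=> //; rewrite h2 Ee mul0r.
case: s s' => [[j m]|a] [[j' m']|a'] /=; last 1 first.
- by split; [exact: e2|exact: Ee2].
- have [ix Exx] := test_second_moment j j'; have [iu Euu] := um_second_moment m m'.
  have [||h1 h2] := independent2_integrable_mul (gen_m (J := _)) (gen_m (J := _)) i34
    (_ : measurable_wrt _ (fun t => test_x M j t * test_x M j' t))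
    (_ : measurable_wrt _ (fun t => um m t * um m' t)) ix iu.
  + by apply: measurable_funM; apply: x_wrt.
  + by apply: measurable_funM; apply: mu.
  rewrite -Exx -Euu -h2.
  have E t : test_x M j t * test_x M j' t * (um m t * um m' t) =
    test_x M j t * um m t * (test_x M j' t * um m' t) by ring.
  by split; [exact: (eq_Rintegrable E)|apply: eq_Ex => t; rewrite E].
- have [h1 h2] := cross j m; split; last by rewrite -[RHS]h2; apply: eq_Ex => t; rewrite mulrC.
  by apply: (eq_Rintegrable _ h1) => t; rewrite mulrC.
- exact: cross.
Qed.

(** Only pairs with the same weight or noise index survive.  Their coefficients assemble
    into two Gram matrices, paired with the covariance of the test point. *)
Lemma moment_sum t :
  \sum_s \sum_s' Cs s t * Cs s' t * Ex (fun u => Qs s u * Qs s' u) =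
  1 + alpha ^+ 2 / p%:R * l ^+ 2 * \tr (Sg *m (Q t *m Q t)) +
  n%:R^-1 * (\tr (Sg *m Q t) - l * \tr (Sg *m (Q t *m Q t))).
Proof.
have hp := sample_cov_psd (X t).
have QT : (Q t)^T = Q t by exact: resolvent_sym.
pose N := (alpha ^+ 2 / p%:R) *: ((l *: Q t) *m (l *: Q t)^T) +
  (n%:R^-1 *: (Q t *m (X t)^T)) *m (n%:R^-1 *: (Q t *m (X t)^T))^T.
transitivity (1 + \sum_j \sum_j' Sg j j' * N j j').
  rewrite big_sumType /= big_ord1 addrC big_sumType /= big_ord1 big1 => [|s _]; last first.
    by rewrite (Qs_moments (inr ord0) (inl s)).2.2; case: s => j m; rewrite mulr0.
  rewrite add0r (Qs_moments (inr ord0) (inr ord0)).2.2 !mulr1; congr (1 + _).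
  rewrite -(pair_bigA _ (fun j m => \sum_(s' : St) Cs (inl (j, m)) t * Cs s' t *
    Ex (fun u => Qs (inl (j, m)) u * Qs s' u))) /=; apply: eq_bigr => j _.
  under eq_bigr => m _.
    rewrite big_sumType /= big_ord1 (Qs_moments (inl (j, m)) (inr ord0)).2.2 mulr0 addr0.
    rewrite -(pair_bigA _ (fun j' m' => Cf t j m * Cf t j' m' *
      Ex (fun u => Qs (inl (j, m)) u * Qs (inl (j', m')) u))) /=.
    under eq_bigr => j' _.
      under eq_bigr => m' _ do rewrite (Qs_moments (inl (j, m)) (inl (j', m'))).2.2.
      rewrite (bigD1 m)//= eqxx big1 ?addr0 => [|m' mm']; last first.
        by rewrite eq_sym (negbTE mm') !mulr0.
      over.
    over.
  rewrite exchange_big /=; apply: eq_bigr => j' _.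
  rewrite big_sumType /= /N [in RHS]mxE mulrDr; congr (_ + _).
    rewrite [in RHS]mxE [in RHS]mxE !mulr_sumr; apply: eq_bigr => k _.
    by rewrite [(l *: Q t)^T _ _]mxE mulr1n; ring.
  rewrite [in RHS]mxE mulr_sumr; apply: eq_bigr => k _.
  by rewrite [(n%:R^-1 *: _)^T _ _]mxE mulr1n; ring.
have NT : N^T = N by rewrite /N linearD /= linearZ /= !trmx_mul !trmxK.
have -> : \sum_j \sum_j' Sg j j' * N j j' = \tr (Sg *m N).
  apply: eq_bigr => j _; rewrite mxE; apply: eq_bigr => j' _.
  by rewrite -[in LHS]NT mxE.
have -> : N = (alpha ^+ 2 / p%:R * l ^+ 2) *: (Q t *m Q t) +
    n%:R^-1 *: (Q t - l *: (Q t *m Q t)).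
  rewrite /N noise_gram// -/(Q t) [(l *: Q t)^T]linearZ /= QT -scalemxAl -scalemxAr !scalerA.
  by congr (_ *: _ + _); ring.
rewrite mulmxDr -!scalemxAr mulmxBr -scalemxAr !(mxtraceD, mxtraceZ) -addrA.
by rewrite -[- (l *: _)]scaleN1r !mxtraceZ mulN1r addrA.
Qed.

Lemma predictive_risk_formula r : is_predictive_risk M l r ->
  {ae P, forall t, r t =
    1 + alpha ^+ 2 / p%:R * l ^+ 2 * \tr (Sg *m (Q t *m Q t)) +
    n%:R^-1 * (\tr (Sg *m Q t) - l * \tr (Sg *m (Q t *m Q t)))}.
Proof.
move=> hr; apply: (cond_expectation_unique Gx_measurable hr).
have := conditional_quadratic Gx_measurable (gen_m (J := J')) Gx_indep Cs_wrt Cs_bounded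
  (fun s s' => (Qs_moments s s').1) (fun s s' => (Qs_moments s s').2.1).
rewrite (_ : (fun t => (\sum_s Cs s t * Qs s t) ^+ 2) = sq_error M l); last first.
  by apply/funext => t; rewrite sq_error_expansion.
rewrite (_ : (fun t => \sum_s \sum_s' _) = fun t => 1 + alpha ^+ 2 / p%:R * l ^+ 2 *
  \tr (Sg *m (Q t *m Q t)) + n%:R^-1 * (\tr (Sg *m Q t) - l * \tr (Sg *m (Q t *m Q t)))) //.
by apply/funext => t; exact: moment_sum.
Qed.

End PredictiveRisk.

(** * Almost sure limits *)

Section AlmostSure.
Context {R : realType} {d} {T : measurableType d} (P : probability T R).
Local Notation Rintegrable := (Rintegrable P).
Local Notation Ex := (Ex P).

Lemma ae_witness (A : T -> Prop) : {ae P, forall t, A t} -> exists t, A t.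
Proof.
move=> [N [mN N0 AN]]; apply: contrapT => h.
have NT : N = setT by apply/seteqP; split=> // t _; apply: AN => At; apply: h; exists t.
by move: N0; rewrite NT probability_setT => /eqP; rewrite onee_eq0.
Qed.

(** The sum of the series has finite mean, so it is finite almost everywhere and its terms
    tend to zero. *)
Lemma ae_cvg0_of_summable (f : nat -> T -> R) (B : R) : (forall k t, 0 <= f k t) ->
  (forall k, Rintegrable (f k)) -> (forall m, \sum_(k < m) Ex (f k) <= B) ->
  {ae P, forall t, f k t @[k --> \oo] --> (0 : R)}.
Proof.
move=> f0 fi fB.
have mf k : measurable_fun setT (EFin \o f k).
  by apply/measurable_EFinP; exact: Rintegrable_measurable (fi k).
pose F t : \bar R := (\sum_(k <oo) (f k t)%:E)%E.
have F0 t : (0 <= F t)%E by apply: nneseries_ge0 => k k0 kP; rewrite lee_fin.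
have mF : measurable_fun setT F.
  apply: (ge0_emeasurable_sum (P := predT)) => [k t tT kP|k kP]; last exact: mf.
  by rewrite lee_fin.
have IF : (\int[P]_t F t <= B%:E)%E.
  rewrite (integral_nneseries P measurableT mf); last by move=> *; rewrite lee_fin.
  apply: lime_le.
    by apply: is_cvg_nneseries => *; apply: integral_ge0 => *; rewrite lee_fin.
  apply: nearW => m; rewrite (eq_bigr (fun k => (Ex (f k))%:E)) ; last first.
    by move=> *; rewrite -Ex_fin.
  by rewrite sumEFin lee_fin big_mkord.
have iF : P.-integrable setT F.
  apply/integrableP; split=> //.
  under eq_integral => t _ do rewrite gee0_abs//.
  exact: le_lt_trans IF (ltry _).
have := integrable_ae measurableT iF; apply: filterS => t /(_ Logic.I) Ft.
apply: cvg_series_cvg_0; apply: nondecreasing_is_cvgn.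
  by apply/nondecreasing_seqP => k; rewrite seriesEnat /= big_nat_recr//= lerDl.
exists (fine (F t)) => _ [m _ <-].
rewrite -lee_fin fineK// seriesEnat /= -sumEFin.
by apply: nneseries_lim_ge => k k0 kP; rewrite lee_fin.
Qed.

Lemma sum_inv_squares_le2 m : \sum_(k < m) (k.+1%:R ^- 2 : R) <= 2.
Proof.
suff : \sum_(k < m) (k.+1%:R ^- 2 : R) <= 2 - m%:R^-1.
  by move/le_trans; apply; rewrite gerBl invr_ge0 ler0n.
elim: m => [|m IH]; first by rewrite big_ord0 invr0 subr0.
rewrite big_ord_recr /=; case: m IH => [_|m IH].
  by rewrite big_ord0 add0r expr1n invr1; lra.
apply: le_trans (lerD IH (lexx _)) _.
have m1 : 0 < m.+1%:R :> R by rewrite ltr0n.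
have e : m.+2%:R = m.+1%:R + 1 :> R by rewrite -natr1.
rewrite e; set x := m.+1%:R : R in m1 *.
rewrite -subr_ge0 (_ : _ - _ = x^-1 * (x + 1) ^- 2).
  by rewrite mulr_ge0// invr_ge0 ?exprn_ge0 ?addr_ge0// ltW.
by field; rewrite !gt_eqF//; lra.
Qed.

Lemma cvg_inv_nat : (n%:R^-1 : R) @[n --> \oo] --> (0 : R).
Proof. by rewrite -(cvg_shiftS (fun n => n%:R^-1 : R)); exact: cvg_harmonic. Qed.

(** First [n] tends to infinity, then [delta] to zero. *)
Lemma cvg0_of_bound (u : nat -> R) (A : R) (B : R -> R) : 0 <= A ->
  (forall delta, 0 < delta -> \forall n \near \oo, `|u n| <= delta * A + B delta / n%:R) ->
  u n @[n --> \oo] --> (0 : R).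
Proof.
move=> A0 uB; apply/cvgr0Pnorm_le => e e0.
pose delta := e / (2 * (A + 1)).
have A1 : 0 < A + 1 by lra.
have d0 : 0 < delta by rewrite divr_gt0// mulr_gt0.
have dA : delta * A <= e / 2.
  rewrite (_ : e / 2 = delta * (A + 1)); first by rewrite ler_wpM2l ?ltW//; lra.
  by rewrite /delta; field; rewrite gt_eqF.
have Bn : B delta / n%:R @[n --> \oo] --> (0 : R).
  by rewrite -(mulr0 (B delta)); apply: cvgM; [exact: cvg_cst|exact: cvg_inv_nat].
have e2 : 0 < e / 2 by lra.
near=> n.
have h1 : `|u n| <= delta * A + B delta / n%:R by near: n; exact: uB.
have h2 : B delta / n%:R < e / 2 by near: n; exact: (cvgr_lt 0 Bn).
lra.
Unshelve. all: by end_near. Qed.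

Lemma near_cvg (f g : nat -> R) (l : R) : f n @[n --> \oo] --> l ->
  (\forall n \near \oo, g n = f n) -> g n @[n --> \oo] --> l.
Proof.
move=> fl gf; apply: cvg_trans fl; apply: near_eq_cvg.
by apply: filterS gf => n ->.
Qed.

(** Exchange of the limits in [k] and [n], valid because [h k] bounds the error for all
    large [n]. *)
Lemma cvg_of_approximations (u : nat -> R) (a : nat -> nat -> R) (b h : nat -> R) (g : R) :
  h k @[k --> \oo] --> (0 : R) -> b k @[k --> \oo] --> g ->
  (forall k, a k n @[n --> \oo] --> b k) ->
  (forall k, \forall n \near \oo, `|u n - a k n| <= h k) -> u n @[n --> \oo] --> g.
Proof.
move=> h0 bg ab ua; apply/cvgrPdist_le => e e0.
have e3 : 0 < e / 3 by lra.
have /cvgrPdist_le bg' := bg.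
have [k [hk bk]] : exists k, `|h k| <= e / 3 /\ `|g - b k| <= e / 3.
  have : \forall k \near \oo, `|h k| <= e / 3 /\ `|g - b k| <= e / 3.
    by near=> k; split; near: k; [exact: (cvgr0_norm_le _ h0)|exact: bg'].
  by move=> [N _ hN]; exists N; apply: (hN N) => /=; exact: leqnn.
near=> n.
have h1 : `|u n - a k n| <= h k by near: n; exact: ua.
have h2 : `|b k - a k n| <= e / 3 by near: n; have /cvgrPdist_le := ab k; exact.
rewrite (_ : g - u n = (g - b k) + (b k - a k n) - (u n - a k n)); last by ring.
apply: le_trans (ler_normB _ _) _; apply: le_trans (lerD (ler_normD _ _) (lexx _)) _.
by have := ler_norm (h k); lra.
Unshelve. all: by end_near. Qed.

End AlmostSure.

Lemma silverstein_equation {R : realType} (gamma l : R) (H F : probability (measurableTypeR R) R) :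
  0 < gamma -> H [set t | 0 <= t] = 1%E -> marchenko_pastur gamma H F -> 0 < l ->
  let v := companion_real F gamma in
  1 = l * v l + gamma * Ex H (fun t : R => t * v l / (1 + t * v l)).
Proof.
move=> gamma0 H0 MP l0 v; have v0 : 0 < v l := companion_real_gt0 gamma0 H0 MP l0.
have := silverstein_real MP l0; rewrite -/(v l) => e.
have : v l * (v l)^-1 = 1 by rewrite divff// gt_eqF.
rewrite e mulrDr [v l * l]mulrC mulrCA => {1}<-; congr (_ + _ * _).
have mE := @measurable_ge0_set R.
have mf : measurable_fun [set: measurableTypeR R] (fun t : R => t / (1 + t * v l)).
  apply: measurable_funM => //; apply: (measurableT_comp measurable_inv).
  by apply: measurable_funD => //; apply: measurable_funM.
rewrite -ExZl; first by apply: eq_Ex => t; rewrite mulrCA mulrA.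
apply: (@Rintegrable_on _ _ (measurableTypeR R) H _ mE H0 _ (v l)^-1 mf) => t /= t0.
have tv : 0 < 1 + t * v l by rewrite ltr_wpDr// mulr_ge0// ltW.
rewrite ger0_norm; last by rewrite divr_ge0// ltW.
by rewrite ler_pdivrMr// mulrDr mulr1 mulrCA mulVf ?gt_eqF// mulr1 lerDr invr_ge0 ltW.
Qed.

(** Minus the derivative of [l |-> (l * v l)^-1]; the slope of [v] enters with a minus sign
    because it is a derivative in [z = - l]. *)
Definition risk_slope {R : realType} (F : probability (measurableTypeR R) R) (gamma l : R) : R :=
  let v := companion_real F gamma l in
  (l ^+ 2 * v)^-1 * (1 - l * companion_slope F l gamma / v).

Lemma risk_slope_limit {R : realType} (F : probability (measurableTypeR R) R) (gamma l : R)
    (h : nat -> R) :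
  let v := companion_real F gamma in
  F [set t | 0 <= t] = 1%E -> 0 < l -> (forall l, 0 < l -> 0 < v l) ->
  (forall k, 0 < h k <= l / 2) -> h k @[k --> \oo] --> (0 : R) ->
  ((l * v l)^-1 - ((l + h k) * v (l + h k))^-1) / h k @[k --> \oo] --> risk_slope F gamma l.
Proof.
move=> v F0 l0 v_gt0 hb h0.
pose q k := (v (l + h k) - v l) / h k.
have hk k : 0 < h k by case/andP: (hb k).
have qs : q k @[k --> \oo] --> - companion_slope F l gamma.
  pose K := (2 * `|gamma| + `|1 - gamma|) * (2 / l ^+ 3).
  have hK : h k * K @[k --> \oo] --> (0 : R).
    by rewrite -(mul0r K); apply: cvgM => //; exact: cvg_cst.
  apply/subr_cvg0/cvgr0Pnorm_le => e e0; near=> k.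
  rewrite opprK; apply: (@le_trans _ _ `|h k * K|).
    apply: le_trans (ler_norm _); rewrite -(gtr0_norm (hk k)).
    apply: companion_real_increment => //; first by rewrite gt_eqF.
    by rewrite gtr0_norm//; case/andP: (hb k).
  by near: k; exact: (cvgr0_norm_le _ hK).
have vE k : v (l + h k) = v l + h k * q k.
  by rewrite /q mulrCA divff ?gt_eqF// mulr1 [RHS]addrC subrK.
have v0 := v_gt0 l l0.
have wl : v (l + h k) @[k --> \oo] --> v l.
  rewrite (funext vE) -(addr0 (v l)) -(mul0r (- companion_slope F l gamma)).
  by apply: cvgD; [rewrite mul0r addr0; exact: cvg_cst|exact: cvgM].
have lh : l + h k @[k --> \oo] --> l.
  by have := cvgD (cvg_cst l) h0; rewrite addr0; apply.
have -> : risk_slope F gamma l =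
    (v l + l * (- companion_slope F l gamma)) / (l * v l * (l * v l)).
  by rewrite /risk_slope -/(v l); field; rewrite !gt_eqF.
rewrite (_ : (fun k => _) = fun k => (v (l + h k) + l * q k) /
    (l * v l * ((l + h k) * v (l + h k)))).
  apply: cvgM; first by apply: cvgD => //; apply: cvgM => //; exact: cvg_cst.
  apply: cvgV; first by rewrite !mulf_neq0 ?gt_eqF.
  by apply: cvgM; [exact: cvg_cst|exact: cvgM].
apply/funext => k; have lhk : 0 < l + h k by rewrite addr_gt0.
have vk := v_gt0 _ lhk.
by rewrite /q; field; rewrite !gt_eqF.
Unshelve. all: by end_near. Qed.

(** * Traces along the sequence of problems *)

Section RidgeSequence.
Context {R : realType} {d} {T : measurableType d} (P : probability T R).
Context (p : nat -> nat) (gamma alpha C : R) (H F : probability (measurableTypeR R) R)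
  (M : forall n, ridge_problem P n (p n)).
Hypothesis p_infty : p n @[n --> \oo] --> \oo.
Hypothesis p_ratio : (p n)%:R / n%:R @[n --> \oo] --> gamma.
Hypothesis gamma0 : 0 < gamma.
Hypothesis M_setting : forall n, ridge_setting (M n) alpha.
Hypothesis H0 : H [set t | 0 <= t] = 1%E.
Hypothesis Sigma_H : weakly_converges (fun n => spectral_cdf (Sigma (M n))) H.
Hypothesis MP : marchenko_pastur gamma H F.
Hypothesis Sigma_C : forall n, opnorm (Sigma (M n)) <= C.
Hypothesis Z_moment : forall n i j, ('E_P[fun t => (Z (M n) i j t ^+ 12)%R] < C%:E)%E.
Local Notation Rintegrable := (Rintegrable P).
Local Notation Ex := (Ex P).

Let S n := sqrtSigma (M n).
Let Sg n := Sigma (M n).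
Let v := companion_real F gamma.

Let mZ n i j : measurable_fun setT (Z (M n) i j). Proof. exact: measurable_funPT. Qed.

Lemma Z_moments n i j : [/\ Ex (Z (M n) i j) = 0, Ex (fun t => Z (M n) i j t ^+ 2) = 1,
  Rintegrable (fun t => Z (M n) i j t ^+ 4) & Ex (fun t => Z (M n) i j t ^+ 4) <= 1 + `|C|].
Proof.
have [_ _ E1 E2] := centred_moments (mZ i j) (Z_mean (M_setting n) i j) (Z_variance (M_setting n) i j).
have m12 : measurable_fun setT (fun t => Z (M n) i j t ^+ 12) by exact: measurable_funX.
have p12 t : 0 <= Z (M n) i j t ^+ 12 by rewrite exprn_even_ge0.
have := Z_moment i j; rewrite expectation.unlock => lt12.
have i12 : Rintegrable (fun t => Z (M n) i j t ^+ 12).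
  apply/integrableP; split; first exact/measurable_EFinP.
  under eq_integral => t _ do rewrite /= ger0_norm//.
  exact: lt_trans lt12 (ltry _).
have h t : Z (M n) i j t ^+ 4 <= 1 + Z (M n) i j t ^+ 12.
  rewrite (_ : 12 = 4 * 3)%N// exprM; set y := _ ^+ 4.
  have y0 : 0 <= y by rewrite exprn_even_ge0.
  have [y1|y1] := lerP y 1; first by have := exprn_ge0 3 y0; lra.
  by have : y <= y ^+ 3 by [rewrite -[leLHS]expr1 ler_eXn2l]; lra.
have i1 : Rintegrable (fun t => 1 + Z (M n) i j t ^+ 12) by exact: RintegrableD (Rintegrable_cst _ _) i12.
have i4 : Rintegrable (fun t => Z (M n) i j t ^+ 4).
  apply: (Rintegrable_le _ _ i1) => [|t]; first exact: measurable_funX.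
  by rewrite ger0_norm// exprn_even_ge0.
split=> //; apply: le_trans (Ex_le i4 i1 h) _.
rewrite ExD//; last exact: Rintegrable_cst.
rewrite Ex_cst lerD2l; apply: le_trans (ler_norm C); rewrite -lee_fin -Ex_fin//.
exact: ltW.
Qed.

Let c0 := Num.sqrt `|C|.

Lemma Sigma_quad n u : dot u (Sg n *m u) <= `|C| * sqn u.
Proof.
have hb : opbound `|C| (Sg n).
  split=> // w; rewrite real_normK ?num_real//; exact: opnorm_sq.
exact: le_trans (ler_norm _) (opbound_quad u hb).
Qed.

Lemma sqrt_sym n : (S n)^T = S n. Proof. by have [[]] := sqrtSigmaP (M_setting n). Qed.

Lemma sqrt_sq n : S n *m S n = Sg n. Proof. by have [] := sqrtSigmaP (M_setting n). Qed.

Lemma sqrt_bound n : opbound c0 (S n).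
Proof.
split=> [|u]; first exact: sqrtr_ge0.
by rewrite sqr_sqrtr// dot_mull sqrt_sym mulmxA sqrt_sq Sigma_quad.
Qed.

Let rho := gamma + 1.

Lemma p_le_rho : \forall n \near \oo, (0 < n)%N /\ ((p n)%:R <= rho * n%:R).
Proof.
have g1 : gamma < rho by rewrite ltrDl.
near=> n.
have n0 : (0 < n)%N by near: n; exists 1%N.
split=> //; rewrite -ler_pdivrMr ?ltr0n//; apply: ltW; near: n.
exact: (cvgr_lt gamma p_ratio rho g1).
Unshelve. all: by end_near. Qed.

Lemma p_pos : \forall n \near \oo, (0 < n)%N /\ (0 < p n)%N.
Proof.
near=> n; split; near: n; first by exists 1%N.
by have /cvgnyPgt/(_ 0%N) := p_infty.
Unshelve. all: by end_near. Qed.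

Definition ridge_trace n (l : R) (t : T) : R :=
  n%:R^-1 * \tr (Sg n *m resolvent (sample_cov (Xmx (M n) t)) l).

Definition ridge_trace2 n (l : R) (t : T) : R :=
  n%:R^-1 * \tr (Sg n *m (resolvent (sample_cov (Xmx (M n) t)) l *m
                           resolvent (sample_cov (Xmx (M n) t)) l)).

Let v_gt0 l : 0 < l -> 0 < v l.
Proof. by move=> l0; exact: companion_real_gt0 gamma0 H0 MP l0. Qed.

Let C0 : 0 <= `|C| := normr_ge0 C.
Let c0c0 : c0 * c0 = `|C|. Proof. by rewrite -expr2 sqr_sqrtr. Qed.

Lemma ridge_trace_ge0 n l t : (0 < n)%N -> 0 < l -> 0 <= ridge_trace n l t.
Proof. by move=> n0 l0; exact: (tau_of_ge0 n0 (@sqrt_sym n) l0 (@sqrt_sq n)). Qed.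

Lemma ridge_trace_mean_ge0 n l : 0 < l -> 0 <= Ex (ridge_trace n l).
Proof.
move=> l0; apply: Ex_ge0 => t; case: n => [|n]; last exact: ridge_trace_ge0.
by rewrite /ridge_trace invr0 mul0r.
Qed.

Lemma ridge_trace_mean_limit l : 0 < l -> 1 + Ex (ridge_trace n l) @[n --> \oo] --> (l * v l)^-1.
Proof.
move=> l0.
have Sg_psd n : psd (Sg n) by exact: Sigma_psd (M_setting n).
apply: (fixed_point_limit p_infty p_ratio Sg_psd Sigma_quad H0 Sigma_H l0 (v_gt0 l0)
  (silverstein_equation gamma0 H0 MP l0)); first by move=> n; exact: ridge_trace_mean_ge0.
pose K1 := c0 * c0 * (l^-1 * (c0 * c0)) / l.
pose k := 1 + `|C|.
have r0 : 0 <= rho by rewrite addr_ge0 ?ltW.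
apply: (@cvg0_of_bound _ _ ((2 * k * rho + rho ^+ 2) * K1 ^+ 2)
  (fun delta => K1 + 3 / (2 * delta) * ((2 * k * rho + 5) * (c0 * c0 / l) ^+ 2))).
  by rewrite mulr_ge0 ?sqr_ge0// addr_ge0 ?sqr_ge0// !mulr_ge0// addr_ge0.
move=> delta d0; near=> n.
have [n0 pn] : (0 < n)%N /\ ((p n)%:R <= rho * n%:R) by near: n; exact: p_le_rho.
have k1 : 1 <= k by rewrite lerDl.
apply: le_trans (taubar_fixed_point n0 (@mZ n) (Z_independent (M_setting n)) k1 _ _ _ _
  (@sqrt_sym n) (@sqrt_bound n) l0 pn (@sqrt_sq n) d0) _.
1-4: by move=> i j; have [] := Z_moments i j.
by rewrite -/K1 le_eqVlt mulrDl; apply/orP; left; apply/eqP; ring.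
Unshelve. all: by end_near. Qed.

Lemma ridge_trace_concentrates l : 0 < l ->
  {ae P, forall t, (ridge_trace n l t - Ex (ridge_trace n l)) ^+ 4 @[n --> \oo] --> (0 : R)}.
Proof.
move=> l0; pose K := 11 * (2 * (c0 * c0 / l)) ^+ 4.
pose f k t := (ridge_trace k.+1 l t - Ex (ridge_trace k.+1 l)) ^+ 4.
have f0 k t : 0 <= f k t by rewrite exprn_even_ge0.
have fi k : Rintegrable (f k).
  have mt : measurable_fun setT (ridge_trace k.+1 l).
    apply: (Rintegrable_measurable (P := P)).
    exact: (tau_int P (ltn0Sn k) (@mZ k.+1) (@sqrt_bound k.+1) l0 (@sqrt_sq k.+1)).
  pose B := (k.+1%:R^-1 * ((p k.+1)%:R * (c0 * c0 / l))) : R.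
  have tb t : `|ridge_trace k.+1 l t| <= B.
    exact: (tau_of_bounded (ltn0Sn k) (@sqrt_bound k.+1) l0 (@sqrt_sq k.+1)).
  have eb : `|Ex (ridge_trace k.+1 l)| <= B.
    by apply: Ex_bounded => //; apply: (@Rintegrable_bounded _ _ _ _ _ B).
  apply: (@Rintegrable_bounded _ _ _ _ _ ((B + B) ^+ 4)) => [|t].
    by apply: measurable_funX; apply: measurable_funB => //; exact: measurable_cst.
  rewrite normrX ler_pXn2r ?nnegrE ?normr_ge0//; last first.
    by rewrite addr_ge0// (le_trans (normr_ge0 _) eb).
  by apply: le_trans (ler_normB _ _) _; exact: lerD.
have fK k : Ex (f k) <= K * k.+1%:R ^- 2.
  apply: le_trans (tau_concentration (ltn0Sn k) (@mZ k.+1) (Z_independent (M_setting k.+1))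
    (@sqrt_sym k.+1) (@sqrt_bound k.+1) l0 (@sqrt_sq k.+1)).2 _.
  have : k.+1%:R != 0 :> R by rewrite pnatr_eq0.
  rewrite /K le_eqVlt; move: (k.+1%:R : R) => x x0; apply/orP; left; apply/eqP.
  by move: (2 * _) => y; field.
have := @ae_cvg0_of_summable _ _ _ P f (K * 2) f0 fi.
have h m : \sum_(k < m) Ex (f k) <= K * 2.
  apply: (@le_trans _ _ (\sum_(k < m) (K * k.+1%:R ^- 2))); first by apply: ler_sum => k _.
  by rewrite -mulr_sumr ler_wpM2l ?sum_inv_squares_le2// mulr_ge0// exprn_even_ge0.
move=> /(_ h); apply: filterS => t ft.
by rewrite -(cvg_shiftS (fun n => (ridge_trace n l t - Ex (ridge_trace n l)) ^+ 4)).
Qed.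

Lemma ridge_trace_limit l : 0 < l -> {ae P, forall t, ridge_trace n l t @[n --> \oo] --> (l * v l)^-1 - 1}.
Proof.
move=> l0; have := ridge_trace_concentrates l0; apply: filterS => t t4.
have d0 : ridge_trace n l t - Ex (ridge_trace n l) @[n --> \oo] --> (0 : R).
  apply/cvgr0Pnorm_le => e e0; have e4 : 0 < e ^+ 4 by rewrite exprn_gt0.
  near=> n; rewrite -(@ler_pXn2r _ 4)// ?nnegrE ?(ltW e0)// -normrX.
  by near: n; exact: (cvgr0_norm_le _ t4 _ e4).
have e n : ridge_trace n l t = ridge_trace n l t - Ex (ridge_trace n l) + (1 + Ex (ridge_trace n l)) - 1 by ring.
rewrite (funext e) -(add0r (l * v l)^-1).
by apply: cvgB; [exact: cvgD d0 (ridge_trace_mean_limit l0)|exact: cvg_cst].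
Unshelve. all: by end_near. Qed.

(** The squared resolvent is minus the derivative of the resolvent, up to a second-order
    error uniform in [n].  It suffices to know the limits of the traces at [l] and at
    countably many [l + h k], which hold together almost surely. *)
Lemma ridge_trace2_limit l : 0 < l -> {ae P, forall t, ridge_trace2 n l t @[n --> \oo] --> risk_slope F gamma l}.
Proof.
move=> l0; pose h k := l / 2 * k.+1%:R^-1.
have hb k : 0 < h k <= l / 2.
  rewrite /h mulr_gt0 ?invr_gt0 ?ltr0n ?divr_gt0//=.
  by rewrite ler_piMr ?divr_ge0 ?(ltW l0)// invf_le1 ?ltr0n// ler1n.
have h0 : h k @[k --> \oo] --> (0 : R).
  by rewrite -(mulr0 (l / 2)); apply: cvgM; [exact: cvg_cst|exact: cvg_harmonic].
have hk k : 0 < h k by case/andP: (hb k).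
have lh k : 0 < l + h k by rewrite addr_gt0.
have := ae_foralln (fun k => ridge_trace_limit (lh k)).
have := ridge_trace_limit l0; apply: filterS2 => t tl tlh.
pose B := rho * (`|C| * (l^-1 * l^-1 * l^-1)).
have B0 : 0 <= rho * (`|C| * (l^-1 * l^-1)).
  by rewrite !mulr_ge0 ?invr_ge0 ?(ltW l0)// addr_ge0// ltW.
have slope := risk_slope_limit MP.1 l0 v_gt0 hb h0.
apply: (@cvg_of_approximations _ _ (fun k n => (ridge_trace n l t - ridge_trace n (l + h k) t) / h k) _
  (fun k => B * h k) _ _ slope).
- by rewrite -(mulr0 B); apply: cvgM => //; exact: cvg_cst.
- move=> k; rewrite (_ : _ - _ = ((l * v l)^-1 - 1) - (((l + h k) * v (l + h k))^-1 - 1)).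
    by apply: cvgM; [apply: cvgB|exact: cvg_cst].
  by rewrite opprB addrA subrK.
move=> k; near=> n.
have [n0 pn] : (0 < n)%N /\ ((p n)%:R <= rho * n%:R) by near: n; exact: p_le_rho.
have nR : 0 < n%:R :> R by rewrite ltr0n.
have Sb : opbound `|C| (Sg n).
  by rewrite -c0c0 -sqrt_sq; apply: opbound_mul; exact: sqrt_bound.
have := trace_resolvent_second_order (sample_cov_psd (Xmx (M n) t)) Sb l0 (lh k).
rewrite /ridge_trace /ridge_trace2; set x := \tr _; set y := \tr _; set z := \tr _.
rewrite (_ : l - (l + h k) = - h k); last by ring.
move=> hx; rewrite (_ : _ - _ / h k = (n%:R * h k)^-1 * (x - y - - h k * z)); last first.
  by field; rewrite !gt_eqF.
have nh : 0 < n%:R * h k by rewrite mulr_gt0.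
rewrite normrM gtr0_norm ?invr_gt0// mulrC ler_pdivrMr//; apply: le_trans hx _.
have lm : (l + h k)^-1 <= l^-1 by rewrite lef_pV2 ?posrE// lerDl ltW.
apply: (@le_trans _ _ (rho * n%:R * (`|C| * (l^-1 * l^-1 * l^-1)) * (- h k) ^+ 2)).
  have li : 0 <= l^-1 by rewrite invr_ge0 ltW.
  rewrite ler_wpM2r ?sqr_ge0//; apply: ler_pM => //.
  - by rewrite !mulr_ge0// invr_ge0 ltW.
  - by rewrite ler_wpM2l// ler_wpM2l// mulr_ge0.
by rewrite /B le_eqVlt; apply/orP; left; apply/eqP; ring.
Unshelve. all: by end_near. Qed.

(** The traces are Lipschitz in the regularization, uniformly in [n]. *)
Lemma ridge_trace_moving_limit (lam : nat -> R) (l : R) : 0 < l -> lam n @[n --> \oo] --> l ->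
  {ae P, forall t, ridge_trace n (lam n) t @[n --> \oo] --> (l * v l)^-1 - 1}.
Proof.
move=> l0 laml; have := ridge_trace_limit l0; apply: filterS => t tl.
suff d0 : ridge_trace n (lam n) t - ridge_trace n l t @[n --> \oo] --> (0 : R).
  have e n : ridge_trace n (lam n) t = ridge_trace n (lam n) t - ridge_trace n l t + ridge_trace n l t by ring.
  by rewrite (funext e) -(add0r (_ - 1)); exact: cvgD d0 tl.
pose B := rho * (`|C| * (l^-1 * (l / 2)^-1)).
have hB : B * (l - lam n) @[n --> \oo] --> (0 : R).
  rewrite -(mulr0 B) -(subrr l); apply: cvgM; first exact: cvg_cst.
  by apply: cvgB => //; exact: cvg_cst.
apply/cvgr0Pnorm_le => e e0; near=> n.
have [n0 pn] : (0 < n)%N /\ ((p n)%:R <= rho * n%:R) by near: n; exact: p_le_rho.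
have nR : 0 < n%:R :> R by rewrite ltr0n.
have l2 : 0 < l / 2 by rewrite divr_gt0.
have ln : l / 2 <= lam n by near: n; apply: (cvgr_ge _ laml); lra.
have ln0 : 0 < lam n := lt_le_trans l2 ln.
have Sb : opbound `|C| (Sg n).
  by rewrite -c0c0 -sqrt_sq; apply: opbound_mul; exact: sqrt_bound.
have := trace_resolvent_lipschitz (sample_cov_psd (Xmx (M n) t)) Sb l0 ln0.
rewrite /ridge_trace -mulrBr normrM gtr0_norm ?invr_gt0// => h.
apply: (@le_trans _ _ `|B * (l - lam n)|); last by near: n; exact: (cvgr0_norm_le _ hB).
rewrite ler_pdivrMl//; apply: le_trans h _.
have B0 : 0 <= B by rewrite !mulr_ge0 ?invr_ge0 ?(ltW l0)// ?(ltW l2)// addr_ge0// ltW.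
rewrite normrM (ger0_norm B0) [leRHS]mulrA ler_wpM2r// /B [leRHS]mulrA [n%:R * _]mulrC.
have li : 0 <= l^-1 by rewrite invr_ge0 ltW.
apply: ler_pM => //; first by rewrite !mulr_ge0// invr_ge0 ltW.
by rewrite ler_wpM2l// ler_wpM2l// lef_pV2.
Unshelve. all: by end_near. Qed.

(** At [l = gamma_n / alpha ^+ 2] the coefficient of the second trace vanishes. *)
Lemma risk_decomposition n l r : (0 < n)%N -> (0 < p n)%N -> 0 < l ->
  is_predictive_risk (M n) l r -> {ae P, forall t,
    r t = 1 + ridge_trace n l t + l * (l * alpha ^+ 2 / ((p n)%:R / n%:R) - 1) * ridge_trace2 n l t}.
Proof.
move=> n0 pn0 l0 hr.
have Zm i j := Z_moments i j.
have Z4 i j : Rintegrable (fun t => Z (M n) i j t ^+ 4) by have [] := Zm n i j.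
have Z1 i j : Ex (Z (M n) i j) = 0 by have [] := Zm n i j.
have Z2 i j : Ex (fun t => Z (M n) i j t ^+ 2) = 1 by have [] := Zm n i j.
have := predictive_risk_formula n0 l0 (M_setting n)
  (row_covariance_int (@mZ n) (Z_independent (M_setting n)) Z4)
  (row_covariance (@mZ n) (Z_independent (M_setting n)) Z1 Z2 Z4) hr.
apply: filterS => t ->; rewrite /ridge_trace /ridge_trace2 -/(Sg n).
set x := \tr _; set z := \tr _.
have p1 : (p n)%:R != 0 :> R by rewrite pnatr_eq0 -lt0n.
have n1 : n%:R != 0 :> R by rewrite pnatr_eq0 -lt0n.
by move: (n%:R : R) ((p n)%:R : R) n1 p1 => a b a0 b0; field; rewrite a0 b0.
Qed.

Lemma ridge_trace_optimality n l m t : (0 < n)%N -> 0 < l -> 0 < m ->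
  ridge_trace n m t <= ridge_trace n l t + l * (l / m - 1) * ridge_trace2 n l t.
Proof.
move=> n0 l0 m0.
have := resolvent_optimality (sample_cov_psd (Xmx (M n) t)) l0 m0 (sqrt_sym n).
rewrite sqrt_sq /ridge_trace /ridge_trace2 [_ * (n%:R^-1 * _)]mulrCA -mulrDr => h.
by rewrite ler_wpM2l// invr_ge0 ler0n.
Qed.

End RidgeSequence.
(** * The predictive risk and its limit *)

Theorem theorem2p1 (R : realType) (d : measure_display) (T : measurableType d)
    (P : probability T R)
    (p : nat -> nat) (gamma alpha C : R)
    (H F : probability (measurableTypeR R) R)
    (M : forall n, ridge_problem P n (p n))
    (r : nat -> R -> T -> R) :
  p n @[n --> \oo] --> \oo ->
  (p n)%:R / n%:R @[n --> \oo] --> gamma ->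
  0 < gamma ->
  0 < alpha ^+ 2 ->
  (forall n, ridge_setting (M n) alpha) ->
  H [set t | 0 <= t] = 1%E ->
  weakly_converges (fun n => spectral_cdf (Sigma (M n))) H ->
  marchenko_pastur gamma H F ->
  (forall n, opnorm (Sigma (M n)) <= C) ->
  (forall n i j, ('E_P[fun t => (Z (M n) i j t ^+ 12)%R] < C%:E)%E) ->
  (forall n lambda, (0 < n)%N -> 0 < lambda ->
     is_predictive_risk (M n) lambda (r n lambda)) ->
  let gamma_ n : R := (p n)%:R / n%:R in
  let lambda_ n : R := gamma_ n / alpha ^+ 2 in
  let lambdas := gamma / alpha ^+ 2 in
  [/\ forall n, (0 < n)%N -> (0 < p n)%N ->
        {ae P, forall t, r n (lambda_ n) t =
           1 + gamma_ n / (p n)%:R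
               * \tr (Sigma (M n) *m
                      invmx (sample_cov (Xmx (M n) t)
                             + (gamma_ n / alpha ^+ 2)%:M))},
      {ae P, forall t, r n (lambda_ n) t @[n --> \oo]
                       --> optimal_limit_risk gamma alpha F},
      forall lambda, 0 < lambda ->
        {ae P, forall t, r n lambda t @[n --> \oo]
                         --> limit_risk gamma alpha F lambda} &
      forall lambda, 0 < lambda ->
        limit_risk gamma alpha F lambdas <= limit_risk gamma alpha F lambda].
Proof.
move=> p_infty p_ratio g0 a0 Ms H0 SH MP SC ZC hr gamma_ lambda_ lambdas.
have aN : alpha ^+ 2 != 0 by rewrite gt_eqF.
have ls0 : 0 < lambdas by rewrite divr_gt0.
pose v := companion_real F gamma.
have v0 l : 0 < l -> 0 < v l by move=> l0; exact: companion_real_gt0 g0 H0 MP l0.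
have gam_pos n : (0 < n)%N -> (0 < p n)%N -> 0 < gamma_ n.
  by move=> n0 p0; rewrite divr_gt0// ltr0n.
have lam_pos n : (0 < n)%N -> (0 < p n)%N -> 0 < lambda_ n.
  by move=> n0 p0; rewrite divr_gt0// gam_pos.
have lam_cvg : lambda_ n @[n --> \oo] --> lambdas by apply: cvgM => //; exact: cvg_cst.
have np := p_pos p_infty.
have optimal n : (0 < n)%N -> (0 < p n)%N ->
    {ae P, forall t, r n (lambda_ n) t = 1 + ridge_trace M n (lambda_ n) t}.
  move=> n0 p0; have := risk_decomposition Ms ZC n0 p0 (lam_pos n n0 p0) (hr _ _ n0 (lam_pos n n0 p0)).
  apply: filterS => t ->; have gn := gam_pos n n0 p0.
  by rewrite -/(gamma_ n) /lambda_ mulfVK// divff ?gt_eqF// subrr mulr0 mul0r addr0.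
have limit_lambdas : limit_risk gamma alpha F lambdas = (lambdas * v lambdas)^-1.
  rewrite /limit_risk v_at_real -/(v lambdas) /lambdas mulfVK// divff ?gt_eqF//.
  by rewrite subrr mul0r addr0 mulr1.
have limitE l : 0 < l -> limit_risk gamma alpha F l =
    1 + ((l * v l)^-1 - 1) + l * (l * alpha ^+ 2 / gamma - 1) * risk_slope F gamma l.
  move=> l0; have vl := v0 l l0.
  rewrite /limit_risk v_at_real dv_at_real//; last exact: MP.1.
  by rewrite /risk_slope -/(v l); field; rewrite !gt_eqF.
have tau_star := ridge_trace_moving_limit p_infty p_ratio g0 Ms H0 SH MP SC ZC ls0 lam_cvg.
split=> [n n0 p0||l l0|l l0].
- have := optimal n n0 p0; apply: filterS => t ->.
  rewrite /ridge_trace -/(lambda_ n) /resolvent; congr (1 + _ * _).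
  by rewrite /gamma_ mulrAC divff ?mul1r// pnatr_eq0 -lt0n.
- have h : {ae P, forall t, forall n, (0 < n)%N -> (0 < p n)%N ->
      r n (lambda_ n) t = 1 + ridge_trace M n (lambda_ n) t}.
    apply: ae_foralln => n.
    have [n0|n0] := posnP n; first by apply: nearW => t; rewrite n0.
    have [p0|p0] := posnP (p n); first by apply: nearW => t n1; case: (p n) p0 => //.
    by have := optimal n n0 p0; apply: filterS => t e _ _.
  move: h tau_star; apply: filterS2 => t rE tl.
  have -> : optimal_limit_risk gamma alpha F = 1 + ((lambdas * v lambdas)^-1 - 1).
    by rewrite /optimal_limit_risk v_at_real addrC subrK.
  apply: (near_cvg (f := fun n => 1 + ridge_trace M n (lambda_ n) t)).
    by apply: cvgD => //; exact: cvg_cst.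
  near=> n.
  have [n0 p0] : (0 < n)%N /\ (0 < p n)%N by near: n; exact: np.
  by rewrite rE.
- have h : {ae P, forall t, forall n, (0 < n)%N -> (0 < p n)%N ->
      r n l t = 1 + ridge_trace M n l t + l * (l * alpha ^+ 2 / gamma_ n - 1) * ridge_trace2 M n l t}.
    apply: ae_foralln => n.
    have [n0|n0] := posnP n; first by apply: nearW => t; rewrite n0.
    have [p0|p0] := posnP (p n); first by apply: nearW => t n1; case: (p n) p0 => //.
    have := risk_decomposition Ms ZC n0 p0 l0 (hr _ _ n0 l0).
    by apply: filterS => t e _ _.
  have tl := ridge_trace_limit p_infty p_ratio g0 Ms H0 SH MP SC ZC l0.
  have tl2 := ridge_trace2_limit p_infty p_ratio g0 Ms H0 SH MP SC ZC l0.
  apply: filterS3 h tl tl2 => t rE h1 h2.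
  rewrite limitE//.
  have hl : l * (l * alpha ^+ 2 / gamma_ n - 1) @[n --> \oo] -->
      l * (l * alpha ^+ 2 / gamma - 1).
    apply: cvgM; first exact: cvg_cst.
    apply: cvgB; last exact: cvg_cst.
    apply: cvgM; first exact: cvg_cst.
    by apply: cvgV => //; rewrite gt_eqF.
  apply: (near_cvg (f := fun n =>
      1 + ridge_trace M n l t + l * (l * alpha ^+ 2 / gamma_ n - 1) * ridge_trace2 M n l t)).
    by apply: cvgD; [apply: cvgD => //; exact: cvg_cst|exact: cvgM].
  near=> n.
  have [n0 p0] : (0 < n)%N /\ (0 < p n)%N by near: n; exact: np.
  by rewrite rE.
(* The inequality holds on every sample; pass to the limit at one outcome at which all
   the traces converge. *)
- have tl := ridge_trace_limit p_infty p_ratio g0 Ms H0 SH MP SC ZC l0.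
  have tl2 := ridge_trace2_limit p_infty p_ratio g0 Ms H0 SH MP SC ZC l0.
  have [t [[h1 h2] h3]] := ae_witness (filterI (filterI tl tl2) tau_star).
  rewrite limit_lambdas limitE//.
  rewrite -addrA -lerBlDl.
  have hl : l * (l / lambda_ n - 1) @[n --> \oo] --> l * (l * alpha ^+ 2 / gamma - 1).
    have -> : l * alpha ^+ 2 / gamma = l / lambdas.
      by rewrite /lambdas invf_div [RHS]mulrA.
    apply: cvgM; first exact: cvg_cst.
    apply: cvgB; last exact: cvg_cst.
    apply: cvgM; first exact: cvg_cst.
    by apply: cvgV => //; rewrite gt_eqF.
  apply: (ler_cvg_to h3 (cvgD h1 (cvgM hl h2))); near=> n.
  have [n0 p0] : (0 < n)%N /\ (0 < p n)%N by near: n; exact: np.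
  by apply: ridge_trace_optimality => //; exact: lam_pos.
Unshelve. all: by end_near. Qed.
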